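(* Let $\boldsymbol\psi$ be a parabolic filtration of $\Phi$ of depth at most $r$ with Levi factor $\boldsymbol\phi$, let $\boldsymbol\lambda\in\mathfrak Z_{\boldsymbol\phi}^\vee$ with corresponding character $\boldsymbol\chi\colon\mathfrak l_{\boldsymbol\phi}\to\mathbb C$, and consider the opposite pair of finite generalised singularity modules $M^\pm=U\mathfrak g_r\otimes_{U\mathfrak p^\pm_{\boldsymbol\psi}}\mathbb C_{\pm\boldsymbol\chi}$ with canonical generators $w^\pm$. Then the bilinear form $\mathcal S^\iota_{\boldsymbol\chi}(\boldsymbol X,\boldsymbol Y)=\boldsymbol\chi(\pi_{\boldsymbol\phi}(\iota(\boldsymbol X)\boldsymbol Y))$ on $U\mathfrak g_r\otimes U\mathfrak g_r$ induces a well-defined (nonsymmetric) Shapovalov form $\mathcal S^\iota_{\boldsymbol\chi}\colon M^-\otimes M^+\to\mathbb C$, $\boldsymbol Xw^-\otimes\boldsymbol Yw^+\mapsto\mathcal S^\iota_{\boldsymbol\chi}(\boldsymbol X,\boldsymbol Y)$, such that: (1) $M^-$ and $M^+$ are simple if and only if both the left and the right radical of $\mathcal S^\iota_{\boldsymbol\chi}$ vanish; (2) the $\mathfrak Z_{\phi_0}$-weight-space decompositions of $M^-$ and $M^+$ are $\mathcal S^\iota_{\boldsymbol\chi}$-orthogonal: $\mathcal S^\iota_{\boldsymbol\chi}(M^-[\mu],M^+[\mu'])=0$ for all $\mu\neq\mu'$ in $Q^+_{\phi_0}$.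
   Context: $\mathfrak g$ is a complex reductive Lie algebra with Cartan subalgebra $\mathfrak t$, roots $\Phi$, root spaces $\mathfrak g_\alpha$, coroots $\alpha^\vee$. $r\ge1$, $\mathbb C_r=\mathbb C[[z]]/z^r\mathbb C[[z]]$, $\varepsilon$ = class of $z$, $\mathfrak g_r=\mathfrak g\otimes\mathbb C_r=\bigoplus_{i=0}^{r-1}\mathfrak g\varepsilon^i$. A subset $\psi\subseteq\Phi$ is parabolic if it is closed under sums within $\Phi$ and $\psi\cup(-\psi)=\Phi$. A parabolic filtration of depth at most $r$ is a sequence $\boldsymbol\psi=(\psi_i)_{i\ge0}$ of parabolic subsets with $\psi_i\subseteq\psi_{i+1}$ and $\psi_i=\Phi$ for $i\ge r$; Levi factor $\boldsymbol\phi$: $\phi_i=\psi_i\cap(-\psi_i)$; $\nu_i=\psi_i\setminus\phi_i$. Let $\mathfrak l_{\boldsymbol\phi}=\bigoplus_{i<r}(\mathfrak t\oplus\bigoplus_{\phi_i}\mathfrak g_\alpha)\varepsilon^i$, $\mathfrak u^\pm_{\boldsymbol\psi}=\bigoplus_{i<r}(\bigoplus_{\alpha\in\nu_i}\mathfrak g_{\pm\alpha})\varepsilon^i$, $\mathfrak p^\pm_{\boldsymbol\psi}=\mathfrak l_{\boldsymbol\phi}\oplus\mathfrak u^\pm_{\boldsymbol\psi}$ (Lie subalgebras). $\mathfrak Z_{\boldsymbol\phi}^\vee$ is the set of $\boldsymbol\lambda=(\lambda_0,\dots,\lambda_{r-1})\in(\mathfrak t^\vee)^r$ with $\lambda_i(\alpha^\vee)=0$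 for $\alpha\in\phi_i$; it defines a character $\boldsymbol\chi$ of $\mathfrak l_{\boldsymbol\phi}$, via $\boldsymbol\chi(X\varepsilon^i)=\lambda_i(X)$ for $X\in\mathfrak t$ and $\boldsymbol\chi=0$ on root vectors, which extends by zero to $\mathfrak p^\pm_{\boldsymbol\psi}$, and to a ring morphism $U\mathfrak l_{\boldsymbol\phi}\to\mathbb C$. $\iota$ is the antipode of $U\mathfrak g_r$ (the antiautomorphism extending $X\mapsto-X$ on $\mathfrak g_r$). In a Poincaré–Birkhoff–Witt basis of $U\mathfrak g_r$ with factors ordered as $\mathfrak u^-_{\boldsymbol\psi}$, $\mathfrak l_{\boldsymbol\phi}$, $\mathfrak u^+_{\boldsymbol\psi}$, $\pi_{\boldsymbol\phi}\colon U\mathfrak g_r\to U\mathfrak l_{\boldsymbol\phi}$ is the projection killing all basis monomials containing a factor from $\mathfrak u^\pm_{\boldsymbol\psi}$. $\mathfrak Z_{\phi_0}=\bigcap_{\alpha\in\phi_0}\ker\alpha\subseteq\mathfrak t\subseteq\mathfrak g_r$, and $Q^+_{\phi_0}\subseteq\mathfrak Z_{\phi_0}^\vee$ is the submonoid generated by the restrictions to $\mathfrak Z_{\phi_0}$ of the roots in $\nu_0$. $M^\pm[\mu]$ is the subspace of $M^\pm$ on which every $X\in\mathfrak Z_{\phi_0}$ acts by $\pm\langle\lambda_0-\mu,X\rangle$; one has $M^\pm=\bigoplus_{\mu\in Q^+_{\phi_0}}M^\pm[\mu]$. *)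

(* Defs.v *)
From HB Require Import structures.
From mathcomp Require Import all_boot all_order all_algebra.
From mathcomp Require Import generic_quotient ring_quotient finmap.
From mathcomp.classical Require Import boolp classical_sets.
From mathcomp Require Import reals complex monalg.

Set Implicit Arguments.
Unset Strict Implicit.
Unset Printing Implicit Defensive.

Import GRing.Theory.
Local Open Scope ring_scope.
Local Open Scope quotient_scope.
Local Open Scope classical_set_scope.

(** * Linear spans and quotients *)

Section LinearSpan.
Context {K : fieldType} {V : lmodType K}.
Implicit Type S : set V.

Definition lspan S : set V :=
  [set v | exists s : seq (K * V),
     (forall p, p \in s -> S p.2) /\ v = \sum_(p <- s) p.1 *: p.2].

Lemma lspan_sub S v : S v -> lspan S v.
Proof.
move=> Sv; exists [:: (1, v)]; split; last by rewrite big_seq1 scale1r.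
by move=> p; rewrite inE => /eqP ->.
Qed.

Lemma lspan0 S : lspan S 0.
Proof. by exists [::]; rewrite big_nil. Qed.

Lemma lspanD S u v : lspan S u -> lspan S v -> lspan S (u + v).
Proof.
move=> [s [Ss ->]] [s' [Ss' ->]]; exists (s ++ s'); rewrite big_cat; split=> //.
by move=> p; rewrite mem_cat => /orP[/Ss|/Ss'].
Qed.

Lemma lspanZ S a v : lspan S v -> lspan S (a *: v).
Proof.
move=> [s [Ss ->]]; exists [seq (a * p.1, p.2) | p <- s]; split.
  by move=> _ /mapP[q qs ->] /=; exact: Ss.
by rewrite big_map scaler_sumr; apply: eq_bigr => p _ /=; rewrite scalerA.
Qed.

Lemma lspan_ind S (P : set V) :
  P 0 -> (forall u v, P u -> P v -> P (u + v)) ->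
  (forall a v, P v -> P (a *: v)) -> (forall v, S v -> P v) ->
  forall v, lspan S v -> P v.
Proof.
move=> P0 PD PZ PS v [s [Ss ->]]; rewrite big_seq.
by elim/big_ind: _ => // p /Ss Sp; apply/PZ/PS.
Qed.

Definition lspan_pred S : {pred V} := fun v => `[< lspan S v >].

Lemma lspan_zmod S : zmod_closed (lspan_pred S).
Proof.
split=> [|u v /asboolP Su /asboolP Sv]; apply/asboolP; first exact: lspan0.
by rewrite -scaleN1r; apply: lspanD => //; exact: lspanZ.
Qed.

HB.instance Definition _ S :=
  GRing.isZmodClosed.Build V (lspan_pred S) (lspan_zmod S).

Definition lquot S : Type := Quotient.quot (lspan_pred S).

HB.instance Definition _ S := GRing.Zmodule.on (lquot S).
HB.instance Definition _ S := EqQuotient.on (lquot S).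

Fact lproj_key : unit. Proof. by []. Qed.

Definition lproj S : V -> lquot S :=
  locked_with lproj_key (fun v => \pi_(lquot S) v).

Lemma lprojE S v : lproj S v = \pi_(lquot S) v.
Proof. by rewrite /lproj unlock. Qed.

Lemma lprojP S u v : lproj S u = lproj S v <-> lspan S (u - v).
Proof.
rewrite !lprojE; split=> [/eqP|Suv].
  by rewrite -Quotient.idealrBE => /asboolP.
by apply/eqP; rewrite -Quotient.idealrBE; apply/asboolP.
Qed.

Lemma lprojK S (x : lquot S) : lproj S (repr x) = x.
Proof. by rewrite lprojE reprK. Qed.

Lemma lprojD S : {morph lproj S : u v / u + v}.
Proof. by move=> u v; rewrite !lprojE; exact: Quotient.pi_add. Qed.

Definition lquot_scale S (a : K) (x : lquot S) : lquot S :=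
  lproj S (a *: repr x).

Lemma lprojZ_def S a v : lquot_scale a (lproj S v) = lproj S (a *: v).
Proof.
by apply/lprojP; rewrite -scalerBr; apply/lspanZ/lprojP; rewrite lprojK.
Qed.

Lemma lquot_ind S (P : lquot S -> Prop) :
  (forall v, P (lproj S v)) -> forall x, P x.
Proof. by move=> PS x; rewrite -[x]lprojK. Qed.

Lemma lquot_scaleA S a b (x : lquot S) :
  lquot_scale a (lquot_scale b x) = lquot_scale (a * b) x.
Proof. by elim/lquot_ind: x => v; rewrite !lprojZ_def scalerA. Qed.

Lemma lquot_scale1 S : left_id 1 (@lquot_scale S).
Proof. by elim/lquot_ind => v; rewrite lprojZ_def scale1r. Qed.

Lemma lquot_scaleDr S : right_distributive (@lquot_scale S) +%R.
Proof.
move=> a; elim/lquot_ind => u; elim/lquot_ind => v.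
by rewrite -lprojD !lprojZ_def scalerDr lprojD.
Qed.

Lemma lquot_scaleDl S (x : lquot S) :
  {morph (@lquot_scale S)^~ x : a b / a + b}.
Proof.
by move=> a b; elim/lquot_ind: x => v; rewrite !lprojZ_def scalerDl lprojD.
Qed.

HB.instance Definition _ S := GRing.Zmodule_isLmodule.Build K (lquot S)
  (@lquot_scaleA S) (@lquot_scale1 S) (@lquot_scaleDr S) (@lquot_scaleDl S).

Lemma lprojZ S a v : lproj S (a *: v) = a *: lproj S v.
Proof. by rewrite -lprojZ_def. Qed.

Lemma lproj_linear S : linear (lproj S).
Proof. by move=> a u v; rewrite lprojD lprojZ. Qed.

End LinearSpan.

(** * Quotients of algebras by relations *)

Section RelationIdeal.
Context {K : fieldType} {A : algType K} (S : set A).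

Definition ideal_gens : set A := [set x | exists a r b, S r /\ x = a * r * b].

Lemma ideal_gensMl a x : lspan ideal_gens x -> lspan ideal_gens (a * x).
Proof.
move: x; apply: lspan_ind => [|u v|c v|_ [b [r [d [rel ->]]]]].
- by rewrite mulr0; exact: lspan0.
- by rewrite mulrDr; exact: lspanD.
- by rewrite -scalerAr; exact: lspanZ.
- by rewrite !mulrA; apply: lspan_sub; exists (a * b), r, d.
Qed.

Lemma ideal_gensMr a x : lspan ideal_gens x -> lspan ideal_gens (x * a).
Proof.
move: x; apply: lspan_ind => [|u v|c v|_ [b [r [d [rel ->]]]]].
- by rewrite mul0r; exact: lspan0.
- by rewrite mulrDl; exact: lspanD.
- by rewrite -scalerAl; exact: lspanZ.
- by rewrite -(mulrA _ d a); apply: lspan_sub; exists b, r, (d * a).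
Qed.

Local Notation Q := (lquot ideal_gens).
Local Notation pr := (lproj ideal_gens).

Let Q_ind (P : Q -> Prop) : (forall x, P (pr x)) -> forall x, P x.
Proof. exact: lquot_ind. Qed.

Definition alg_one : Q := pr 1.
Definition alg_mul (x y : Q) : Q := pr (repr x * repr y).

Lemma alg_mulE x y : alg_mul (pr x) (pr y) = pr (x * y).
Proof.
apply/lprojP; set x' := repr _; set y' := repr _.
have -> : x' * y' - x * y = x' * (y' - y) + (x' - x) * y.
  by rewrite mulrBr mulrBl addrA subrK.
by apply: lspanD; [apply: ideal_gensMl|apply: ideal_gensMr];
  apply/lprojP; rewrite lprojK.
Qed.

Lemma alg_mulA : associative alg_mul.
Proof.
elim/Q_ind=> x; elim/Q_ind=> y; elim/Q_ind=> z.
by rewrite !alg_mulE mulrA.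
Qed.

Lemma alg_mul1l : left_id alg_one alg_mul.
Proof. by elim/Q_ind=> x; rewrite alg_mulE mul1r. Qed.

Lemma alg_mul1r : right_id alg_one alg_mul.
Proof. by elim/Q_ind=> x; rewrite alg_mulE mulr1. Qed.

Lemma alg_mulDl : left_distributive alg_mul +%R.
Proof.
elim/Q_ind=> x; elim/Q_ind=> y; elim/Q_ind=> z.
by rewrite -lprojD !alg_mulE mulrDl lprojD.
Qed.

Lemma alg_mulDr : right_distributive alg_mul +%R.
Proof.
elim/Q_ind=> x; elim/Q_ind=> y; elim/Q_ind=> z.
by rewrite -lprojD !alg_mulE mulrDr lprojD.
Qed.

Lemma alg_scaleAl a (x y : Q) : a *: alg_mul x y = alg_mul (a *: x) y.
Proof.
elim/Q_ind: x => x; elim/Q_ind: y => y.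
by rewrite alg_mulE -!lprojZ alg_mulE scalerAl.
Qed.

Lemma alg_scaleAr a (x y : Q) : a *: alg_mul x y = alg_mul x (a *: y).
Proof.
elim/Q_ind: x => x; elim/Q_ind: y => y.
by rewrite alg_mulE -!lprojZ alg_mulE scalerAr.
Qed.

(* A character of [A] killing the relations witnesses that the quotient is
   not the zero ring. *)
Lemma alg_one_neq0 (e : A -> K) : linear_for *%R e -> monoid_morphism e ->
  (forall r, S r -> e r = 0) -> alg_one != 0.
Proof.
move=> elin [e1 eM] eS.
have e0 : e 0 = 0.
  have := elin 0 0 0; rewrite scale0r addr0 mul0r add0r => h.
  by have := elin (-1) 0 0; rewrite scaler0 addr0 mulN1r addNr.
have eD u v : e (u + v) = e u + e v by rewrite -[u]scale1r elin mul1r scale1r.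
have eZ a u : e (a *: u) = a * e u by rewrite -[a *: u]addr0 elin e0 addr0.
have ker x : lspan ideal_gens x -> e x = 0.
  move: x; apply: lspan_ind => // [u v|a v|_ [b [r [d [/eS r0 ->]]]]].
  - by rewrite eD => -> ->; rewrite addr0.
  - by rewrite eZ => ->; rewrite mulr0.
  - by rewrite !eM r0 mulr0 mul0r.
apply/eqP => one0; have /lprojP/ker : pr 1 = pr 0.
  by rewrite -[LHS]/alg_one one0; apply: (addrI (pr 0)); rewrite -lprojD !addr0.
by rewrite subr0 e1 => /eqP; rewrite oner_eq0.
Qed.

End RelationIdeal.

(** * Free algebras *)

Section FreeAlgebra.
Context {K : fieldType} (V : choiceType).

Definition free_alg : Type := {malg K[{fmonom V}]}.

HB.instance Definition _ := GRing.Lmodule.on free_alg.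

Fact free_alg_key : unit. Proof. by []. Qed.

(* The operations and generators are locked, since unification would otherwise
   unfold them. *)
Definition free_mul : free_alg -> free_alg -> free_alg :=
  locked_with free_alg_key
    (fun x y => (x : {malg K[{fmonom V}]}) * (y : {malg K[{fmonom V}]})).
Definition free_one : free_alg :=
  locked_with free_alg_key (1 : {malg K[{fmonom V}]}).

Lemma free_mulE : free_mul = @GRing.mul {malg K[{fmonom V}]}.
Proof. by rewrite /free_mul unlock. Qed.

Lemma free_oneE : free_one = (1 : {malg K[{fmonom V}]}).
Proof. by rewrite /free_one unlock. Qed.

Lemma free_mulA : associative free_mul.
Proof. by rewrite free_mulE; exact: mulrA. Qed.
Lemma free_mul1l : left_id free_one free_mul.
Proof. by rewrite free_mulE free_oneE; exact: mul1r. Qed.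
Lemma free_mul1r : right_id free_one free_mul.
Proof. by rewrite free_mulE free_oneE; exact: mulr1. Qed.
Lemma free_mulDl : left_distributive free_mul +%R.
Proof. by rewrite free_mulE; exact: mulrDl. Qed.
Lemma free_mulDr : right_distributive free_mul +%R.
Proof. by rewrite free_mulE; exact: mulrDr. Qed.
Lemma free_oner_neq0 : free_one != 0.
Proof. by rewrite free_oneE; exact: oner_neq0. Qed.

HB.instance Definition _ := GRing.Zmodule_isNzRing.Build free_alg
  free_mulA free_mul1l free_mul1r free_mulDl free_mulDr free_oner_neq0.

Lemma free_scaleAl a (x y : free_alg) :
  a *: free_mul x y = free_mul (a *: x) y.
Proof. by rewrite free_mulE; exact: scalerAl. Qed.

HB.instance Definition _ :=
  GRing.Lmodule_isLalgebra.Build K free_alg free_scaleAl.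

Lemma free_scaleAr a (x y : free_alg) :
  a *: free_mul x y = free_mul x (a *: y).
Proof.
rewrite free_mulE.
suff h (u v : {malg K[{fmonom V}]}) : a *: (u * v) = u * (a *: v) by exact: h.
move: u v => {}x {}y.
have xa : x * malgC a = a *: x :> {malg K[{fmonom V}]}.
  rewrite malgM_def fgmulgU.
  by apply: eq_bigr => m _; rewrite mulm1 mulrC.
by rewrite -(mul_malgC a y) (mulrA x (malgC a) y) xa; exact: scalerAl.
Qed.

HB.instance Definition _ :=
  GRing.Lalgebra_isAlgebra.Build K free_alg free_scaleAr.

Lemma free_mulrE (x y : free_alg) :
  x * y = @GRing.mul {malg K[{fmonom V}]} x y.
Proof. by rewrite -[LHS]/(free_mul x y) free_mulE. Qed.

Definition fgen : V -> free_alg :=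
  locked_with free_alg_key (fun v => << fmu v >>).

Lemma fgenE v : fgen v = << fmu v >>.
Proof. by rewrite /fgen unlock. Qed.

(* Images of [x] under the algebra morphism, resp. anti-morphism, from the free
   algebra to [A] that sends each generator [v] to [f v]. *)
Definition free_lift (A : algType K) (f : V -> A) (x : free_alg) : A :=
  mmap (in_alg A) (fun m : {fmonom V} => \prod_(v <- (m : seq V)) f v) x.

Definition free_antilift (A : algType K) (f : V -> A) (x : free_alg) : A :=
  mmap (in_alg A) (fun m : {fmonom V} => \prod_(v <- rev m) f v) x.

Definition free_aug (x : free_alg) : K := mcoeff mone x.

Lemma free_aug_linear : linear_for *%R free_aug.
Proof. by move=> a x y; rewrite /free_aug mcoeffD mcoeffZ. Qed.

Lemma free_aug_morph : monoid_morphism free_aug.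
Proof.
split; first by rewrite [1]free_oneE; exact: rmorph1.
by move=> x y; rewrite free_mulrE; exact: rmorphM.
Qed.

Lemma free_aug_gen v : free_aug (fgen v) = 0.
Proof.
rewrite fgenE /free_aug mcoeffU1 -[mone]/(fmone V).
by case: eqP => // /(congr1 (@fmonom_val _)); rewrite fmuE fmoneE.
Qed.

Section Lift.
Context {A : algType K}.

Lemma mmap_linear (h : {fmonom V} -> A) :
  linear (mmap (in_alg A) h : free_alg -> A).
Proof.
move=> a x y; rewrite mmapD; congr (_ + _).
rewrite (mmapEw (msuppZ_le _ _)) mmapE scaler_sumr /=.
by apply: eq_bigr => k _; rewrite mcoeffZ !mulr_algl scalerA.
Qed.

Lemma free_lift_linear (f : V -> A) : linear (free_lift f).
Proof. exact: mmap_linear. Qed.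

Lemma free_antilift_linear (f : V -> A) : linear (free_antilift f).
Proof. exact: mmap_linear. Qed.

Lemma free_lift_gen (f : V -> A) v : free_lift f (fgen v) = f v.
Proof. by rewrite fgenE /free_lift mmapU /= fmuE big_seq1 scale1r mul1r. Qed.

Lemma free_antilift_gen (f : V -> A) v : free_antilift f (fgen v) = f v.
Proof.
by rewrite fgenE /free_antilift mmapU /= fmuE big_seq1 scale1r mul1r.
Qed.

Lemma free_lift1 (f : V -> A) : free_lift f 1 = 1.
Proof.
rewrite [1]free_oneE /free_lift mmapU /= scale1r mul1r.
by rewrite -[mone]/(fmone V) fmoneE big_nil.
Qed.

Lemma free_antilift1 (f : V -> A) : free_antilift f 1 = 1.
Proof.
rewrite [1]free_oneE /free_antilift mmapU /= scale1r mul1r.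
by rewrite -[mone]/(fmone V) fmoneE big_nil.
Qed.

Lemma free_liftM (f : V -> A) x y :
  free_lift f (x * y) = free_lift f x * free_lift f y.
Proof.
rewrite free_mulrE /free_lift malgME raddf_sum mulr_suml /=.
apply: eq_bigr=> i _.
rewrite raddf_sum mulr_sumr /=; apply: eq_bigr=> j _.
rewrite mmapU /= -[mul i j]/(fmmul i j) fmmulE big_cat /=.
by rewrite !mulr_algl -scalerAl -scalerAr scalerA.
Qed.

Lemma free_antiliftM (f : V -> A) x y :
  free_antilift f (x * y) = free_antilift f y * free_antilift f x.
Proof.
rewrite free_mulrE /free_antilift malgME raddf_sum mulr_sumr /=.
apply: eq_bigr=> i _.
rewrite raddf_sum mulr_suml /=; apply: eq_bigr=> j _.
rewrite mmapU /= -[mul i j]/(fmmul i j) fmmulE rev_cat big_cat /=.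
by rewrite !mulr_algl -scalerAl -scalerAr scalerA mulrC.
Qed.

End Lift.
End FreeAlgebra.

(* Stated over abstract structures to keep conversion away from the concrete
   operations of [free_alg]. *)
Section LinearValues.
Context {K : fieldType} {U W : lmodType K} (f : U -> W).
Hypothesis flin : linear f.

Lemma linear_val0 : f 0 = 0.
Proof.
have := flin (-1) 0 0; rewrite scaler0 addr0 => ->.
by rewrite scaleN1r addNr.
Qed.

Lemma linear_valD x y : f (x + y) = f x + f y.
Proof. by rewrite -[x]scale1r flin !scale1r. Qed.

Lemma linear_valZ a x : f (a *: x) = a *: f x.
Proof. by rewrite -[a *: x]addr0 flin linear_val0 addr0. Qed.

Lemma linear_valB x y : f (x - y) = f x - f y.
Proof. by rewrite -scaleN1r linear_valD linear_valZ scaleN1r. Qed.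

Lemma linear_valBB x y z : f (x - y - z) = f x - f y - f z.
Proof. by rewrite !linear_valB. Qed.

Lemma linear_valBZD a x y z : f (x - (a *: y + z)) = f x - (a *: f y + f z).
Proof. by rewrite linear_valB flin. Qed.

End LinearValues.

(** * Enveloping algebras *)

Section Enveloping.
Context {K : fieldType} {V : lmodType K} (br : V -> V -> V).

Local Notation F := (@free_alg K V).

(* The tensor algebra of [V] is the free algebra on the set [V] modulo
   linearity of [fgen]. *)
Definition env_relations : set F :=
  [set x | (exists a u v, x = fgen (a *: u + v) - (a *: fgen u + fgen v)) \/
           (exists u v,
              x = fgen u * fgen v - fgen v * fgen u - fgen (br u v))].

Definition env : Type := lquot (ideal_gens env_relations).

Definition env_proj : F -> env := lproj (ideal_gens env_relations).

HB.instance Definition _ := GRing.Lmodule.on env.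

Lemma env_one_neq0 : alg_one env_relations != 0.
Proof.
apply: (alg_one_neq0 (@free_aug_linear K V) (@free_aug_morph K V)).
have [e1 eM] := @free_aug_morph K V.
have elin : linear (@free_aug K V : F -> K^o) by exact: free_aug_linear.
move=> _ [[a [u [v ->]]]|[u [v ->]]].
  apply: (etrans (linear_valBZD elin _ _ _ _)).
  have g := @free_aug_gen K V.
  by rewrite (g (_ + _)) (g u) (g v) scaler0 addr0 subr0.
apply: (etrans (linear_valBB elin _ _ _)).
have g := @free_aug_gen K V.
rewrite (eM (fgen u) (fgen v)) (eM (fgen v) (fgen u)) (g (br u v)) (g u).
by rewrite mulr0 mul0r !subr0.
Qed.

HB.instance Definition _ := GRing.Zmodule_isNzRing.Build env
  (@alg_mulA _ _ env_relations) (@alg_mul1l _ _ env_relations)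
  (@alg_mul1r _ _ env_relations) (@alg_mulDl _ _ env_relations)
  (@alg_mulDr _ _ env_relations) env_one_neq0.
HB.instance Definition _ := GRing.Lmodule_isLalgebra.Build K env
  (@alg_scaleAl _ _ env_relations).
HB.instance Definition _ := GRing.Lalgebra_isAlgebra.Build K env
  (@alg_scaleAr _ _ env_relations).

Definition env_gen (v : V) : env := env_proj (fgen v).

(* When [f] is linear and maps [br] to the commutator (resp. to its opposite),
   these are the morphism and the anti-morphism of algebras extending [f]. *)
Definition env_lift (A : algType K) (f : V -> A) (x : env) : A :=
  free_lift f (repr x).

Definition env_antilift (A : algType K) (f : V -> A) (x : env) : A :=
  free_antilift f (repr x).

Definition antipode : env -> env := env_antilift (fun v => - env_gen v).

Lemma env_ind (P : env -> Prop) :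
  (forall x, P (env_proj x)) -> forall x, P x.
Proof. exact: lquot_ind. Qed.

Lemma env_proj_linear : linear env_proj.
Proof. exact: lproj_linear. Qed.

Lemma env_projM x y : env_proj (x * y) = env_proj x * env_proj y.
Proof. by rewrite -[RHS]/(alg_mul _ _) alg_mulE. Qed.

Lemma env_proj_eq x y : lspan (ideal_gens env_relations) (x - y) ->
  env_proj x = env_proj y.
Proof. by move=> h; apply/lprojP. Qed.

Lemma env_gen_linear : linear env_gen.
Proof.
move=> a u v; rewrite /env_gen -env_proj_linear; apply/env_proj_eq/lspan_sub.
by exists 1, (fgen (a *: u + v) - (a *: fgen u + fgen v)), 1;
  split; [left; exists a, u, v | rewrite mul1r mulr1].
Qed.

Lemma env_gen_br u v :
  env_gen (br u v) = env_gen u * env_gen v - env_gen v * env_gen u.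
Proof.
have -> : env_gen u * env_gen v - env_gen v * env_gen u =
          env_proj (fgen u * fgen v - fgen v * fgen u).
  by rewrite -!env_projM addrC -scaleN1r -env_proj_linear scaleN1r addrC.
apply/esym/env_proj_eq/lspan_sub.
exists 1, (fgen u * fgen v - fgen v * fgen u - fgen (br u v)), 1; split.
  by right; exists u, v.
by rewrite mul1r mulr1.
Qed.

Section Factor.
Context {A : algType K} (ev : F -> A).
Hypothesis evlin : linear ev.

Lemma env_factor :
    (forall a r b, env_relations r -> ev (a * r * b) = 0) ->
  forall x, ev (repr (env_proj x)) = ev x.
Proof.
move=> evr x; apply/eqP; rewrite -subr_eq0 -(linear_valB evlin); apply/eqP.
have : lspan (ideal_gens env_relations) (repr (env_proj x) - x).
  exact/lprojP/lprojK.
move: (_ - x); apply: lspan_ind => [|u v|a v|_ [b [r [d [rel ->]]]]].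
- exact: (linear_val0 evlin).
- by move=> eu ev'; rewrite (linear_valD evlin) eu ev' addr0.
- by move=> ev'; rewrite (linear_valZ evlin) ev' scaler0.
- exact: evr.
Qed.

Lemma ev_relations (f : V -> A) r : linear f ->
    (forall v, ev (fgen v) = f v) ->
    (forall u v, ev (fgen u * fgen v) - ev (fgen v * fgen u) = f (br u v)) ->
  env_relations r -> ev r = 0.
Proof.
move=> flin evgen evbr [[a [u [v ->]]]|[u [v ->]]].
  apply: (etrans (linear_valBZD evlin _ _ _ _)).
  by rewrite 3!evgen flin subrr.
apply: (etrans (linear_valBB evlin _ _ _)).
by rewrite evbr evgen subrr.
Qed.

End Factor.

Lemma env_liftP (A : algType K) (f : V -> A) :
    linear f -> (forall u v, f (br u v) = f u * f v - f v * f u) ->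
  [/\ linear (env_lift f), monoid_morphism (env_lift f)
    & forall v, env_lift f (env_gen v) = f v].
Proof.
move=> flin fbr.
have E x : env_lift f (env_proj x) = free_lift f x.
  apply: env_factor; first exact: free_lift_linear.
  move=> a r b rel; rewrite 2!free_liftM.
  suff -> : free_lift f r = 0 by rewrite mulr0 mul0r.
  apply: (ev_relations (free_lift_linear f) flin) rel => [v|u v].
    exact: free_lift_gen.
  by rewrite 2!free_liftM 2!free_lift_gen fbr.
split=> [a|| v]; last by rewrite E free_lift_gen.
  elim/env_ind => x; elim/env_ind => y.
  by rewrite -env_proj_linear !E free_lift_linear.
split; first by rewrite -[1]/(env_proj 1) E free_lift1.
by elim/env_ind => x; elim/env_ind => y; rewrite -env_projM !E free_liftM.
Qed.

Lemma antipodeP :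
  [/\ linear antipode, antipode 1 = 1,
      forall x y, antipode (x * y) = antipode y * antipode x
    & forall v, antipode (env_gen v) = - env_gen v].
Proof.
pose f v := - env_gen v.
have flin : linear f.
  by move=> a u v; rewrite /f env_gen_linear opprD scalerN.
have E x : antipode (env_proj x) = free_antilift f x.
  apply: (env_factor (free_antilift_linear f)) => a r b rel.
  rewrite 2!free_antiliftM.
  suff -> : free_antilift f r = 0 by rewrite mul0r mulr0.
  apply: (ev_relations (free_antilift_linear f) flin) rel => [v|u v].
    exact: free_antilift_gen.
  by rewrite 2!free_antiliftM 2!free_antilift_gen /f env_gen_br 2!mulrNN opprB.
split=> [a|||v]; last by rewrite E free_antilift_gen.
- elim/env_ind => x; elim/env_ind => y.
  rewrite (E x) (E y); move: (E (a *: x + y)).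
  by rewrite env_proj_linear free_antilift_linear.
- by rewrite -[1]/(env_proj 1) E free_antilift1.
- by elim/env_ind => x; elim/env_ind => y; rewrite -env_projM !E free_antiliftM.
Qed.

End Enveloping.

(** * Induced modules *)

Section Induction.
Context {K : fieldType} {A B : algType K} (j : B -> A)
  {N : lmodType K} (act : B -> N -> N).

Local Notation F := {malg K[(A * N)%type]}.

Definition tgen (a : A) (n : N) : F := << (a, n) >>.

Definition tensor_relations : set F :=
  [set x |
    [\/ exists c a a' n, x = tgen (c *: a + a') n - (c *: tgen a n + tgen a' n),
        exists c a n n', x = tgen a (c *: n + n') - (c *: tgen a n + tgen a n')
      | exists a b n, x = tgen (a * j b) n - tgen a (act b n)]].

(* The tensor product of [A], a right [B]-module through [j], and the left
   [B]-module [N] whose action is [act]. *)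
Definition induced : Type := lquot tensor_relations.

HB.instance Definition _ := GRing.Lmodule.on induced.

Definition tensor (a : A) (n : N) : induced :=
  lproj tensor_relations (tgen a n).

(* Left multiplication by [a] on the first tensor factor. *)
Definition free_act (a : A) (x : F) : F :=
  \sum_(k <- msupp x) << mcoeff k x *g (a * k.1, k.2) >>.

Definition induced_act (a : A) (m : induced) : induced :=
  lproj tensor_relations (free_act a (repr m)).

Lemma malgU_linear (M : choiceType) (k : M) c u v :
  << c * u + v *g k >> = c *: << u *g k >> + << v *g k >> :> {malg K[M]}.
Proof.
apply/malgP => l; rewrite mcoeffD mcoeffZ 3!mcoeffU.
by case: eqP => _; rewrite ?mulr1n ?mulr0n ?mulr0 ?addr0.
Qed.

Lemma free_actEw a (d : {fset A * N}) x : (msupp x `<=` d)%fset ->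
  free_act a x = \sum_(k <- d) << mcoeff k x *g (a * k.1, k.2) >>.
Proof.
move=> le; rewrite [LHS](big_fset_incl _ le) => //= k _ /mcoeff_outdom ->.
exact: monalgU0.
Qed.

Lemma free_act_linear a : linear (free_act a).
Proof.
move=> c x y; set d := (msupp x `|` msupp y)%fset.
have dx : (msupp x `<=` d)%fset := fsubsetUl _ _.
have dy : (msupp y `<=` d)%fset := fsubsetUr _ _.
have dxy : (msupp (c *: x + y) `<=` d)%fset.
  apply: (fsubset_trans (msuppD_le _ _)).
  by rewrite fsubUset dy (fsubset_trans (msuppZ_le _ _)).
rewrite (free_actEw a dx) (free_actEw a dy) (free_actEw a dxy).
rewrite scaler_sumr -big_split /=; apply: eq_bigr => k _.
by rewrite mcoeffD mcoeffZ; exact: malgU_linear.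
Qed.

Lemma free_act_gen a b n : free_act a (tgen b n) = tgen (a * b) n.
Proof. by rewrite (free_actEw a msuppU_le) big_seq_fset1 mcoeffUU. Qed.

Lemma free_act_ker a x :
  lspan tensor_relations x -> lspan tensor_relations (free_act a x).
Proof.
have flin := free_act_linear a.
move: x; apply: lspan_ind => [|u v|c v|x].
- by rewrite (linear_val0 flin); exact: lspan0.
- by rewrite (linear_valD flin); exact: lspanD.
- by rewrite (linear_valZ flin); exact: lspanZ.
case=> [[c [b [b' [n ->]]]]|[c [b [n [n' ->]]]]|[b [d [n ->]]]];
  apply: lspan_sub.
- rewrite (linear_valBZD flin) !free_act_gen mulrDr -scalerAr.
  by constructor 1; exists c, (a * b), (a * b'), n.
- by rewrite (linear_valBZD flin) !free_act_gen; constructor 2;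
    exists c, (a * b), n, n'.
- by rewrite (linear_valB flin) !free_act_gen mulrA; constructor 3;
    exists (a * b), d, n.
Qed.

Lemma induced_act_proj a x :
  induced_act a (lproj tensor_relations x) =
  lproj tensor_relations (free_act a x).
Proof.
apply/lprojP; rewrite -(linear_valB (free_act_linear a)).
by apply/free_act_ker/lprojP; rewrite lprojK.
Qed.

Lemma induced_act_linear a : linear (induced_act a).
Proof.
move=> c x y.
have -> : c *: x + y = lproj tensor_relations (c *: repr x + repr y).
  by rewrite lproj_linear 2!lprojK.
by rewrite induced_act_proj free_act_linear; exact: lproj_linear.
Qed.

Lemma induced_act_tensor a b n :
  induced_act a (tensor b n) = tensor (a * b) n.
Proof. by rewrite induced_act_proj free_act_gen. Qed.

Lemma tensor_balanced a b n : tensor (a * j b) n = tensor a (act b n).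
Proof. by apply/lprojP/lspan_sub; constructor 3; exists a, b, n. Qed.

End Induction.

(** * Lie algebras *)

Section LieAlgebra.
Context {K : fieldType} {g : vectType K} (br : g -> g -> g).

Record is_lie_bracket : Prop := IsLieBracket {
  lie_linearl : forall y, linear (br^~ y);
  lie_linearr : forall x, linear (br x);
  lie_alternating : forall x, br x x = 0;
  lie_jacobi : forall x y z,
    br x (br y z) + br y (br z x) + br z (br x y) = 0
}.

Definition is_ideal (W : {vspace g}) : Prop :=
  forall x y, y \in W -> br x y \in W.

(* The adjoint representation is semisimple. *)
Definition is_reductive : Prop :=
  forall W, is_ideal W ->
  exists W', [/\ is_ideal W', (W + W' = fullv)%VS & (W :&: W' = 0)%VS].

Definition ad_diagonalizable (h : g) : Prop :=
  exists b : seq g, basis_of fullv b /\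
    forall x, x \in b -> exists a, br h x = a *: x.

Definition is_cartan (t : {vspace g}) : Prop :=
  [/\ forall h h', h \in t -> h' \in t -> br h h' = 0,
      forall x, (forall h, h \in t -> br h x = 0) -> x \in t
    & forall h, h \in t -> ad_diagonalizable h].

Definition sub_br (W : {vspace g}) (x y : subvs_of W) : subvs_of W :=
  vsproj W (br (vsval x) (vsval y)).

(* Monomials [b_0 ^ e_0 * b_1 ^ e_1 * ...] in the enveloping algebra. *)
Definition ordered_monomial (b : seq g) (e : nat -> nat) : env br :=
  \prod_(i < size b) env_gen br b`_i ^+ e i.

End LieAlgebra.

Definition vspan {K : fieldType} {V : vectType K} (S : set V) : {vspace V} :=
  xget 0%VS [set W : {vspace V} | forall v, v \in W <-> lspan S v].

(** * Roots *)

Section Roots.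
Context {K : fieldType} {g : vectType K} (br : g -> g -> g) (t : {vspace g}).

Definition tdual : vectType K := 'Hom(subvs_of t, K^o).

Definition root_space (alpha : tdual) : set g :=
  [set x | forall h : subvs_of t, br (vsval h) x = alpha h *: x].

Definition root_set : set tdual :=
  [set alpha | alpha != 0 /\ exists2 x, root_space alpha x & x != 0].

Definition coroot (alpha : tdual) : subvs_of t :=
  xget 0 [set h : subvs_of t |
    lspan [set z | exists x y,
             [/\ root_space alpha x, root_space (- alpha) y & z = br x y]]
          (vsval h) /\
    alpha h = 2].

(* Projection onto [t] along the sum of the root spaces. *)
Definition cartan_proj (x : g) : subvs_of t :=
  vsproj t (daddv_pi t
    (vspan [set y | exists2 alpha, root_set alpha & root_space alpha y]) x).

Definition is_parabolic (psi : set tdual) : Prop :=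
  [/\ psi `<=` root_set,
      forall alpha beta, psi alpha -> psi beta -> root_set (alpha + beta) ->
        psi (alpha + beta)
    & [set alpha | psi alpha \/ psi (- alpha)] = root_set].

Definition is_parabolic_filtration (r : nat) (psi : nat -> set tdual) : Prop :=
  [/\ forall i, is_parabolic (psi i),
      forall i, psi i `<=` psi i.+1
    & forall i, (r <= i)%N -> psi i = root_set].

Definition levi_factor (psi : nat -> set tdual) (i : nat) : set tdual :=
  [set alpha | psi i alpha /\ psi i (- alpha)].

Definition nilradical_roots (psi : nat -> set tdual) (i : nat) : set tdual :=
  psi i `\` levi_factor psi i.

(* The subspace of [t] killed by the roots in [phi], and restriction to it. *)
Definition common_kernel (phi : set tdual) : {vspace subvs_of t} :=
  vspan [set h | forall alpha, phi alpha -> alpha h = 0].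

Definition restrict_root (Z : {vspace subvs_of t}) (alpha : tdual) :
    'Hom(subvs_of Z, K^o) :=
  (alpha \o linfun vsval)%VF.

Definition weight_monoid (psi : nat -> set tdual) :
    set 'Hom(subvs_of (common_kernel (levi_factor psi 0%N)), K^o) :=
  [set mu | exists s : seq tdual,
     (forall alpha, alpha \in s -> nilradical_roots psi 0%N alpha) /\
     mu = \sum_(alpha <- s) restrict_root _ alpha].

End Roots.

(** * Truncated current algebras and singularity modules *)

Section Singularity.
Context {K : fieldType} {g : vectType K} (br : g -> g -> g) (t : {vspace g}).
Context {r : nat}.

(* [x i] is the coefficient of the [i]-th power of the truncated variable. *)
Definition current : vectType K := {ffun 'I_r -> g}.

Definition current_br (x y : current) : current :=
  [ffun k : 'I_r => \sum_(i < r) \sum_(j < r | (i + j == k)%N) br (x i) (y j)].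

Definition eps (i : 'I_r) (x : g) : current :=
  [ffun k => if k == i then x else 0].

Local Notation tdual := (tdual t).
Context (psi : nat -> set tdual) (lam : 'I_r -> tdual).
Local Notation phi := (levi_factor psi).
Local Notation nu := (nilradical_roots psi).

Definition levi : {vspace current} :=
  vspan [set v | exists i x, v = eps i x /\
    (x \in t \/ exists2 alpha, phi i alpha & root_space br alpha x)].

(* Here and below, [b = false] stands for the sign [+] and [b = true] for the
   sign [-]. *)
Definition nilradical (b : bool) : {vspace current} :=
  vspan [set v | exists i x, v = eps i x /\
    exists2 alpha, nu i alpha & root_space br ((-1) ^+ b *: alpha) x].

Definition parabolic (b : bool) : {vspace current} := (levi + nilradical b)%VS.

Definition in_levi_dual : Prop :=
  forall (i : 'I_r) alpha, phi i alpha -> lam i (coroot br alpha) = 0.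

(* On [levi] this is the character given by [lam], on [parabolic b] its
   extension by zero. *)
Definition chi (x : current) : K :=
  \sum_(i < r) lam i (cartan_proj br t (x i)).

Definition Ucurrent := env current_br.
Definition Ulevi := env (sub_br current_br (W := levi)).
Definition Uparabolic b := env (sub_br current_br (W := parabolic b)).

Definition chi_Ulevi : Ulevi -> K^o :=
  env_lift (fun x : subvs_of levi => chi (vsval x) : K^o).

Definition chi_Uparabolic b : Uparabolic b -> K^o :=
  env_lift (fun x : subvs_of (parabolic b) => (-1) ^+ b * chi (vsval x) : K^o).

Definition Uparabolic_incl b : Uparabolic b -> Ucurrent :=
  env_lift (fun x : subvs_of (parabolic b) => env_gen current_br (vsval x)).

Definition singularity_module b : lmodType K :=
  induced (@Uparabolic_incl b) (fun y (c : K^o) => chi_Uparabolic y * c).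

Definition generator b : singularity_module b := tensor _ _ 1 1.

Definition module_action b (X : Ucurrent) (m : singularity_module b) :
    singularity_module b :=
  induced_act X m.

Definition is_submodule b (W : set (singularity_module b)) : Prop :=
  [/\ W 0, forall a u v, W u -> W v -> W (a *: u + v)
    & forall X v, W v -> W (module_action X v)].

Definition is_simple b : Prop :=
  (exists m : singularity_module b, m != 0) /\
  forall W : set (singularity_module b),
    is_submodule W -> W = [set 0] \/ W = setT.

(* [bm], [bl] and [bp] are meant to be bases of [nilradical true], [levi] and
   [nilradical false]; a basis monomial is given by its exponents. *)
Definition is_pbw_projection (bm : seq current) (bl : seq (subvs_of levi))
    (bp : seq current) (pi : Ucurrent -> Ulevi) : Prop :=
  linear pi /\
  forall em el ep : nat -> nat,
    pi (ordered_monomial current_br bm em *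
        ordered_monomial current_br [seq vsval x | x <- bl] el *
        ordered_monomial current_br bp ep) =
    if [forall i : 'I_(size bm), em i == 0%N] &&
       [forall i : 'I_(size bp), ep i == 0%N]
    then ordered_monomial (sub_br current_br (W := levi)) bl el else 0.

(* By the Poincare-Birkhoff-Witt theorem there is exactly one such map. *)
Definition pbw_projection bm bl bp : Ucurrent -> Ulevi :=
  if pselect (exists pi, is_pbw_projection bm bl bp pi) is left ex
  then sval (cid ex) else fun=> 0.

Definition shapovalov bm bl bp (X Y : Ucurrent) : K :=
  chi_Ulevi (pbw_projection bm bl bp (antipode X * Y)).

Local Notation center := (common_kernel (phi 0%N)).

Definition weight_space (r_gt0 : (0 < r)%N) b
    (mu : 'Hom(subvs_of center, K^o)) : set (singularity_module b) :=
  let i0 := Ordinal r_gt0 in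
  [set m | forall X : subvs_of center,
     module_action (env_gen current_br (eps i0 (vsval (vsval X)))) m =
     ((-1) ^+ b * (lam i0 (vsval X) - mu X)) *: m].

End Singularity.

Arguments current {K} g r.
Arguments Ucurrent {K g} br r.
Arguments levi {K g} br [t] r psi.
Arguments nilradical {K g} br [t] r psi b.
Arguments weight_monoid {K g} [t] psi _.
Arguments weight_space {K g} br {t r psi} lam r_gt0 b mu _.

(* Main.v *)
From HB Require Import structures.
Require Import Defs.
From mathcomp Require Import all_boot all_order all_algebra.
From mathcomp Require Import finmap.
From mathcomp.classical Require Import boolp classical_sets.
From mathcomp Require Import reals complex monalg.
From mathcomp Require Import ring.

Set Implicit Arguments.
Unset Strict Implicit.
Unset Printing Implicit Defensive.

Import Order.TTheory GRing.Theory Num.Theory.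
Local Open Scope ring_scope.
Local Open Scope classical_set_scope.
Local Open Scope complex_scope.

(** The form is [S (X w^-) (Y w^+) = P (iota X * Y)], where [P] is the character of
    the Levi factor composed with the projection of the enveloping algebra, and all
    of its properties come from two equations:
    [P (v * X) = chi v * P X] for [v] in [p^-] ([proj_character_left]) and
    [P (X * v) = P X * chi v] for [v] in [p^+] ([proj_character_right]).
    They say that the functionals [P (Z * _)] and [P (iota _ * Z)] factor through
    the modules [M^+] and [M^-], so that the form is well defined, and invariant:
    [S (X m) n = S m (iota X n)].  In general neither [u^+] nor [u^-] is stable
    under brackets with the Levi factor, or even a subalgebra.  What makes the
    equations true is that [p^-] and [p^+] are subalgebras on which [chi] is a
    character: by the Poincare-Birkhoff-Witt theorem for [p^-], an element of
    [U p^-] is a combination of ordered monomials in [u^-] and the Levi factor, and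
    its product with an ordered monomial in [u^+] is mapped by [P] to its value
    under the character if the last monomial is 1, and to 0 otherwise.

    The Poincare-Birkhoff-Witt theorem ([pbw_linear_map], [pbw_span]) gives the
    existence and the uniqueness of the projection.  It is obtained by letting the
    Lie algebra act on the free module on sorted words.

    Orthogonality of weight spaces is immediate from invariance.  If both modules
    are simple, the radicals vanish, since they are submodules that miss the
    generators, as [S w^- w^+ = P 1 = 1].  Conversely, a submodule that pairs to zero
    with the opposite generator lies in the radical by invariance.  Any other
    submodule contains some [c w + u] with [c] nonzero, where [u] is a combination
    of vectors obtained from [w] by words in root vectors of the opposite
    nilradical.  The weight of such a vector for the Cartan subalgebra differs from
    that of [w] by a nonempty sum of roots of [nu_0].  This sum is not zero
    ([nil_root_sum_neq0]), so the weight component [c w] lies in the submodule,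
    which is therefore everything.

    The facts on root systems used here are derived from the semisimplicity of the
    adjoint representation: brackets of opposite root vectors are multiples of the
    coroot ([bracket_coroot]), which makes [chi] a character, and every root belongs
    to an [sl_2]-triple ([sl2_triple]), because the radical of the Killing form is a
    central ideal ([isotropic_ideal_central]). *)

(** * Linear algebra *)

Section LinearSets.
Context {K : fieldType} {V : lmodType K}.
Implicit Type W S : set V.

Definition linset W : Prop :=
  W 0 /\ forall a u v, W u -> W v -> W (a *: u + v).

Lemma linsetD W u v : linset W -> W u -> W v -> W (u + v).
Proof. by move=> [_ h] Wu Wv; rewrite -[u]scale1r; exact: h. Qed.

Lemma linsetZ W a u : linset W -> W u -> W (a *: u).
Proof. by move=> [h0 h] Wu; rewrite -[_ *: _]addr0; exact: h. Qed.

Lemma linsetB W u v : linset W -> W u -> W v -> W (u - v).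
Proof.
by move=> h Wu Wv; apply: linsetD => //; rewrite -scaleN1r; exact: linsetZ.
Qed.

Lemma linset_sum W (I : eqType) (s : seq I) (P : pred I) (F : I -> V) :
  linset W -> (forall i, i \in s -> P i -> W (F i)) -> W (\sum_(i <- s | P i) F i).
Proof.
move=> h; elim: s => [|i s IH] hs; first by rewrite big_nil; case: h.
have hs' : W (\sum_(j <- s | P j) F j).
  by apply: IH => j js; apply: hs; rewrite inE js orbT.
rewrite big_cons; case: ifP => // Pi.
by apply: linsetD => //; apply: hs; rewrite // inE eqxx.
Qed.

Lemma linset_lspan S : linset (lspan S).
Proof.
split; first exact: lspan0.
by move=> a u v Su Sv; apply: lspanD => //; exact: lspanZ.
Qed.

Lemma lspan_min S W : linset W -> S `<=` W -> lspan S `<=` W.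
Proof.
move=> h SW; apply: lspan_ind => [|u v|a v|v]; first by case: h.
- exact: linsetD.
- exact: linsetZ.
- exact: SW.
Qed.

Lemma lspan_id W v : linset W -> lspan W v -> W v.
Proof. by move=> h; exact: (lspan_min h (fun x h => h)). Qed.

Lemma lspanS S W : S `<=` W -> lspan S `<=` lspan W.
Proof.
by move=> SW; apply: lspan_min; [exact: linset_lspan|move=> x /SW/lspan_sub].
Qed.

Lemma linset_eq {W : lmodType K} (f f' : V -> W) :
  linear f -> linear f' -> linset [set v | f v = f' v].
Proof.
move=> fl fl'; split=> /=; first by rewrite (linear_val0 fl) (linear_val0 fl').
by move=> a u v; rewrite fl fl' => -> ->.
Qed.

Lemma linear_addf {W : lmodType K} (f f' : V -> W) :
  linear f -> linear f' -> linear (fun v => f v + f' v).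
Proof. by move=> fl fl' a u v; rewrite fl fl' scalerDr addrACA. Qed.

Lemma linear_scalef {W : lmodType K} c (f : V -> W) :
  linear f -> linear (fun v => c *: f v).
Proof. by move=> fl a u v; rewrite fl scalerDr !scalerA mulrC. Qed.

Lemma linear_subf {W : lmodType K} (f f' : V -> W) :
  linear f -> linear f' -> linear (fun v => f v - f' v).
Proof.
move=> fl fl'; under [fun v => _]eq_fun do rewrite -scaleN1r.
by apply: linear_addf => //; exact: linear_scalef.
Qed.

Lemma linset_vspace {V' : vectType K} (U : {vspace V'}) :
  @lspan K V' [set v | v \in U] `<=` [set v | v \in U].
Proof.
apply: lspan_ind => [|u v|a v|//] /=; first exact: mem0v.
- exact: memvD.
- exact: memvZ.
Qed.

End LinearSets.

Lemma linear_val_sum {K : fieldType} {V W : lmodType K} (f : V -> W) :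
  linear f -> forall (I : Type) (s : seq I) (P : pred I) (F : I -> V),
  f (\sum_(i <- s | P i) F i) = \sum_(i <- s | P i) f (F i).
Proof.
move=> fl I s P F; apply: (big_rec2 (fun u v => f u = v)).
  exact: linear_val0.
by move=> i u v _ <-; rewrite (linear_valD fl).
Qed.

Lemma linset_preim {K : fieldType} {V W : lmodType K} (f : V -> W) (S : set W) :
  linear f -> linset S -> linset [set v | S (f v)].
Proof.
move=> fl h; split=> /=; first by rewrite (linear_val0 fl); case: h.
by move=> a u v Su Sv /=; rewrite fl; case: h => _; apply.
Qed.

Lemma lspan_img {K : fieldType} {V W : lmodType K} (f : V -> W) S v :
  linear f -> lspan S v -> lspan (f @` S) (f v).
Proof.
move=> fl; move: v.
apply: lspan_min; first by apply: linset_preim => //; exact: linset_lspan.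
by move=> x Sx; apply: lspan_sub; exists x.
Qed.

Lemma linear_ext_lspan {K : fieldType} {V W : lmodType K} (f f' : V -> W) S v :
  linear f -> linear f' -> (forall x, S x -> f x = f' x) -> lspan S v ->
  f v = f' v.
Proof.
move=> fl fl' E; move: v; apply: lspan_ind => [|u v|a v|] //.
- by rewrite (linear_val0 fl) (linear_val0 fl').
- by move=> Eu Ev; rewrite (linear_valD fl) (linear_valD fl') Eu Ev.
- by move=> Ev; rewrite (linear_valZ fl) (linear_valZ fl') Ev.
Qed.

(** A longest free family inside [S] spans everything that [S] spans. *)
Lemma lspan_basis {K : fieldType} {V : vectType K} (S : set V) :
  exists X : seq V, [/\ free X, forall x, x \in X -> S x
    & forall v, lspan S v <-> v \in <<X>>%VS].
Proof.
pose P n := `[< exists X : seq V,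
  [/\ free X, forall x, x \in X -> S x & size X = n] >].
have exP : exists n, P n by exists 0%N; apply/asboolP; exists [::]; rewrite nil_free.
have ubP n : P n -> (n <= \dim {:V})%N.
  by move=> /asboolP[X [/eqP <- _ <-]]; apply: dimvS; exact: subvf.
have [n /asboolP[X [fX XS sX]] nmax] := ex_maxnP exP ubP.
have SX x : S x -> x \in <<X>>%VS.
  move=> Sx; apply: contraT => xX; have : P n.+1.
    apply/asboolP; exists (x :: X); rewrite free_cons xX /= sX; split=> // y.
    by rewrite inE => /orP[/eqP -> //|/XS].
  by move=> /nmax; rewrite ltnn.
exists X; split=> // v; split=> [Sv|].
  by apply: linset_vspace; apply: lspanS Sv => x /SX.
move=> /(@coord_span _ _ _ (in_tuple X)) ->.
apply: linset_sum; first exact: linset_lspan.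
by move=> i _ _; apply/lspanZ/lspan_sub/XS; rewrite mem_nth.
Qed.

Lemma vspanP {K : fieldType} {V : vectType K} (S : set V) v :
  v \in vspan S <-> lspan S v.
Proof.
suff: exists W : {vspace V}, forall v, v \in W <-> lspan S v.
  by case=> W hW; rewrite /vspan; case: xgetP => [U _ /= ->|/(_ W)/(_ hW)].
  by have [X [_ _ XP]] := lspan_basis S; exists <<X>>%VS => w; exact: iff_sym.
Qed.
Lemma vspan_linset {K : fieldType} {V : vectType K} (S : set V) v :
  linset S -> v \in vspan S <-> S v.
Proof.
move=> h; split=> [/vspanP|Sv]; first exact: lspan_id.
by apply/vspanP/lspan_sub.
Qed.

(** ** Joint eigenvectors *)

Section JointEigenvectors.
Context {K : fieldType} {V : lmodType K} {H : Type}.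
Variable T : H -> V -> V.
Hypothesis Tlin : forall h, linear (T h).

Definition joint_eigen (c : H -> K) : set V :=
  [set v | forall h, T h v = c h *: v].

Definition other_eigen (c : H -> K) : set V :=
  [set v | exists2 d, joint_eigen d v & exists h, d h != c h].

Lemma joint_eigen_linset c : linset (joint_eigen c).
Proof.
split=> [h|a u v cu cv h]; first by rewrite (linear_val0 (Tlin h)) scaler0.
by rewrite Tlin cu cv scalerDr !scalerA mulrC.
Qed.

(** An invariant subspace containing a sum of joint eigenvectors contains the
    component of each weight: applying [T h - d h] removes a summand of weight
    [d] and multiplies the wanted component by a nonzero scalar as soon as [d h]
    differs from its eigenvalue. *)
Lemma eigen_component (W : set V) c x u :
    linset W -> (forall h v, W v -> W (T h v)) ->
  joint_eigen c x -> lspan (other_eigen c) u -> W (x + u) -> W x.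
Proof.
move=> Wlin WT + [s [sE ->]].
rewrite (_ : \sum_(p <- s) _ = \sum_(v <- [seq p.1 *: p.2 | p <- s]) v);
  last by rewrite big_map.
have: forall v, v \in [seq p.1 *: p.2 | p <- s] -> other_eigen c v.
  move=> _ /mapP[p /sE [d dp hd] ->]; exists d => // h.
  by rewrite (linear_valZ (Tlin h)) dp !scalerA mulrC.
move: [seq _ | _ <- s] => {s sE}s; have [n] := ubnP (size s).
elim: n s x => // n IH [|v s] x /= sn sE cx; first by rewrite big_nil addr0.
have [d dv [h dh]] := sE v (mem_head _ _).
move=> Wxu; have chd : c h - d h != 0 by rewrite subr_eq0 eq_sym.
suff W' : W ((c h - d h) *: x).
  have := linsetZ (c h - d h)^-1 Wlin W'.
  by rewrite scalerA mulVf // scale1r.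
apply: (IH [seq T h v - d h *: v | v <- s]); first by rewrite size_map.
- move=> _ /mapP[w ws ->].
  have [|e ew he] := sE w; first by rewrite inE ws orbT.
  by exists e => // k; rewrite ew -scalerBl (linear_valZ (Tlin k)) ew !scalerA mulrC.
- by move=> k; rewrite (linear_valZ (Tlin k)) cx !scalerA mulrC.
have -> : (c h - d h) *: x + \sum_(v <- [seq T h v - d h *: v | v <- s]) v =
          T h (x + \sum_(j <- (v :: s)) j) - d h *: (x + \sum_(j <- (v :: s)) j).
  rewrite big_map sumrB -scaler_sumr big_cons.
  set S := \sum_(j <- s) j.
  have -> : \sum_(j <- s) T h j = T h S.
    rewrite /S; elim: (s) => [|j s' IHs]; first by rewrite !big_nil (linear_val0 (Tlin h)).
    by rewrite !big_cons (linear_valD (Tlin h)) IHs.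
  have AC (p q e y z : V) : p - q + (y - z) = p + (e + y) - (q + (e + z)).
    by rewrite opprD [RHS]addrACA opprD (addrACA e) subrr add0r.
  by rewrite !(linear_valD (Tlin h)) cx dv scalerBl !scalerDr; exact: AC.
by apply: linsetB => //; [exact: WT|exact: linsetZ].
Qed.

Lemma eigen_disjoint c x :
  joint_eigen c x -> lspan (other_eigen c) x -> x = 0.
Proof.
move=> cx ux; suff: [set y : V | y = 0] x by [].
apply: (@eigen_component _ c x (- x)) => //=.
- by split=> //= a u v -> ->; rewrite scaler0 addr0.
- by move=> h _ ->; rewrite (linear_val0 (Tlin h)).
- by rewrite -scaleN1r; exact: lspanZ.
- by rewrite subrr.
Qed.

(** Induction on the length of a decomposition into joint eigenvectors: those
    with the weight of the first one add up to an element of the subspace, by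
    [eigen_component], and may be split off. *)
Lemma eigen_graded (W : set V) x :
    linset W -> (forall h v, W v -> W (T h v)) ->
    (forall y, lspan [set v | exists c, joint_eigen c v] y) ->
  W x -> lspan [set v | W v /\ exists c, joint_eigen c v] x.
Proof.
move=> Wlin WT full; have [s [sE ->]] := full x.
rewrite (_ : \sum_(p <- s) _ = \sum_(v <- [seq p.1 *: p.2 | p <- s]) v);
  last by rewrite big_map.
have: forall v, v \in [seq p.1 *: p.2 | p <- s] -> exists c, joint_eigen c v.
  by move=> _ /mapP[p /sE [c cp] ->]; exists c; exact: (linsetZ _ (joint_eigen_linset c) cp).
move: [seq _ | _ <- s] => {x s sE}s; have [n] := ubnP (size s).
elim: n s => // n IH [|v s] /= sn sE; first by rewrite big_nil => _; exact: lspan0.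
have [c cv] := sE v (mem_head _ _).
have {}sE u : u \in s -> exists d, joint_eigen d u by move=> us; apply: sE; rewrite inE us orbT.
pose P u := `[< joint_eigen c u >].
rewrite big_cons (bigID P) /= addrA; set z := v + _; set y := \sum_(_ <- _ | _) _.
have cz : joint_eigen c z.
  apply: (linsetD (joint_eigen_linset c)) => //.
  by apply: (linset_sum (joint_eigen_linset c)) => u _ /asboolP.
have oy : lspan (other_eigen c) y.
  apply: linset_sum; first exact: linset_lspan.
  move=> u us /asboolP ncu; apply: lspan_sub; have [d du] := sE u us.
  exists d => //; apply: contrapT => /forallNP dc; apply: ncu => h.
  by have /negP := dc h; rewrite negbK => /eqP <-; exact: du.
move=> Wzy; have Wz : W z := eigen_component Wlin WT cz oy Wzy.
apply: lspanD; first by apply: lspan_sub; split=> //; exists c.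
have Wy : W y by rewrite -[y](addKr z) addrC; exact: linsetB.
move: Wy; rewrite /y -big_filter; apply: IH.
  by rewrite size_filter (leq_ltn_trans (count_size _ _)) // -ltnS.
by move=> u; rewrite mem_filter => /andP[_ /sE].
Qed.

End JointEigenvectors.

(** ** Traces *)

Section Trace.
Context {K : fieldType} {V : vectType K} (b : (dim V).-tuple V).
Hypothesis bP : basis_of fullv b.

Definition endo_trace (f : V -> V) : K := \sum_(i < dim V) coord b i (f b`_i).

Lemma endo_traceC (f f' : V -> V) : linear f -> linear f' ->
  endo_trace (f \o f') = endo_trace (f' \o f).
Proof.
move=> fl fl'.
have E (h h' : V -> V) : linear h -> endo_trace (h \o h') =
    \sum_(i < dim V) \sum_(j < dim V) coord b j (h' b`_i) * coord b i (h b`_j).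
  move=> hl; apply: eq_bigr => i _ /=.
  rewrite {1}[h' _](coord_basis bP (memvf _)).
  have -> (F : 'I_(dim V) -> K) : h (\sum_(j < dim V) F j *: b`_j) = \sum_(j < dim V) F j *: h b`_j.
    apply: (big_rec2 (fun u v => h u = v)); first by rewrite (linear_val0 hl).
    by move=> j y1 y2 _ <-; rewrite hl.
  by rewrite linear_sum; apply: eq_bigr => j _; rewrite linearZ.
rewrite (E f f') // (E f' f) // exchange_big /=.
by apply: eq_bigr => i _; apply: eq_bigr => j _; rewrite mulrC.
Qed.

Lemma endo_trace_eigen (f : V -> V) (c : 'I_(dim V) -> K) :
  (forall i : 'I_(dim V), f b`_i = c i *: b`_i) -> endo_trace f = \sum_i c i.
Proof.
move=> fE; apply: eq_bigr => i _; rewrite fE linearZ /=.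
by rewrite coord_free ?(basis_free bP) // eqxx mulr1.
Qed.

Lemma endo_traceB (f f' : V -> V) :
  endo_trace (fun x => f x - f' x) = endo_trace f - endo_trace f'.
Proof. by rewrite /endo_trace -sumrB; apply: eq_bigr => i _; rewrite linearB. Qed.

Lemma endo_traceD a (f f' : V -> V) :
  endo_trace (fun x => a *: f x + f' x) = a * endo_trace f + endo_trace f'.
Proof.
rewrite /endo_trace mulr_sumr -big_split /=.
by apply: eq_bigr => i _; rewrite linearP.
Qed.

Lemma eq_endo_trace (f f' : V -> V) : f =1 f' -> endo_trace f = endo_trace f'.
Proof. by move=> E; apply: eq_bigr => i _; rewrite E. Qed.

End Trace.

(** ** Linear extension from a basis *)

Section LinearExtension.
Context {K : fieldType} {M : choiceType} {W : lmodType K} (f : M -> W).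

Definition linext (x : {malg K[M]}) : W := \sum_(k <- msupp x) mcoeff k x *: f k.

Lemma linextEw (d : {fset M}) x : (msupp x `<=` d)%fset ->
  linext x = \sum_(k <- d) mcoeff k x *: f k.
Proof.
move=> le; rewrite /linext (big_fset_incl _ le) => //= k _ /mcoeff_outdom ->.
by rewrite scale0r.
Qed.

Lemma linext_linear : linear linext.
Proof.
move=> c x y; set d := (msupp x `|` msupp y)%fset.
have dx : (msupp x `<=` d)%fset := fsubsetUl _ _.
have dy : (msupp y `<=` d)%fset := fsubsetUr _ _.
have dxy : (msupp (c *: x + y) `<=` d)%fset.
  apply: (fsubset_trans (msuppD_le _ _)).
  by rewrite fsubUset dy (fsubset_trans (msuppZ_le _ _)).
rewrite (linextEw dx) (linextEw dy) (linextEw dxy) scaler_sumr -big_split /=.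
by apply: eq_bigr => k _; rewrite mcoeffD mcoeffZ scalerDl scalerA.
Qed.

Lemma linextU k : linext << k >> = f k.
Proof. by rewrite (linextEw msuppU_le) big_seq_fset1 mcoeffUU scale1r. Qed.

Lemma malg_lspan (x : {malg K[M]}) : lspan [set << k >> | k in [set: M]] x.
Proof.
rewrite [x]monalgE; apply: linset_sum; first exact: linset_lspan.
move=> k _ _; rewrite (_ : << _ *g k >> = mcoeff k x *: << k >>).
  by apply/lspanZ/lspan_sub; exists k.
by have /= := malgU_linear k (mcoeff k x) 1 0; rewrite mulr1 addr0 monalgU0 addr0.
Qed.

End LinearExtension.

(** ** Modules over enveloping algebras *)

Section EnvelopingRepresentation.
Context {K : fieldType} {V : lmodType K} (br : V -> V -> V).

Lemma free_genind (P : set (@free_alg K V)) : linset P -> P 1 ->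
  (forall v x, P x -> P (fgen v * x)) -> forall x, P x.
Proof.
move=> Plin P1 PM x; apply: (lspan_min Plin _ (malg_lspan x)).
move=> _ [[s] _ <-]; elim: s => [|v s IH].
  have -> : << FMonom [::] >> = (1 : @free_alg K V) :> @free_alg K V; last by [].
  by rewrite [RHS]free_oneE -fmoneE.
have -> : << FMonom (v :: s) >> =
          fgen v * (<< FMonom s >> : @free_alg K V) :> @free_alg K V.
  rewrite free_mulrE fgenE malgM_def fgmulUU mulr1 -[mul _ _]/(fmmul _ _) fmmulE fmuE.
  by [].
exact: PM.
Qed.

Lemma env_genind (P : set (env br)) : linset P -> P 1 ->
  (forall v x, P x -> P (env_gen br v * x)) -> forall x, P x.
Proof.
move=> Plin P1 PM; elim/(@env_ind _ _ br).
apply: free_genind => [||v x Px]; last by rewrite /= env_projM; exact: PM.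
  by apply: linset_preim => //; exact: env_proj_linear.
by rewrite /= -[env_proj _ 1]/(1 : env br).
Qed.

(** A bracket-preserving action of the Lie algebra turns a cyclic vector into
    a linear map out of the enveloping algebra.  The relations are required
    on an invariant subspace [T] only, the one in which all vectors that occur
    lie. *)
Lemma env_cyclic (W : lmodType K) (rho : V -> W -> W) (w0 : W) (T : set W) :
    (forall v, linear (rho v)) -> T w0 -> (forall v w, T w -> T (rho v w)) ->
    (forall a u v w, T w -> rho (a *: u + v) w = a *: rho u w + rho v w) ->
    (forall u v w, T w -> rho (br u v) w = rho u (rho v w) - rho v (rho u w)) ->
  exists f : env br -> W,
    [/\ linear f, f 1 = w0 & forall v x, f (env_gen br v * x) = rho v (f x)].
Proof.
move=> rl T0 Trho rlin rbr.
pose f0 : @free_alg K V -> W := linext (fun m : {fmonom V} => foldr rho w0 m).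
have f0l : linear f0 by exact: linext_linear.
have f01 : f0 1 = w0.
  rewrite [1]free_oneE /f0.
  by rewrite -[X in linext _ X]/(<< fmone V >>) linextU fmoneE.
have lmulr_lin (y : @free_alg K V) : linear (fun x : free_alg V => x * y).
  by move=> a u v; rewrite mulrDl -scalerAl.
have rmulr_lin (y : @free_alg K V) : linear (fun x : free_alg V => y * x).
  by move=> a u v; rewrite mulrDr -scalerAr.
have f0M v (x : @free_alg K V) : f0 (fgen v * x) = rho v (f0 x).
  apply: (@linear_ext_lspan _ (@free_alg K V) _ (fun y => f0 (fgen v * y))
            (fun y => rho v (f0 y)) _ _ _ _ _ (malg_lspan x)).
  - by move=> a x1 x2; rewrite rmulr_lin f0l.
  - by move=> a x1 x2; rewrite f0l rl.
  move=> _ [m _ <-]; rewrite free_mulrE fgenE malgM_def fgmulUU mulr1 /f0 !linextU.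
  by rewrite -[mul _ _]/(fmmul _ _) fmmulE fmuE.
have lc0 : linset [set y : W | y = 0].
  by split=> //= a u v -> ->; rewrite scaler0 addr0.
have lcT : linset (lspan T) by exact: linset_lspan.
have TL w : lspan T w -> forall v, lspan T (rho v w).
  move=> Tw v; have := lspan_img (rl v) Tw; apply: lspanS.
  by move=> _ [y Ty <-]; exact: Trho.
have f0T x : lspan T (f0 x).
  move: x; apply: free_genind; first exact: linset_preim.
    by rewrite /= f01; exact: lspan_sub.
  by move=> v x /= h; rewrite f0M; exact: TL.
have f0rel (a r d : @free_alg K V) : env_relations br r -> f0 (a * r * d) = 0.
  move=> rel; have r0 : f0 (r * d) = 0.
    case: rel => [[c [u [v ->]]]|[u [v ->]]].
      rewrite (linear_valBZD (lmulr_lin d)) (linear_valB f0l) f0l !f0M.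
      have := f0T d; move: (f0 d); apply: lspan_min => /=.
        apply: linset_eq; last by move=> e y1 y2; rewrite scaler0 addr0.
        by apply: linear_subf; [exact: rl|apply: linear_addf; [apply: linear_scalef|]; exact: rl].
      by move=> w Tw /=; rewrite rlin // subrr.
    rewrite (linear_valBB (lmulr_lin d)) (linear_valBB f0l) -!mulrA !f0M.
    have := f0T d; move: (f0 d); apply: lspan_min => /=.
      apply: linset_eq; last by move=> e y1 y2; rewrite scaler0 addr0.
      apply: linear_subf; last exact: rl.
      by apply: linear_subf; move=> e y1 y2; rewrite !rl.
    by move=> w Tw /=; rewrite rbr // subrr.
  rewrite -mulrA; move: a; apply: free_genind.
  - by have /= := linset_preim (_ : linear (fun x => f0 (x * (r * d)))) lc0; apply=> b x y;
      rewrite lmulr_lin f0l.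
  - by rewrite /= mul1r.
  - by move=> v x /= h; rewrite -mulrA f0M h (linear_val0 (rl v)).
pose f (x : env br) : W := f0 (repr x).
have fE x : f (env_proj br x) = f0 x.
  apply/eqP; rewrite -subr_eq0 -(linear_valB f0l); apply/eqP.
  have : lspan (ideal_gens (env_relations br)) (repr (env_proj br x) - x).
    exact/lprojP/lprojK.
  move: (_ - x); apply: lspan_min.
    by have /= := linset_preim f0l lc0.
  by move=> _ [a [r [d [rel ->]]]] /=; exact: f0rel.
exists f; split.
- move=> a; elim/(@env_ind _ _ br) => x; elim/(@env_ind _ _ br) => y.
  by rewrite -env_proj_linear !fE f0l.
- by rewrite -[1]/(env_proj br 1) fE.
- by move=> v; elim/(@env_ind _ _ br) => x; rewrite -env_projM !fE.
Qed.

End EnvelopingRepresentation.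

(** * The Poincare-Birkhoff-Witt theorem *)

(** ** Identities for brackets *)

Section LieIdentities.
Context {K : fieldType} {L : vectType K} (br : L -> L -> L).
Hypothesis brP : is_lie_bracket br.

Lemma brlD x y z : br (x + y) z = br x z + br y z.
Proof. exact: (linear_valD (lie_linearl brP z)). Qed.

Lemma brrD x y z : br x (y + z) = br x y + br x z.
Proof. exact: (linear_valD (lie_linearr brP x)). Qed.

Lemma brlZ a x y : br (a *: x) y = a *: br x y.
Proof. exact: (linear_valZ (lie_linearl brP y)). Qed.

Lemma brrZ a x y : br x (a *: y) = a *: br x y.
Proof. exact: (linear_valZ (lie_linearr brP x)). Qed.

Lemma br0l x : br 0 x = 0.
Proof. exact: (linear_val0 (lie_linearl brP x)). Qed.

Lemma br0r x : br x 0 = 0.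
Proof. exact: (linear_val0 (lie_linearr brP x)). Qed.

Lemma brC x y : br x y = - br y x.
Proof.
apply/eqP; rewrite -addr_eq0; apply/eqP.
have := lie_alternating brP (x + y).
by rewrite brlD !brrD !(lie_alternating brP) add0r addr0.
Qed.

Lemma brNr x y : br x (- y) = - br x y.
Proof. by rewrite -scaleN1r brrZ scaleN1r. Qed.

Lemma br_jacobil x y z : br (br x y) z = br x (br y z) - br y (br x z).
Proof.
have /eqP := lie_jacobi brP x y z.
rewrite (brC z x) (brC z (br x y)) brNr => /eqP h.
by apply/esym/eqP; rewrite -subr_eq0 h.
Qed.

Lemma br_jacobir x y z : br x (br y z) = br (br x y) z + br y (br x z).
Proof. by rewrite br_jacobil subrK. Qed.

End LieIdentities.

(** ** The action on sorted words *)

Section PBW.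
Context {K : fieldType} {L : vectType K} (br : L -> L -> L).
Hypothesis brP : is_lie_bracket br.
Context {n : nat} (b : n.-tuple L).
Hypothesis bP : basis_of fullv b.

Local Notation word := (seq 'I_n).

(* The free module on the words, given by its universal property. *)
Context {S : lmodType K} (mon : word -> S).
Variable ext : forall {W : lmodType K}, (word -> W) -> S -> W.
Hypothesis ext_linear : forall (W : lmodType K) (f : word -> W), linear (ext f).
Hypothesis ext_mon : forall (W : lmodType K) (f : word -> W) M, ext f (mon M) = f M.

Local Notation sorted := (sorted (fun i j : 'I_n => (i <= j)%N)).
Local Notation below i M := (all (fun j : 'I_n => (i <= j)%N) M).

Fixpoint insert_letter (i : 'I_n) (M : word) : word :=
  if M is j :: N then if (i <= j)%N then i :: M else j :: insert_letter i N
  else [:: i].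
Local Notation ins := insert_letter.

(** The action of a basis vector on a word, by recursion on a bound [p] for the
    length.  If [j] is the first letter and [j < i], then [b_i b_j N] is
    [b_j b_i N + [b_i, b_j] N]; the leading term of [b_i N] is the word with [i]
    inserted, and [b_j] only prepends a letter to that word, so that the
    recursive calls concern shorter words. *)
Fixpoint act_word (p : nat) (i : 'I_n) (M : word) {struct p} : S :=
  match M, p with
  | j :: N, p'.+1 =>
    if (i <= j)%N then mon (i :: M) else
    mon (j :: ins i N) + ext (act_word p' j) (act_word p' i N - mon (ins i N))
    + \sum_(k < n) coord b k (br b`_i b`_j) *: act_word p' k N
  | _, _ => mon (i :: M)
  end.

Local Notation act i M := (act_word (size M) i M).

Definition sorted_deg (p : nat) : set S :=
  lspan [set x | exists M : word, [/\ sorted M, (size M <= p)%N & x = mon M]].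

Definition sorted_span : set S :=
  lspan [set x | exists M : word, sorted M /\ x = mon M].

Lemma sorted_deg_linset p : linset (sorted_deg p).
Proof. exact: linset_lspan. Qed.

Lemma sorted_deg_mon p M : sorted M -> (size M <= p)%N -> sorted_deg p (mon M).
Proof. by move=> sM pM; apply: lspan_sub; exists M. Qed.

Lemma sorted_degS p q : (p <= q)%N -> sorted_deg p `<=` sorted_deg q.
Proof.
move=> pq; apply: lspanS => _ [M [sM pM ->]].
by exists M; split=> //; exact: leq_trans pq.
Qed.

Lemma sorted_deg_span p : sorted_deg p `<=` sorted_span.
Proof. by apply: lspanS => _ [M [sM _ ->]]; exists M. Qed.

Lemma size_ins i M : size (ins i M) = (size M).+1.
Proof. by elim: M => //= j N IH; case: ifP => //= _; rewrite IH. Qed.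

Lemma below_ins (k i : 'I_n) M : (k <= i)%N -> below k M -> below k (ins i M).
Proof.
move=> ki; elim: M => /= [_|j N IH /andP[kj kN]]; first by rewrite ki.
by case: ifP => _ /=; rewrite kj ?ki ?kN //= IH.
Qed.

Lemma sorted_cons (i : 'I_n) M : sorted (i :: M) = below i M && sorted M.
Proof. by rewrite /= path_sortedE // => x y z; exact: leq_trans. Qed.

Lemma sorted_ins i M : sorted M -> sorted (ins i M).
Proof.
elim: M => // j N IH sM; move: (sM); rewrite sorted_cons => /andP[jN sN].
rewrite [ins _ _]/=; case: leqP => ij; rewrite sorted_cons; last first.
  by rewrite IH // andbT; apply: below_ins => //; exact: ltnW.
rewrite sM andbT /= ij /=.
by apply/allP => k /(allP jN); exact: leq_trans.
Qed.

Lemma act_word_stable m M i p : (size M <= m)%N -> (size M <= p)%N -> sorted M ->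
  act_word p i M = act i M /\ sorted_deg (size M) (act i M - mon (ins i M)).
Proof.
elim: m M i p => [|m IH] [|j N] i [|p] //= Mm Mp sM;
  do ?by split=> //; rewrite subrr; case: (sorted_deg_linset 0).
move: sM; rewrite -/(sorted (j :: N)) sorted_cons => /andP[jN sN].
case: leqP => ij; first by split=> //; rewrite subrr; case: (sorted_deg_linset (size N).+1).
have extE q w : (size N <= q)%N -> sorted_deg (size N) w ->
    ext (act_word q j) w = ext (fun M => act j M) w.
  move=> Nq; apply: linear_ext_lspan; [exact: ext_linear|exact: ext_linear|].
  move=> _ [M [sM MN ->]]; rewrite !ext_mon.
  by apply: (IH M j q _ _ sM).1; exact: leq_trans MN _.
have wN := (IH N i p Mm Mp sN).2.
rewrite (IH N i p Mm Mp sN).1 (extE p) // (extE (size N)) //.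
split.
  by congr (_ + _); apply: eq_bigr => k _; rewrite (IH N k p Mm Mp sN).1.
rewrite addrC !addrA addNr add0r.
apply: linsetD; first exact: sorted_deg_linset.
  have lin_j := linset_preim (ext_linear (fun M => act j M))
    (sorted_deg_linset (size N).+1).
  apply: (lspan_min lin_j _ wN).
  move=> _ [M [sM MN ->]] /=; rewrite ext_mon -[act j M](subrK (mon (ins j M))).
  apply: linsetD; first exact: sorted_deg_linset.
    apply: sorted_degS (IH M j (size M) (leq_trans MN Mm) (leqnn _) sM).2.
    exact: leq_trans MN _.
  by apply: sorted_deg_mon; [exact: sorted_ins|rewrite size_ins].
apply: linset_sum; first exact: sorted_deg_linset.
move=> k _ _; apply: linsetZ; first exact: sorted_deg_linset.
rewrite -[act k N](subrK (mon (ins k N))).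
apply: linsetD; first exact: sorted_deg_linset.
  by apply: sorted_degS (IH N k (size N) Mm (leqnn _) sN).2.
by apply: sorted_deg_mon; [exact: sorted_ins|rewrite size_ins].
Qed.

Definition act_basis (i : 'I_n) : S -> S := ext (fun M => act i M).

Lemma act_basis_linear i : linear (act_basis i).
Proof. exact: ext_linear. Qed.

Lemma act_basis_ins i M : sorted M ->
  sorted_deg (size M) (act_basis i (mon M) - mon (ins i M)).
Proof.
move=> sM; rewrite /act_basis ext_mon.
exact: (act_word_stable i (leqnn _) (leqnn _) sM).2.
Qed.

Lemma act_basis_below (i : 'I_n) M : below i M -> act_basis i (mon M) = mon (i :: M).
Proof. by rewrite /act_basis ext_mon; case: M => //= j N /andP[-> _]. Qed.

Lemma act_basis_cons (i j : 'I_n) N : (j < i)%N -> sorted (j :: N) ->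
  act_basis i (mon (j :: N)) = act_basis j (act_basis i (mon N)) +
    \sum_(k < n) coord b k (br b`_i b`_j) *: act_basis k (mon N).
Proof.
move=> ji; rewrite sorted_cons => /andP[jN sN].
rewrite {1}/act_basis ext_mon /= leqNgt ji /=.
congr (_ + _); last by apply: eq_bigr => k _; rewrite /act_basis ext_mon.
rewrite -[in RHS](subrK (mon (ins i N)) (act_basis i (mon N))).
rewrite (linear_valD (act_basis_linear j)) addrC; congr (_ + _).
  rewrite {2}/act_basis ext_mon; have := act_basis_ins i sN.
  rewrite {1}/act_basis ext_mon; apply: linear_ext_lspan;
    [exact: ext_linear|exact: ext_linear|].
  move=> _ [M [sM MN ->]]; rewrite /act_basis !ext_mon.
  exact: (act_word_stable j (leqnn _) MN sM).1.
by rewrite act_basis_below //; apply: below_ins => //; exact: ltnW.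
Qed.

Definition act_lie (x : L) (w : S) : S := \sum_(i < n) coord b i x *: act_basis i w.

Lemma act_lie_linear x : linear (act_lie x).
Proof.
move=> a u v; rewrite /act_lie scaler_sumr -big_split /=; apply: eq_bigr => i _.
by rewrite act_basis_linear scalerDr !scalerA mulrC.
Qed.

Lemma act_lie_linearl w : linear (act_lie^~ w).
Proof.
move=> a u v; rewrite /act_lie scaler_sumr -big_split /=; apply: eq_bigr => i _.
by rewrite linearP scalerDl scalerA.
Qed.

Lemma act_lie_basis (i : 'I_n) : act_lie b`_i =1 act_basis i.
Proof.
move=> w; rewrite /act_lie (bigD1 i) //= coord_free ?(basis_free bP) // eqxx scale1r.
rewrite big1 ?addr0 // => j ji; rewrite coord_free ?(basis_free bP) //.
by rewrite eq_sym (negPf ji) scale0r.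
Qed.

Lemma act_lie_sorted x w : sorted_span w -> sorted_span (act_lie x w).
Proof.
move: w; apply: lspan_min.
  by apply: linset_preim; [exact: act_lie_linear|exact: linset_lspan].
move=> _ [M [sM ->]] /=; apply: linset_sum; first exact: linset_lspan.
move=> i _ _; apply: linsetZ; first exact: linset_lspan.
rewrite -[act_basis i _](subrK (mon (ins i M))).
apply: linsetD; first exact: linset_lspan.
  exact: sorted_deg_span (act_basis_ins i sM).
by apply: lspan_sub; exists (ins i M); split=> //; exact: sorted_ins.
Qed.

Let comm_at (x y : L) (w : S) : Prop :=
  act_lie x (act_lie y w) = act_lie y (act_lie x w) + act_lie (br x y) w.

Lemma comm_at_linset x y : linset (comm_at x y).
Proof.
apply: linset_eq => [a u v|]; first by rewrite !act_lie_linear.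
by apply: linear_addf => [a u v|]; [rewrite !act_lie_linear|exact: act_lie_linear].
Qed.

Lemma comm_at_sym x y w : comm_at x y w -> comm_at y x w.
Proof.
rewrite /comm_at => ->; rewrite (brC brP y x).
have -> : act_lie (- br x y) w = - act_lie (br x y) w.
  by rewrite -(scaleN1r (br x y)) (linear_valZ (act_lie_linearl w)) scaleN1r.
by rewrite addrK.
Qed.

Lemma comm_at_basis w : (forall i j : 'I_n, (j < i)%N -> comm_at b`_i b`_j w) ->
  forall x y, comm_at x y w.
Proof.
move=> h.
have {}h (i j : 'I_n) : comm_at b`_i b`_j w.
  case: (ltngtP i j) => [/h/comm_at_sym //|/h //|/val_inj ->].
  by rewrite /comm_at (lie_alternating brP) (linear_val0 (act_lie_linearl w)) addr0.
have sp x : lspan [set z | exists i : 'I_n, z = b`_i] x.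
  rewrite (coord_basis bP (memvf x)); apply: linset_sum; first exact: linset_lspan.
  by move=> i _ _; apply/lspanZ/lspan_sub; exists i.
have linl y : linset [set x | comm_at x y w].
  apply: linset_eq; first exact: act_lie_linearl.
  apply: linear_addf; first by move=> a u v; rewrite act_lie_linearl act_lie_linear.
  by move=> a u v; rewrite (lie_linearl brP) act_lie_linearl.
have linr x : linset [set y | comm_at x y w].
  apply: linset_eq; first by move=> a u v; rewrite act_lie_linearl act_lie_linear.
  apply: linear_addf; first exact: act_lie_linearl.
  by move=> a u v; rewrite (lie_linearr brP) act_lie_linearl.
move=> x y; apply: (lspan_min (linl y) _ (sp x)) => _ [i ->] /=.
by apply: (lspan_min (linr _) _ (sp y)) => _ [j ->] /=.
Qed.

Lemma comm_at_below (i j : 'I_n) M : (j < i)%N -> sorted M -> below j M ->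
  comm_at b`_i b`_j (mon M).
Proof.
move=> ji sM jM; rewrite /comm_at !act_lie_basis act_basis_below //.
by rewrite act_basis_cons // sorted_cons jM.
Qed.

(** The relation [b_i b_j - b_j b_i = [b_i, b_j]] on a word that starts with a
    letter [k] smaller than [i] and [j] follows from the Jacobi identity, since
    [b_k] can be commuted past [b_i] and [b_j] by induction. *)
Lemma comm_at_sorted m w : sorted_deg m w -> forall x y, comm_at x y w.
Proof.
elim/ltn_ind: m w => m IH w; move: w.
suff h M : sorted M -> (size M <= m)%N -> forall x y, comm_at x y (mon M).
  move=> w wm x y; move: w wm; apply: lspan_min; first exact: comm_at_linset.
  by move=> _ [M [sM Mm ->]]; exact: h.
move=> sM Mm; apply: comm_at_basis => i j ji.
case: M sM Mm => [|k P] sM Mm; first exact: comm_at_below.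
case: (leqP j k) => [jk|kj].
  apply: comm_at_below => //=; rewrite jk /=.
  move: sM; rewrite sorted_cons => /andP[kP _].
  by apply: sub_all kP => l; exact: leq_trans.
move: (sM); rewrite sorted_cons => /andP[kP sP].
have IHP w : sorted_deg (size P) w -> forall x y, comm_at x y w.
  exact: IH.
have zE : mon (k :: P) = act_lie b`_k (mon P).
  by rewrite act_lie_basis act_basis_below.
have commP := IHP _ (sorted_deg_mon sP (leqnn _)).
have commk (l l' : 'I_n) : (k < l)%N -> (k < l')%N ->
    comm_at b`_l' b`_k (act_lie b`_l (mon P)).
  move=> kl kl'; rewrite act_lie_basis -[act_basis l _](subrK (mon (ins l P))).
  apply: linsetD; first exact: comm_at_linset.
    exact/IHP/act_basis_ins.
  apply: comm_at_below => //; first exact: sorted_ins.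
  by apply: below_ins => //; exact: ltnW.
have ki : (k < i)%N := ltn_trans kj ji.
rewrite /comm_at zE (commP b`_j b`_k) (commP b`_i b`_k).
rewrite !(linear_valD (act_lie_linear _)).
rewrite (commk j i kj ki) (commk i j ki kj) (commP b`_i b`_j).
rewrite (commP b`_i) (commP b`_j (br _ _)) (commP (br b`_i b`_j)).
rewrite (br_jacobil brP b`_i b`_j b`_k).
rewrite (linear_valB (act_lie_linearl _)) !(linear_valD (act_lie_linear _)).
have arr (V : zmodType) (x1 x2 x3 x4 x5 x6 : V) : x1 + x2 + x3 + (x4 + x5) =
    x1 + x4 + (x3 + x6) + (x2 + (x5 - x6)).
  by rewrite [RHS](AC ((2*2)*(1*2)) ((((1*5)*3)*(2*6))*(4*7))) /= subrr addr0.
exact: arr.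
Qed.

Definition word_prod (M : word) : env br := \prod_(j <- M) env_gen br b`_j.

Let word_map : S -> env br := ext word_prod.

Let word_map_linear : linear word_map.
Proof. exact: ext_linear. Qed.

Lemma word_map_act m i w : sorted_deg m w ->
  word_map (act_basis i w) = env_gen br b`_i * word_map w.
Proof.
have mull (g : env br) : linear (fun w => g * word_map w).
  by move=> a u v; rewrite word_map_linear mulrDr -scalerAr.
have actl j : linear (fun w => word_map (act_basis j w)).
  by move=> a u v; rewrite act_basis_linear word_map_linear.
elim/ltn_ind: m i w => m IH i w; move: w.
apply: lspan_min; first exact: linset_eq.
move=> _ [M [sM Mm ->]] /=; case: M sM Mm => [|j N] sM Mm.
  by rewrite act_basis_below // /word_map !ext_mon /word_prod big_cons.
move: (sM); rewrite sorted_cons => /andP[jN sN].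
case: (leqP i j) => ij.
  rewrite act_basis_below; first by rewrite /word_map !ext_mon /word_prod big_cons.
  by rewrite /= ij; apply/allP => k /(allP jN); exact: leq_trans.
have IHN := IH _ Mm; have NN : sorted_deg (size N) (mon N) by exact: sorted_deg_mon.
rewrite act_basis_cons // (linear_valD word_map_linear).
have -> : word_map (act_basis j (act_basis i (mon N))) =
    env_gen br b`_j * word_map (act_basis i (mon N)).
  rewrite -[act_basis i (mon N)](subrK (mon (ins i N))).
  rewrite (linear_valD (actl j)) (linear_valD (mull _)); congr (_ + _).
    exact/IHN/act_basis_ins.
  rewrite act_basis_below; first by rewrite /word_map !ext_mon /word_prod big_cons.
  by apply: below_ins => //; exact: ltnW.
rewrite (IHN i) //.
have -> : word_map (\sum_(k < n) coord b k (br b`_i b`_j) *: act_basis k (mon N)) =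
    env_gen br (br b`_i b`_j) * word_map (mon N).
  rewrite [in RHS](coord_basis bP (memvf (br b`_i b`_j))).
  rewrite (linear_val_sum word_map_linear) (linear_val_sum (env_gen_linear br)).
  rewrite mulr_suml; apply: eq_bigr => k _.
  rewrite (linear_valZ word_map_linear) (linear_valZ (env_gen_linear br)).
  by rewrite (IHN k) // -scalerAl.
rewrite env_gen_br mulrBl addrC -!mulrA subrK /word_map !ext_mon.
by rewrite /word_prod big_cons.
Qed.

Let word_map_rho v w : sorted_span w ->
  word_map (act_lie v w) = env_gen br v * word_map w.
Proof.
move: w; apply: lspan_min.
  apply: linset_eq => a u w; first by rewrite act_lie_linear word_map_linear.
  by rewrite word_map_linear mulrDr -scalerAr.
move=> _ [M [sM ->]] /=.
rewrite (linear_val_sum word_map_linear) {2}(coord_basis bP (memvf v)).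
rewrite (linear_val_sum (env_gen_linear br)) mulr_suml; apply: eq_bigr => k _.
rewrite (linear_valZ word_map_linear) (linear_valZ (env_gen_linear br)) -scalerAl.
by rewrite (word_map_act k (sorted_deg_mon sM (leqnn _))).
Qed.

(** The sorted words act on the empty word as themselves, which makes the
    ordered monomials independent; the map from words back to the enveloping
    algebra intertwines the actions, which makes them span. *)
Lemma sorted_words_free_span :
  (exists f : env br -> S, linear f /\ forall M, sorted M -> f (word_prod M) = mon M) /\
  forall x, lspan [set y | exists M, sorted M /\ y = word_prod M] x.
Proof.
have nilT : sorted_span (mon [::]) by apply: lspan_sub; exists [::].
have [||f [fl f1 fM]] := @env_cyclic _ _ br _ act_lie (mon [::]) sorted_span
  act_lie_linear nilT (fun v w => @act_lie_sorted v w).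
- by move=> a u v w _; exact: act_lie_linearl.
- move=> u v w Tw; suff: comm_at u v w by rewrite /comm_at => ->; rewrite addrC addKr.
  move: w Tw; apply: lspan_min; first exact: comm_at_linset.
  by move=> _ [M [sM ->]]; exact: (comm_at_sorted (sorted_deg_mon sM (leqnn _))).
have fT x : sorted_span (f x).
  move: x; apply: env_genind.
  - by apply: linset_preim => //; exact: linset_lspan.
  - by rewrite /= f1.
  - by move=> v x /= Tx; rewrite fM; exact: act_lie_sorted.
have fK x : word_map (f x) = x.
  move: x; apply: env_genind.
  - by apply: linset_eq => // a u v; rewrite fl word_map_linear.
  - by rewrite /= f1 /word_map ext_mon /word_prod big_nil.
  - by move=> v x /= fxK; rewrite fM word_map_rho // fxK.
split=> [|x].
  exists f; split=> //; elim=> [|i M IH] sM; first by rewrite /word_prod big_nil.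
  move: (sM); rewrite sorted_cons => /andP[iM sM'].
  by rewrite /word_prod big_cons fM IH // act_lie_basis act_basis_below.
rewrite -(fK x).
apply: (lspan_min (linset_preim word_map_linear (linset_lspan _)) _ (fT x)).
move=> _ [M [sM ->]] /=; apply: lspan_sub; exists M; split=> //.
by rewrite /word_map ext_mon.
Qed.

End PBW.

Section PBWTheorem.
Context {K : fieldType} {L : vectType K} (br : L -> L -> L).
Hypothesis brP : is_lie_bracket br.
Context {n : nat} (b : n.-tuple L).
Hypothesis bP : basis_of fullv b.
Local Notation sorted := (sorted (fun i j : 'I_n => (i <= j)%N)).

Theorem pbw_words (W : lmodType K) (tau : seq 'I_n -> W) :
  (exists f : env br -> W, linear f /\ forall M, sorted M -> f (word_prod br b M) = tau M) /\
  forall x, lspan [set y | exists M, sorted M /\ y = word_prod br b M] x.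
Proof.
pose ext (W' : lmodType K) (f : seq 'I_n -> W') := linext f.
have := @sorted_words_free_span _ _ _ brP _ b bP {malg K[seq 'I_n]}
  (fun M => << M >>) ext (fun W' f => linext_linear f) (fun W' f => linextU f).
move=> [[f [fl fE]] sp]; split=> //; exists (fun x => linext tau (f x)).
split=> [a u v|M sM]; first by rewrite fl linext_linear.
by rewrite fE // linextU.
Qed.

End PBWTheorem.

(** ** Ordered monomials *)

Section OrderedMonomials.
Context {K : fieldType} {L : vectType K} (br : L -> L -> L).

Definition exponent_word n (e : nat -> nat) : seq 'I_n :=
  flatten [seq nseq (e (i : 'I_n)) i | i <- enum 'I_n].

Lemma exponent_word_sorted n e : sorted (fun i j : 'I_n => (i <= j)%N) (exponent_word n e).
Proof.
have tr : transitive (fun i j : 'I_n => (i <= j)%N) by move=> y x z; exact: leq_trans.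
rewrite sorted_pairwise // /exponent_word.
have : sorted (fun i j : 'I_n => (i <= j)%N) (enum 'I_n).
  by have := iota_sorted 0 n; rewrite -val_enum_ord sorted_map.
rewrite sorted_pairwise //; elim: (enum 'I_n) => //= i s IH /andP[si ss].
rewrite pairwise_cat IH // andbT; apply/andP; split.
  apply/allrelP => x y /nseqP[-> _] /flattenP[_ /mapP[j js ->] /nseqP[-> _]].
  exact: (allP si).
by elim: (e i) => //= k ->; rewrite andbT; apply/allP => j /nseqP[-> _].
Qed.

Lemma count_exponent_word n e (i : 'I_n) : count_mem i (exponent_word n e) = e i.
Proof.
rewrite count_flatten -map_comp /comp sumnE big_map big_enum /=.
rewrite (bigD1 i) //= count_nseq /= eqxx mul1n big1 ?addn0 // => j ji.
by rewrite count_nseq /= (negPf ji).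
Qed.

Lemma sorted_exponent_word n (M : seq 'I_n) :
  sorted (fun i j : 'I_n => (i <= j)%N) M ->
  M = exponent_word n (fun k => count (fun j : 'I_n => val j == k) M).
Proof.
move=> sM; apply: sorted_eq sM (exponent_word_sorted _ _) _.
- by move=> y x z; exact: leq_trans.
- by move=> x y /=; rewrite -eqn_leq => /eqP/val_inj.
by apply/allP => i _; rewrite /= count_exponent_word.
Qed.

Lemma word_prod_exponent (b : seq L) e :
  word_prod br (in_tuple b) (exponent_word (size b) e) = ordered_monomial br b e.
Proof.
rewrite /word_prod /exponent_word big_flatten big_map /= /ordered_monomial.
rewrite -(big_mkord xpredT (fun i => env_gen br b`_i ^+ e i)) /index_iota subn0.
rewrite -val_enum_ord big_map; apply: eq_bigr => i _.
by elim: (e i) => [|k IH]; rewrite ?big_nil // big_cons IH exprS.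
Qed.

Lemma eq_ordered_monomial (b : seq L) e e' :
  (forall i, (i < size b)%N -> e i = e' i) ->
  ordered_monomial br b e = ordered_monomial br b e'.
Proof. by move=> E; apply: eq_bigr => i _; rewrite E. Qed.

Lemma ordered_monomial_cat (b b' : seq L) e :
  ordered_monomial br (b ++ b') e =
  ordered_monomial br b e * ordered_monomial br b' (fun k => e (size b + k)%N).
Proof.
rewrite /ordered_monomial.
rewrite -(big_mkord xpredT (fun i => env_gen br (b ++ b')`_i ^+ e i)).
rewrite -(big_mkord xpredT (fun i => env_gen br b`_i ^+ e i)).
rewrite -(big_mkord xpredT (fun i => env_gen br b'`_i ^+ e (size b + i)%N)).
rewrite size_cat (big_cat_nat (n := size b)) ?leq_addr //=; congr (_ * _).
  by rewrite !big_nat; apply: eq_bigr => i /andP[_ ib]; rewrite nth_cat ib.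
rewrite -{1}[size b]add0n big_addn addKn; apply: eq_bigr => i _.
by rewrite nth_cat ltnNge leq_addl /= addnK addnC.
Qed.

Hypothesis brP : is_lie_bracket br.

(** The two halves of the theorem: the ordered monomials in a basis are
    independent, so that a linear map may be prescribed on them, and they span. *)
Theorem pbw_linear_map (b : seq L) (W : lmodType K) (tau : (nat -> nat) -> W) :
    basis_of fullv b ->
    (forall e e', (forall i, (i < size b)%N -> e i = e' i) -> tau e = tau e') ->
  exists f : env br -> W, linear f /\ forall e, f (ordered_monomial br b e) = tau e.
Proof.
move=> bP tauE.
have [[f [fl fE]] _] := @pbw_words _ _ _ brP _ (in_tuple b) bP W
  (fun M => tau (fun k => count (fun j : 'I_(size b) => val j == k) M)).
exists f; split=> // e.
rewrite -word_prod_exponent fE; last exact: exponent_word_sorted.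
by apply: tauE => i ib; exact: (count_exponent_word _ (Ordinal ib)).
Qed.

Theorem pbw_span (b : seq L) x : basis_of fullv b ->
  lspan [set ordered_monomial br b e | e in [set: nat -> nat]] x.
Proof.
move=> bP; have [_ sp] := @pbw_words _ _ _ brP _ (in_tuple b) bP K^o (fun=> 0).
apply: (lspanS _ (sp x)) => _ [M [sM ->]].
rewrite (sorted_exponent_word sM) word_prod_exponent.
by eexists.
Qed.

End OrderedMonomials.

(** * Root spaces of a reductive Lie algebra *)

Lemma linfunP {K : fieldType} {V W : vectType K} (f : V -> W) :
  linear f -> linfun f =1 f.
Proof.
move=> fl x; pose F : {linear V -> W} := HB.pack f (GRing.isLinear.Build _ _ _ _ f fl).
exact: (lfunE F x).
Qed.

Section RootSpaces.
Context {R : realType} {g : vectType R[i]} (br : g -> g -> g) (t : {vspace g}).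
Local Notation K := R[i].
Hypothesis brP : is_lie_bracket br.
Hypothesis tP : is_cartan br t.

Local Notation tdual := (tdual t).
Local Notation rs := (@root_space _ g br t).
Local Notation Phi := (@root_set _ g br t).
Implicit Types (x y : g).

Let ad_t (h : subvs_of t) : g -> g := br (vsval h).

Let ad_t_linear h : linear (ad_t h).
Proof. exact: lie_linearr. Qed.

Lemma root_space_linset a : linset (rs a).
Proof. exact: (joint_eigen_linset ad_t_linear). Qed.

Lemma root_space_br a c x y : rs a x -> rs c y -> rs (a + c) (br x y).
Proof.
move=> ax cy h; rewrite br_jacobir // ax cy brlZ // brrZ // -scalerDl.
by rewrite add_lfunE.
Qed.

Lemma root_space0 x : rs 0 x <-> x \in t.
Proof.
case: tP => tab tC _; split=> [x0|xt h].
  by apply: tC => h ht; have := x0 (vsproj t h); rewrite vsprojK // zero_lfunE scale0r.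
by rewrite tab ?subvsP // zero_lfunE scale0r.
Qed.

Lemma joint_eigen_root_space y :
  (forall h : subvs_of t, exists c, br (vsval h) y = c *: y) -> exists a, rs a y.
Proof.
have [->|y0] := eqVneq y 0.
  by exists 0 => h; rewrite br0r // scaler0.
move=> /choice[f fE].
have flin : linear (f : subvs_of t -> K^o).
  have sI (p q : K) : p *: y = q *: y -> p = q.
    by move/eqP; rewrite -subr_eq0 -scalerBl scaler_eq0 (negPf y0) orbF subr_eq0 => /eqP.
  move=> c u v; apply: sI; rewrite -fE linearP /= brlD // brlZ //.
  by rewrite !fE scalerDl scalerA.
by exists (linfun (f : subvs_of t -> K^o)) => h; rewrite linfunP.
Qed.

(** Commuting diagonalisable operators have a joint eigenbasis, by induction on
    their number: each eigenspace of the first ones is stable under the next. *)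
Lemma weight_vectors_span x : lspan [set v | exists a, rs a v] x.
Proof.
case: tP => tab _ td.
pose JE (hs : seq g) := [set y | forall h, h \in hs -> exists c, br h y = c *: y].
have spJE hs y : (forall h, h \in hs -> h \in t) -> lspan (JE hs) y.
  elim: hs y => [|h0 hs IH] y hst; first by apply: lspan_sub.
  have hst' h : h \in hs -> h \in t by move=> hhs; apply: hst; rewrite inE hhs orbT.
  have h0t : h0 \in t by apply: hst; exact: mem_head.
  have := IH y hst'; move: y; apply: lspan_min => [|y JEy].
    exact: linset_lspan.
  pose W := [set z | forall h c, h \in hs -> br h y = c *: y -> br h z = c *: z].
  have Wlin : linset W.
    split=> [h c hhs _|c u v Wu Wv h d hhs hy]; first by rewrite br0r // scaler0.
    by rewrite brrD // brrZ // (Wu h d) // (Wv h d) // scalerDr !scalerA mulrC.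
  have Wh0 : unit -> forall v, W v -> W (br h0 v).
    move=> _ v Wv h c hhs hy; have ht := hst' h hhs.
    by rewrite br_jacobir // (Wv h c) // (tab h h0) // br0l // add0r brrZ.
  have full z : lspan [set v | exists c : unit -> K, joint_eigen (fun _ : unit => br h0) c v] z.
    have [b [bP bE]] := td h0 h0t; rewrite (coord_basis (X := in_tuple b) bP (memvf z)).
    apply: linset_sum; first exact: linset_lspan.
    move=> i _ _; apply/lspanZ/lspan_sub.
    have [d bi] := bE b`_i (mem_nth _ (ltn_ord i)).
    by exists (fun=> d) => _ /=; exact: bi.
  have Wy : W y by [].
  have := eigen_graded (fun _ : unit => lie_linearr brP h0) Wlin Wh0 full Wy.
  apply: lspanS => z [Wz [c cz]] h; rewrite inE => /orP[/eqP ->|hhs].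
    by exists (c tt); exact: cz.
  by have [d hy] := JEy h hhs; exists d; exact: Wz.
have : lspan (JE (vbasis t)) x by apply: spJE => h; exact: vbasis_mem.
apply: lspanS => {x} y JEy; apply: joint_eigen_root_space => h.
have : vsval h \in t by exact: subvsP.
move: (vsval h) => {h} h ht; rewrite (coord_vbasis ht).
have : linset [set h | exists c, br h y = c *: y].
  split=> [|c u v [d1 u1] [d2 v2]]; first by exists 0; rewrite br0l // scale0r.
  by exists (c * d1 + d2); rewrite brlD // brlZ // u1 v2 scalerDl scalerA.
move=> /linset_sum; apply=> i _ _.
have [c hc] := JEy _ (mem_nth 0 (ltn_ord (cast_ord (esym (size_tuple (vbasis t))) i))).
by exists (coord (vbasis t) i h * c); rewrite brlZ // hc scalerA.
Qed.

Lemma weight_vectors_span_stable (W : set g) x : linset W ->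
    (forall (h : subvs_of t) v, W v -> W (br (vsval h) v)) ->
  W x -> lspan [set v | W v /\ exists a, rs a v] x.
Proof.
move=> Wl Wt Wx; have full y : lspan [set v | exists c, joint_eigen ad_t c v] y.
  by apply: lspanS (weight_vectors_span y) => v [a av]; exists (fun h => a h).
have := eigen_graded ad_t_linear Wl Wt full Wx.
apply: lspanS => v [Wv [c cv]]; split=> //.
by apply: joint_eigen_root_space => h; exists (c h); exact: cv.
Qed.

Definition weight_basis : seq g := sval (cid (lspan_basis [set v | exists a, rs a v])).

Lemma weight_basisP : basis_of fullv weight_basis.
Proof.
rewrite /weight_basis; case: cid => X [fX XS XP] /=.
rewrite /basis_of fX andbT eqEsubv subvf /=.
by apply/subvP => x _; apply/XP; exact: weight_vectors_span.
Qed.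

Lemma weight_basis_weight x : x \in weight_basis -> exists a, rs a x.
Proof. by rewrite /weight_basis; case: cid => X [fX XS XP] /=; exact: XS. Qed.

Lemma other_weight a c x : c != a -> rs c x ->
  other_eigen ad_t (fun h => a h) x.
Proof.
move=> ca cx; exists (fun h => c h) => //.
by have /lfunPn[h ch] := ca; exists h.
Qed.

Lemma weight_disjoint a x :
  rs a x -> lspan [set v | exists2 c, c != a & rs c v] x -> x = 0.
Proof.
move=> ax ux; apply: (@eigen_disjoint _ _ _ ad_t ad_t_linear (fun h => a h)) => //.
by apply: lspanS ux => v [c]; exact: other_weight.
Qed.

(** The intersection of the two spans is stable under [t], hence spanned by weight
    vectors, each of which has a weight outside one of the two sets. *)
Lemma weight_sets_disjoint (P Q : tdual -> Prop) x : (forall a, P a -> Q a -> False) ->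
  lspan [set v | exists2 a, P a & rs a v] x ->
  lspan [set v | exists2 a, Q a & rs a v] x -> x = 0.
Proof.
move=> PQ Px Qx.
have stab (S : tdual -> Prop) (h : subvs_of t) v :
    lspan [set v | exists2 a, S a & rs a v] v ->
    lspan [set v | exists2 a, S a & rs a v] (br (vsval h) v).
  have l := linset_preim (lie_linearr brP (vsval h))
    (linset_lspan [set v | exists2 a, S a & rs a v]).
  move: v; apply: (lspan_min l) => v [a Sa av] /=.
  by apply: lspan_sub; exists a => //; rewrite av; exact: (linsetZ _ (root_space_linset a)).
pose W := [set v | lspan [set v | exists2 a, P a & rs a v] v /\
                   lspan [set v | exists2 a, Q a & rs a v] v].
have Wl : linset W.
  split=> [|k u v [Pu Qu] [Pv Qv]]; first by split; exact: lspan0.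
  by split; apply: lspanD => //; exact: lspanZ.
have Wt (h : subvs_of t) v : W v -> W (br (vsval h) v).
  by move=> [Pv Qv]; split; exact: stab.
have Wx : W x by [].
have l0 : linset [set v : g | v = 0].
  by split=> //= k u v -> ->; rewrite scaler0 addr0.
apply: (lspan_min l0 _ (weight_vectors_span_stable Wl Wt Wx)) => v [[Pv Qv] [a av]] /=.
have [Pa|nPa] := pselect (P a); apply: (weight_disjoint av).
  apply: lspanS Qv => u [c Qc cu]; exists c => //.
  by apply/eqP => ca; apply: (PQ a) => //; rewrite -ca.
by apply: lspanS Pv => u [c Pc cu]; exists c => //; apply: contra_notN nPa => /eqP <-.
Qed.

Lemma root_space_inj a c x : rs a x -> rs c x -> x != 0 -> a = c.
Proof.
move=> ax cx x0; apply/eqP; apply: contraT => ac; case/eqP: x0.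
by apply: (weight_disjoint ax); apply: lspan_sub; exists c; rewrite 1?eq_sym.
Qed.

Definition weight_list : seq tdual :=
  [seq xget 0 [set a | rs a v] | v <- weight_basis].

Lemma mem_weight_list a x : rs a x -> x != 0 -> a \in weight_list.
Proof.
move=> ax; apply: contraNT => na; apply/eqP; apply: (weight_disjoint ax).
rewrite (coord_basis (X := in_tuple weight_basis) weight_basisP (memvf x)).
apply: linset_sum; first exact: linset_lspan.
move=> i _ _; have vi : weight_basis`_i \in weight_basis by exact: mem_nth.
apply/lspanZ/lspan_sub; have [c cv] := weight_basis_weight vi.
have := xgetPex 0 (ex_intro (fun a => rs a _) c cv); set d := xget _ _ => dv.
exists d => //; apply: contraNneq na => <-.
by apply/mapP; exists (weight_basis`_i).
Qed.

(** A string of weight vectors ends, as there are finitely many weights. *)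
Lemma weight_string a c (u : nat -> g) : a != 0 ->
  (forall k, rs (c + a *+ k) (u k)) -> exists k, u k = 0.
Proof.
move=> a0 uk; apply: contrapT => /forallNP un0.
pose s := [seq c + a *+ k | k <- iota 0 (size weight_list).+1].
have us : uniq s.
  rewrite map_inj_uniq ?iota_uniq // => k l /addrI /eqP.
  have [h] : exists h, a h != 0.
    by have /lfunPn[h] := a0; rewrite zero_lfunE; exists h.
  move=> ah /eqP/lfunP/(_ h).
  rewrite -(scaler_nat k a) -(scaler_nat l a) 2!scale_lfunE.
  by move=> /(mulIf ah)/eqP; rewrite eqr_nat => /eqP.
have sub : {subset s <= weight_list}.
  by move=> _ /mapP[k _ ->]; apply: (mem_weight_list (uk k)); apply/eqP.
by have := uniq_leq_size us sub; rewrite size_map size_iota ltnn.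
Qed.

(** ** Brackets of opposite root vectors *)

Lemma root_br_opp a x y : rs a x -> rs (- a) y -> br x y \in t.
Proof.
by move=> ax ay; apply/root_space0; rewrite -(subrr a); exact: root_space_br.
Qed.

(** Let [x] and [y] have weights [a] and [-a], and [H = [x, y]].  On a vector of
    weight [c] killed by [x], the powers of [y] satisfy
    [x y^(k+1) v = (k+1) (c(H) - k a(H) / 2) y^k v]; the last nonzero one forces
    [2 c(H) = k a(H)].  For [a(H) = 2] this is the integrality of the weights of
    [sl_2], for [a(H) = 0] it shows that [H] is nilpotent. *)
Lemma highest_weight a c x y v : a != 0 -> rs a x -> rs (- a) y ->
    v != 0 -> rs c v -> br x v = 0 ->
  exists k : nat, 2 * c (vsproj t (br x y)) = k%:R * a (vsproj t (br x y)).
Proof.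
move=> a0 ax ay v0 cv xv; set H := vsproj t _.
have HE : vsval H = br x y by rewrite vsprojK //; exact: root_br_opp ax ay.
pose u k := iter k (br y) v.
have uk k : rs (c + (- a) *+ k) (u k).
  elim: k => [|k IH]; first by rewrite mulr0n addr0.
  by rewrite mulrS addrCA; exact: root_space_br.
have Hu k : br (br x y) (u k) = (c H - k%:R * a H) *: u k.
  rewrite -HE uk add_lfunE mulNrn opp_lfunE -scaler_nat scale_lfunE.
  by [].
have xu k : br x (u k.+1) = (k.+1%:R * (c H - k%:R * a H / 2)) *: u k.
  elim: k => [|k IH].
    by rewrite /= br_jacobir // xv br0r // addr0 (Hu 0%N) mul0r mul0r !subr0 mul1r.
  rewrite -[u k.+2]/(br y (u k.+1)) br_jacobir // (Hu k.+1) IH brrZ //.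
  rewrite -[br y (u k)]/(u k.+1) -scalerDl; congr (_ *: _).
  by field.
have [k /eqP uk0 kmin] : exists2 k, u k == 0 & forall l, u l == 0 -> (k <= l)%N.
  have exk : exists k, u k == 0.
    have [|k k0] := @weight_string (- a) c u _ uk; first by rewrite oppr_eq0.
    by exists k; apply/eqP.
  by have [k k0 kmin] := ex_minnP exk; exists k.
case: k uk0 kmin => [|k] uk0 kmin; first by rewrite /u /= in uk0; rewrite uk0 eqxx in v0.
have unz : u k != 0 by apply/negP => /kmin; rewrite ltnn.
have := xu k; rewrite uk0 br0r // => /esym/eqP; rewrite scaler_eq0 (negPf unz) orbF.
rewrite mulf_eq0 pnatr_eq0 /= subr_eq0 => /eqP ->; exists k.
by rewrite mulrC divfK // pnatr_eq0.
Qed.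

(** Apply [x] to [v] until a vector killed by [x] is reached. *)
Lemma weight_integrality a c x y v : a != 0 -> rs a x -> rs (- a) y ->
    v != 0 -> rs c v ->
  exists k l : nat, 2 * c (vsproj t (br x y)) =
                    (k%:R - l%:R) * a (vsproj t (br x y)).
Proof.
move=> a0 ax ay v0 cv; set H := vsproj t _.
pose u k := iter k (br x) v.
have uk k : rs (c + a *+ k) (u k).
  elim: k => [|k IH]; first by rewrite mulr0n addr0.
  by rewrite mulrS addrCA; exact: root_space_br.
have [k /eqP uk0 kmin] : exists2 k, u k == 0 & forall l, u l == 0 -> (k <= l)%N.
  have exk : exists k, u k == 0.
    by have [k k0] := weight_string a0 uk; exists k; apply/eqP.
  by have [k k0 kmin] := ex_minnP exk; exists k.
case: k uk0 kmin => [|k] uk0 kmin; first by rewrite /u /= in uk0; rewrite uk0 eqxx in v0.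
have unz : u k != 0 by apply/negP => /kmin; rewrite ltnn.
have [l] := highest_weight a0 ax ay unz (uk k) uk0.
rewrite -/H add_lfunE -(scaler_nat k a) scale_lfunE => lE.
exists l, (2 * k)%N; rewrite mulrBl -lE natrM mulrDr.
by rewrite /GRing.scale /= mulrA addrK.
Qed.

End RootSpaces.

Lemma seq_minimum {T : eqType} {R : realType} (s : seq T) (Q : T -> Prop) (f : T -> R) :
  (exists a, Q a) -> (forall a, Q a -> a \in s) ->
  exists a, Q a /\ forall c, Q c -> f a <= f c.
Proof.
elim: s Q => [|b s IH] Q exQ Qs; first by have [a /Qs] := exQ.
have [[a [Qa ab]]|none] := pselect (exists a, Q a /\ a != b); last first.
  have Qb a : Q a -> a = b.
    by move=> Qa; apply/eqP; apply: contraT => ab; case: none; exists a.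
  have [a Qa] := exQ; exists a; split=> // c Qc.
  by rewrite (Qb a Qa) (Qb c Qc).
have [||m [[Qm mb] mmin]] := IH (fun a => Q a /\ a != b); first by exists a.
  by move=> c [/Qs]; rewrite inE => /orP[/eqP ->|//]; rewrite eqxx.
have mminb c : Q c -> c != b -> f m <= f c by move=> Qc cb; exact: mmin.
have [Qb|nQb] := pselect (Q b); last first.
  exists m; split=> // c Qc; apply: mminb => //.
  by apply: contra_notN nQb => /eqP <-.
have [fbm|fmb] := leP (f b) (f m).
  exists b; split=> // c Qc; have [->//|cb] := eqVneq c b.
  exact: le_trans fbm (mminb c Qc cb).
exists m; split=> // c Qc; have [->|cb] := eqVneq c b; first exact: ltW.
exact: mminb.
Qed.

Section Reductive.
Context {R : realType} {g : vectType R[i]} (br : g -> g -> g) (t : {vspace g}).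
Local Notation K := R[i].
Hypothesis brP : is_lie_bracket br.
Hypothesis brR : is_reductive br.
Hypothesis tP : is_cartan br t.

Local Notation tdual := (tdual t).
Local Notation rs := (@root_space _ g br t).
Local Notation Phi := (@root_set _ g br t).
Implicit Types (x y z w : g).

(** An ideal commutes with a complementary ideal, since their brackets lie in
    both. *)
Lemma abelian_ideal_central (A : set g) : linset A ->
  (forall x y, A y -> A (br x y)) -> (forall x y, A x -> A y -> br x y = 0) ->
  forall x y, A y -> br x y = 0.
Proof.
move=> Al Aid Aab x y Ay.
have AvP v : v \in vspan A <-> A v := vspan_linset v Al.
have [|W' [W'id sumW capW]] := brR (W := vspan A).
  by move=> u v /AvP Av; apply/AvP; exact: Aid.
have /memv_addP[x1 /AvP Ax1 [x2 W'x2 ->]] : x \in (vspan A + W')%VS.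
  by rewrite sumW memvf.
rewrite (brlD brP) Aab // add0r.
have : br x2 y \in (vspan A :&: W')%VS.
  rewrite memv_cap; apply/andP; split; first by apply/AvP; exact: Aid.
  by rewrite (brC brP) memvN; exact: W'id.
by rewrite capW memv0 => /eqP.
Qed.

(** A complementary ideal of the centre contains all brackets. *)
Lemma central_bracket0 x y : (forall w, br w (br x y) = 0) -> br x y = 0.
Proof.
move=> cz; pose Z := [set z | forall w, br w z = 0].
have Zl : linset Z.
  split=> [w|a u v Zu Zv w]; first by rewrite (br0r brP).
  by rewrite (brrD brP) (brrZ brP) Zu Zv scaler0 addr0.
have ZvP v : v \in vspan Z <-> Z v := vspan_linset v Zl.
have [|W' [W'id sumW capW]] := brR (W := vspan Z).
  by move=> u v /ZvP Zv; apply/ZvP; rewrite Zv; case: Zl.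
have dec u : exists u1 u2, [/\ Z u1, u2 \in W' & u = u1 + u2].
  have /memv_addP[u1 /ZvP Zu1 [u2 W'u2 ->]] : u \in (vspan Z + W')%VS.
    by rewrite sumW memvf.
  by exists u1, u2.
have [x1 [x2 [Zx1 W'x2 xE]]] := dec x; have [y1 [y2 [Zy1 W'y2 yE]]] := dec y.
have : br x y \in (vspan Z :&: W')%VS.
  rewrite memv_cap; apply/andP; split; first by apply/ZvP.
  rewrite xE yE (brrD brP) Zy1 add0r (brlD brP) (brC brP x1) Zx1 oppr0 add0r.
  exact: W'id.
by rewrite capW memv0 => /eqP.
Qed.

Lemma br_vsproj a x y v c : rs a x -> rs (- a) y -> rs c v ->
  br (br x y) v = c (vsproj t (br x y)) *: v.
Proof.
move=> ax ay cv; rewrite -cv vsprojK //; exact: (root_br_opp brP tP ax ay).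
Qed.

(** By [weight_integrality] such a bracket acts by zero on all weight vectors, so
    it is central. *)
Lemma opposite_bracket0 a x y : a != 0 -> rs a x -> rs (- a) y ->
  a (vsproj t (br x y)) = 0 -> br x y = 0.
Proof.
move=> a0 ax ay aH; apply: central_bracket0 => w.
have lz : linset [set w | br w (br x y) = 0].
  apply: linset_eq; first exact: lie_linearl.
  by move=> k u v; rewrite scaler0 addr0.
apply: (lspan_min lz _ (weight_vectors_span brP tP w)) => v [c cv] /=.
rewrite (brC brP) (br_vsproj ax ay cv).
have [->|v0] := eqVneq v 0; first by rewrite scaler0 oppr0.
have [k [l /eqP]] := weight_integrality brP tP a0 ax ay v0 cv.
rewrite aH mulr0 mulf_eq0 pnatr_eq0 /= => /eqP ->.
by rewrite scale0r oppr0.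
Qed.

(** ** The Killing form *)

Lemma weight_basis_size : size (weight_basis br t) == dim g.
Proof.
rewrite -dimvf eq_sym; apply/eqP.
exact: (size_basis (X := in_tuple (weight_basis br t)) (weight_basisP brP tP)).
Qed.

Let wb : (dim g).-tuple g := Tuple weight_basis_size.

Let wbP : basis_of fullv wb.
Proof. exact: (weight_basisP brP tP). Qed.

Definition killing x y : K := endo_trace wb (br x \o br y).

Lemma killingC x y : killing x y = killing y x.
Proof. by apply: (endo_traceC wbP); exact: lie_linearr. Qed.

Lemma killing_br x y z : killing (br x y) z = killing x (br y z).
Proof.
have lr := lie_linearr brP; rewrite /killing.
have -> : endo_trace wb (br (br x y) \o br z) =
    endo_trace wb (br x \o (br y \o br z)) - endo_trace wb (br y \o (br x \o br z)).
  by rewrite -endo_traceB; apply: eq_endo_trace => v /=; rewrite (br_jacobil brP).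
have -> : endo_trace wb (br x \o br (br y z)) =
    endo_trace wb (br x \o (br y \o br z)) - endo_trace wb (br x \o (br z \o br y)).
  rewrite -endo_traceB; apply: eq_endo_trace => v /=.
  by rewrite (br_jacobil brP) (linear_valB (lr x)).
congr (_ - _); rewrite -[RHS]/(endo_trace wb ((br x \o br z) \o br y)).
by apply: (endo_traceC wbP) => // k u v /=; rewrite !lr.
Qed.

Lemma killing_linear y : linear ((killing^~ y) : g -> K^o).
Proof.
move=> k u v; rewrite -endo_traceD; apply: eq_endo_trace => w /=.
by rewrite (brlD brP) (brlZ brP).
Qed.

(** Invariance gives [a(h) killing x y = killing h [x, y] = - c(h) killing x y]. *)
Lemma killing_weight a c x y : rs a x -> rs c y -> a + c != 0 -> killing x y = 0.
Proof.
move=> ax cy /lfunPn[h]; rewrite zero_lfunE add_lfunE => ac.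
have := killing_br x (vsval h) y; rewrite (brC brP x) ax cy.
rewrite -scaleNr (linear_valZ (killing_linear y)) killingC.
rewrite [RHS]killingC (linear_valZ (killing_linear x)) => /eqP.
rewrite -subr_eq0 -scalerBl -opprD scaler_eq0 oppr_eq0 (negPf ac) /= => /eqP.
by rewrite killingC.
Qed.

Lemma killing_commute a x y : a != 0 -> rs a x -> br x y = 0 -> killing x y = 0.
Proof.
move=> /lfunPn[h]; rewrite zero_lfunE => ah ax xy.
have := killing_br (vsval h) x y; rewrite ax xy killingC [RHS]killingC.
rewrite (linear_val0 (killing_linear (vsval h))) killingC.
rewrite (linear_valZ (killing_linear y)) => /eqP.
by rewrite scaler_eq0 (negPf ah) => /eqP.
Qed.

(** On a nonzero bracket of opposite root vectors the Killing form is a nonzero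
    multiple of a sum of squares of integers. *)
Lemma killing_opposite_neq0 a x y : a != 0 -> rs a x -> rs (- a) y ->
  br x y != 0 -> killing (br x y) (br x y) != 0.
Proof.
move=> a0 ax ay xy0; set H := vsproj t (br x y).
have aH : a H != 0.
  by apply: contra_neq xy0; exact: opposite_bracket0.
have x0 : x != 0 by apply: contra_neq xy0 => ->; rewrite (br0l brP).
have wbi (i : 'I_(dim g)) : exists m : int, br (br x y) wb`_i = (m%:~R * a H / 2) *: wb`_i.
  have iw : wb`_i \in weight_basis br t by rewrite mem_nth // (eqP weight_basis_size).
  have [c cv] := weight_basis_weight iw.
  have v0 : wb`_i != 0 := basis_not0 wbP iw.
  have [k [l E]] := weight_integrality brP tP a0 ax ay v0 cv.
  exists (k%:Z - l%:Z); rewrite (br_vsproj ax ay cv); congr (_ *: _).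
  by rewrite rmorphB /= -!pmulrn -E mulrAC mulfV ?mul1r // pnatr_eq0.
have [m mE] := choice wbi.
have -> : killing (br x y) (br x y) = (a H / 2) ^+ 2 * (\sum_i m i ^+ 2)%:~R.
  rewrite /killing (endo_trace_eigen wbP (c := fun i => ((m i)%:~R * a H / 2) ^+ 2)).
    rewrite rmorph_sum mulr_sumr; apply: eq_bigr => i _ /=.
    by rewrite -mulrA exprMn mulrC rmorphXn.
  by move=> i /=; rewrite mE (brrZ brP) mE scalerA expr2.
rewrite mulf_neq0 ?expf_neq0 ?mulf_neq0 ?invr_eq0 ?pnatr_eq0 //.
rewrite intr_eq0; apply/negP; rewrite psumr_eq0; last by move=> i _; exact: sqr_ge0.
move=> /allP m0; have Hx : br (br x y) x = 0.
  rewrite [X in br _ X](coord_basis wbP (memvf x)).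
  rewrite (linear_val_sum (lie_linearr brP _)) big1 // => i _.
  rewrite (brrZ brP) mE; have := m0 i (mem_index_enum i).
  by rewrite sqrf_eq0 => /eqP ->; rewrite mul0r mul0r scale0r scaler0.
move: Hx; rewrite (br_vsproj ax ay ax) -/H => /eqP.
by rewrite scaler_eq0 (negPf aH) (negPf x0).
Qed.

(** On the line through [h] in the direction [h'], each of the functionals
    excludes at most one of the points [h + k h'] with [k] natural. *)
Lemma regular_element (s : seq tdual) : (forall a, a \in s -> a != 0) ->
  exists h : subvs_of t, forall a, a \in s -> complex.Re (a h) != 0.
Proof.
elim: s => [|c s IH] s0; first by exists 0.
have [|h hs] := IH; first by move=> a ais; apply: s0; rewrite inE ais orbT.
have [h' ch'] : exists h', complex.Re (c h') != 0.
  have /lfunPn[k] := s0 c (mem_head _ _); rewrite zero_lfunE => ck.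
  have [re0|] := eqVneq (complex.Re (c k)) 0; last by exists k.
  (* a purely imaginary value becomes real on multiplying by i *)
  exists ('i%C *: k); rewrite linearZ /=; move: ck re0.
  case: (c k) => u v /= uv u0; move: uv; rewrite u0 eq_complex /= eqxx /= => v0.
  by rewrite /GRing.scale /= mul0r mul1r sub0r oppr_eq0.
pose bad (a : tdual) (k : nat) := complex.Re (a (h + k%:R *: h')) == 0.
have badE a k : bad a k = (complex.Re (a h) + k%:R * complex.Re (a h') == 0).
  rewrite /bad linearD linearZ /= /GRing.scale /= raddfD /=; congr (_ + _ == _).
  rewrite -[k%:R]/(k%:R : R[i]) -(rmorph_nat (real_complex R)).
  by case: (a h') => u v /=; rewrite mul0r subr0.
have bad1 a k l : a \in c :: s -> bad a k -> bad a l -> k = l.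
  move=> ais; rewrite !badE => /eqP bk /eqP bl; apply/eqP.
  have kl : (k%:R - l%:R) * complex.Re (a h') = 0.
    by rewrite mulrBl; apply/eqP; rewrite subr_eq0; apply/eqP/(addrI (complex.Re (a h))); rewrite bk bl.
  move/eqP: kl; rewrite mulf_eq0 subr_eq0 eqr_nat => /orP[//|/eqP ah'].
  move: ais; rewrite inE => /orP[/eqP ac|ais]; first by rewrite -ac ah' eqxx in ch'.
  by have := hs a ais; move: bk; rewrite ah' mulr0 addr0 => ->; rewrite eqxx.
have [k kgood] : exists k, forall a, a \in c :: s -> ~~ bad a k.
  pose w a := xget 0%N [set k | bad a k].
  exists (\sum_(a <- c :: s) w a).+1 => a ais; apply/negP => ba.
  have := xgetPex 0%N (ex_intro (fun k => bad a k) _ ba); rewrite -/(w a) => wa.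
  have := bad1 a _ _ ais wa ba => E.
  have : (w a <= \sum_(b <- c :: s) w b)%N by rewrite (big_rem a) //= leq_addr.
  by rewrite E ltnn.
by exists (h + k%:R *: h') => a /kgood.
Qed.

End Reductive.

(** ** Every root has an sl_2-triple *)

Section Coroots.
Context {R : realType} {g : vectType R[i]} (br : g -> g -> g) (t : {vspace g}).
Local Notation K := R[i].
Hypothesis brP : is_lie_bracket br.
Hypothesis brR : is_reductive br.
Hypothesis tP : is_cartan br t.

Local Notation tdual := (tdual t).
Local Notation rs := (@root_space _ g br t).
Local Notation Phi := (@root_set _ g br t).
Implicit Types (x y z w v : g).

(** If all brackets of opposite root vectors of the ideal [I] vanish, then
    [D = [I, I]] has no component of weight zero.  Order the weights by the real
    part [l] of their value at a regular element.  Among the root vectors of [D]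
    killed by those of positive weight, one of lowest weight is also killed by
    those of negative weight: otherwise apply to it a root vector whose weight
    is the largest negative one with nonzero effect, which yields a vector of
    the same kind of lower weight.  So if [D] is nonzero its centre is an ideal
    of [g] that is nonzero, abelian, hence central, and yet has no component of
    weight zero. *)
Lemma isotropic_ideal_central (I : set g) : linset I ->
    (forall x y, I y -> I (br x y)) ->
    (forall a x y, a != 0 -> I x -> I y -> rs a x -> rs (- a) y -> br x y = 0) ->
  forall x y, I y -> br x y = 0.
Proof.
move=> Il Iid Iiso; apply: (abelian_ideal_central brP brR Il Iid) => x0 y0 Ix0 Iy0.
pose D := lspan [set z | exists x y, [/\ I x, I y & z = br x y]].
have Dl : linset D := linset_lspan _.
have DI v : D v -> I v.
  by move: v; apply: lspan_min => // _ [x [y [Ix Iy ->]]]; exact: Iid.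
have Did x y : D y -> D (br x y).
  have h := linset_preim (lie_linearr brP x) Dl.
  move: y; apply: (lspan_min h) => _ [u [v [Iu Iv ->]]] /=.
  rewrite (br_jacobir brP); apply: (linsetD Dl); apply: lspan_sub.
    by exists (br x u), v; split=> //; exact: Iid.
  by exists u, (br x v); split=> //; exact: Iid.
pose E := [set v | D v /\ exists2 a, a != 0 & rs a v].
have IE x : I x -> lspan [set v | I v /\ exists a, rs a v] x.
  by apply: (weight_vectors_span_stable brP tP Il) => h v; exact: Iid.
have isoI x y a c : I x -> I y -> rs a x -> rs c y -> a + c = 0 -> br x y = 0.
  move=> Ix Iy ax cy /eqP; rewrite addrC addr_eq0 => /eqP cE.
  have [a0|a0] := eqVneq a 0; last by apply: (Iiso a) => //; rewrite -cE.
  have [tab _ _] := tP; apply: tab; apply/(root_space0 tP); first by rewrite -a0.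
  by rewrite -[0 : tdual](oppr0 tdual) -a0 -cE.
have DE v : D v -> lspan E v.
  move: v; apply: lspan_min; first exact: linset_lspan.
  move=> _ [x [y [Ix Iy ->]]].
  have El : linset (lspan E) := linset_lspan _.
  have h1 := linset_preim (lie_linearl brP y) El.
  apply: (lspan_min h1 _ (IE x Ix)) => {Ix} u [Iu [a au]] /=.
  have h2 := linset_preim (lie_linearr brP u) El.
  apply: (lspan_min h2 _ (IE y Iy)) => {Iy} v [Iv [c cv]] /=.
  have [ac|ac] := eqVneq (a + c) 0; first by rewrite (isoI u v a c) //; case: El.
  apply: lspan_sub; split; last by exists (a + c) => //; exact: root_space_br.
  by apply: lspan_sub; exists u, v.
have D0 v : D v -> rs 0 v -> v = 0.
  move=> /DE Ev v0; apply: (weight_disjoint brP v0).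
  by apply: lspanS Ev => u [_ [a a0 au]]; exists a.
have DIbr x y a c : D x -> I y -> rs a x -> rs c y -> a + c = 0 -> br x y = 0.
  by move=> /DI; exact: isoI.
suff E0 : E `<=` [set u : g | u = 0].
  have l0 : linset [set u : g | u = 0].
    by split=> //= k u w -> ->; rewrite scaler0 addr0.
  have D00 : D (br x0 y0) by apply: lspan_sub; exists x0, y0.
  exact: (lspan_min l0 E0 (DE _ D00)).
apply: contrapT => /existsNP[v0 /not_implyP[Ev0 /= v00]].
have [h0 h0P] : exists h : subvs_of t, forall a, a \in weight_list br t -> a != 0 ->
    complex.Re (a h) != 0.
  have [|h hP] := @regular_element _ _ t [seq a <- weight_list br t | a != 0].
    by move=> a; rewrite mem_filter => /andP[].
  by exists h => a aL a0; apply: hP; rewrite mem_filter a0.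
pose l (a : tdual) : R := complex.Re (a h0).
have lD a c : l (a + c) = l a + l c by rewrite /l add_lfunE raddfD.
pose EW (a : tdual) v := [/\ D v, a != 0, rs a v & v != 0].
have EWl a v : EW a v -> l a != 0.
  by move=> [_ a0 av v0']; apply: h0P => //; exact: (mem_weight_list brP tP av).
have EWL a v : EW a v -> a \in weight_list br t.
  by move=> [_ a0 av v0']; exact: (mem_weight_list brP tP av).
have EWbr a c x y : EW a x -> EW c y -> br x y != 0 -> EW (a + c) (br x y).
  move=> [Dx a0 ax x0'] [Dy c0 cy y0'] xy; split=> //; first exact: Did.
    by apply: contra_neq xy => ac; exact: (DIbr x y a c Dx (DI _ Dy)).
  exact: root_space_br.
pose X a := exists2 v, EW a v & forall c y, EW c y -> 0 < l c -> br y v = 0.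
have [||a [[v av vX] amin]] := @seq_minimum _ _ (weight_list br t) X l.
- have [||a [[v av] amax]] := @seq_minimum _ _ (weight_list br t)
    (fun a => exists v, EW a v) (fun a => - l a).
  + case: Ev0 => Dv0 [a a0 av0]; exists a, v0; split=> //; exact/eqP.
  + by move=> a [v']; exact: EWL.
  exists a, v => // c y cy lc; apply/eqP; apply: contraT => yv.
  have := amax (c + a) (ex_intro _ _ (EWbr _ _ _ _ cy av yv)).
  by rewrite lD opprD lerDr oppr_ge0 leNgt lc.
- by move=> a [v' /EWL].
have vD c y : EW c y -> br y v = 0.
  move=> cy; apply: contrapT => /eqP yv.
  pose Q c := exists y, EW c y /\ br y v != 0.
  have [||d [[u [du uv]] dmax]] := @seq_minimum _ _ (weight_list br t) Q (fun a => - l a).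
  - by exists c, y.
  - by move=> d [u [/EWL]].
  have ld : l d < 0.
    rewrite lt_neqAle (EWl d u) //= leNgt; apply/negP => ld.
    by rewrite (vX d u du ld) eqxx in uv.
  have /amin : X (d + a).
    exists (br u v); first exact: EWbr.
    move=> e w ew le; rewrite (br_jacobir brP) (vX e w ew le) (br0r brP) addr0.
    apply/eqP; apply: contraT => wuv.
    have wu : br w u != 0 by apply: contra_neq wuv => ->; rewrite br0l.
    have := dmax (e + d) (ex_intro _ _ (conj (EWbr _ _ _ _ ew du wu) wuv)).
    by rewrite lD opprD lerDr oppr_ge0 leNgt le.
  by rewrite lD lerDr leNgt ld.
pose A := [set z | D z /\ forall y, D y -> br y z = 0].
have Al : linset A.
  split=> [|k x y [Dx xA] [Dy yA]].
    by split=> [|y _]; [case: Dl|rewrite br0r].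
  split=> [|w Dw]; first by case: Dl => _; apply.
  by rewrite (brrD brP) (brrZ brP) xA // yA // scaler0 addr0.
have Aid x y : A y -> A (br x y).
  move=> [Dy yA]; split; first exact: Did.
  move=> w Dw; rewrite (br_jacobir brP) (yA w Dw) (br0r brP) addr0.
  by apply: yA; rewrite (brC brP) -scaleN1r; apply: (linsetZ _ Dl); exact: Did.
have Aab x y : A x -> A y -> br x y = 0 by move=> [Dx _] [_ yA]; exact: yA.
have Av : A v.
  case: (av) => Dv' a0 av' v0'; split=> // y Dy.
  have l0 : linset [set y | br y v = 0].
    split=> [|k x w /= xv wv]; first by rewrite /= br0l.
    by rewrite /= (brlD brP) (brlZ brP) xv wv scaler0 addr0.
  apply: (lspan_min l0 _ (DE y Dy)) => w [Dw [c c0 cw]] /=.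
  have [->|w0] := eqVneq w 0; first by rewrite br0l.
  by apply: (vD c).
have vc : rs 0 v.
  move=> h; rewrite zero_lfunE scale0r.
  exact: (abelian_ideal_central brP brR Al Aid Aab).
case: av => Dv' a0 av' /eqP; apply; exact: D0.
Qed.

(** A root vector orthogonal to all its opposites under the bracket lies in the
    radical of the Killing form, which is an ideal without [sl_2]-triples. *)
Lemma opposite_bracket_exists a x : a != 0 -> rs a x -> x != 0 ->
  exists2 y, rs (- a) y & br x y != 0.
Proof.
move=> a0 ax x0; apply: contrapT => /forall2NP none.
have {}none y : rs (- a) y -> br x y = 0.
  by move=> ay; case: (none y) => // /negP; rewrite negbK => /eqP.
pose I := [set z | forall w, killing brP tP z w = 0].
have Il : linset I.
  split=> [w|k u v Iu Iv w]; first exact: (linear_val0 (killing_linear brP tP w)).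
  by rewrite (killing_linear brP tP w) /= Iu Iv scaler0 addr0.
have Iid u v : I v -> I (br u v).
  move=> Iv w; rewrite (brC brP) -scaleN1r (linear_valZ (killing_linear brP tP w)).
  by rewrite (killing_br brP tP) Iv scaler0.
have Iiso c u v : c != 0 -> I u -> I v -> rs c u -> rs (- c) v -> br u v = 0.
  move=> c0 Iu Iv cu cv; apply/eqP; apply: contraT => uv.
  have := killing_opposite_neq0 brP brR tP c0 cu cv uv.
  by rewrite (Iid u v Iv) eqxx.
have Ix : I x.
  move=> w; rewrite killingC.
  have l0 : linset [set w | killing brP tP w x = 0].
    apply: (linset_eq (f' := fun=> 0 : K^o)); first exact: killing_linear.
    by move=> k u v; rewrite scaler0 addr0.
  apply: (lspan_min l0 _ (weight_vectors_span brP tP w)) => v [c cv] /=.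
  rewrite killingC; have [ac|ac] := eqVneq (a + c) 0; last exact: killing_weight ac.
  apply: (killing_commute _ _ a0 ax); apply: none.
  by move/eqP: ac; rewrite addrC addr_eq0 => /eqP <-.
have xc : rs 0 x.
  by move=> h; rewrite zero_lfunE scale0r; exact: (isotropic_ideal_central Il Iid Iiso).
by move/eqP: a0; apply; exact: (root_space_inj brP ax xc x0).
Qed.

Lemma sl2_triple a x : a != 0 -> rs a x -> x != 0 ->
  exists2 y, rs (- a) y & a (vsproj t (br x y)) = 2.
Proof.
move=> a0 ax x0; have [y ay xy] := opposite_bracket_exists a0 ax x0.
have aH : a (vsproj t (br x y)) != 0.
  by apply: contra_neq xy; exact: (opposite_bracket0 brP brR tP a0 ax ay).
exists ((2 / a (vsproj t (br x y))) *: y).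
  exact: (linsetZ _ (root_space_linset (t := t) brP _)).
by rewrite (brrZ brP) !linearZ /= /GRing.scale /= divfK.
Qed.

(** The bracket [g_a x g_(-a) -> t] vanishes wherever [a] vanishes on it, so it
    has rank one: its values are multiples of the coroot. *)
Lemma bracket_coroot a x y : a != 0 -> rs a x -> rs (- a) y ->
  br x y = (a (vsproj t (br x y)) / 2) *: vsval (coroot br a).
Proof.
move=> a0 ax ay; have [->|x0] := eqVneq x 0.
  by rewrite br0l // !linear0 mul0r scale0r.
have [f af ef] := sl2_triple a0 ax x0; set e := x in ax x0 ef *.
pose B u v := a (vsproj t (br u v)); pose h := br e f.
have Bl v : linear (B^~ v : g -> K^o).
  by move=> k u w; rewrite /B (lie_linearl brP) !linearP.
have Br u : linear (B u : g -> K^o).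
  by move=> k v w; rewrite /B (lie_linearr brP) !linearP.
have rl c := root_space_linset (t := t) brP c.
have B0 u v : rs a u -> rs (- a) v -> B u v = 0 -> br u v = 0.
  by move=> au av; exact: (opposite_bracket0 brP brR tP a0).
have Bef : B e f = 2 by [].
have n2 : 2 != 0 :> K by rewrite pnatr_eq0.
have P1 v : rs (- a) v -> br e v = (B e v / 2) *: h.
  move=> av; apply/eqP; rewrite -subr_eq0 -(brrZ brP) -(linear_valB (lie_linearr brP e)).
  apply/eqP/B0 => //; first exact: (linsetB (rl _) av (linsetZ _ (rl _) af)).
  by rewrite (linear_valB (Br e)) (linear_valZ (Br e)) Bef /GRing.scale /= divfK ?subrr.
have P2 u : rs a u -> br u f = (B u f / 2) *: h.
  move=> au; apply/eqP; rewrite -subr_eq0 -(brlZ brP) -(linear_valB (lie_linearl brP f)).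
  apply/eqP/B0 => //; first exact: (linsetB (rl _) au (linsetZ _ (rl _) ax)).
  by rewrite (linear_valB (Bl f)) (linear_valZ (Bl f)) Bef /GRing.scale /= divfK ?subrr.
have P3 u v : rs a u -> rs (- a) v -> B u f != 0 -> br u v = (B u v / 2) *: h.
  move=> au av uf; have -> : (B u v / 2) *: h = (B u v / B u f) *: br u f.
    by rewrite (P2 u au) scalerA; congr (_ *: _); rewrite mulrA divfK.
  apply/eqP; rewrite -subr_eq0 -(brrZ brP) -(linear_valB (lie_linearr brP u)).
  apply/eqP/B0 => //; first exact: (linsetB (rl _) av (linsetZ _ (rl _) af)).
  by rewrite (linear_valB (Br u)) (linear_valZ (Br u)) /GRing.scale /= divfK ?subrr.
have P u v : rs a u -> rs (- a) v -> br u v = (B u v / 2) *: h.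
  move=> au av; have [uf|] := eqVneq (B u f) 0; last exact: P3.
  have := P3 (u + e) v (linsetD (rl _) au ax) av.
  rewrite !(linear_valD (Bl _)) uf add0r Bef => /(_ n2).
  rewrite (brlD brP) (P1 v av) => /eqP.
  by rewrite mulrDl scalerDl (inj_eq (addIr _)) => /eqP.
have ht : h \in t := root_br_opp brP tP ax af.
suff -> : coroot br a = vsproj t h by rewrite vsprojK // -P.
have in_h z : lspan [set z | exists x y, [/\ rs a x, rs (- a) y & z = br x y]] z ->
    exists k, z = k *: h.
  have lh : linset [set z | exists k, z = k *: h].
    split=> [|k u v [p ->] [q ->]]; first by exists 0; rewrite scale0r.
    by exists (k * p + q); rewrite scalerDl scalerA.
  by apply: (lspan_min lh) => _ [u [v [au av ->]]]; exists (B u v / 2); exact: P.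
rewrite /coroot; case: xgetP => [H _ [/in_h[k Hk] aH]|/(_ (vsproj t h))[]].
  have HE : H = k *: vsproj t h by apply: subvs_inj; rewrite Hk linearZ /= vsprojK.
  suff k1 : k = 1 by rewrite HE k1; exact: (scale1r (vsproj t h)).
  by apply: (mulIf n2); rewrite mul1r -[RHS]aH HE linearZ /= ef.
split=> //; rewrite vsprojK //; apply: lspan_sub.
by exists e, f.
Qed.

(** ** Sums of roots in the nilradical of a parabolic subset *)

Section Parabolic.
Context (psi0 : set tdual).
Hypothesis psiP : is_parabolic br psi0.

Lemma root_opp a : Phi a -> Phi (- a).
Proof. by case: psiP => _ _ <- /= [|] h; [right|left]; rewrite ?opprK. Qed.

(** If [- (a + c)] were in the parabolic subset, so would be its sum [- a] with
    [c]. *)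
Lemma nil_root_add a c : psi0 a -> ~ psi0 (- a) -> psi0 c -> ~ psi0 (- c) ->
  Phi (a + c) -> psi0 (a + c) /\ ~ psi0 (- (a + c)).
Proof.
case: (psiP) => sub add _ pa na pc nc pac; split; first exact: add.
move=> nac; apply: na; have E : - a = - (a + c) + c by rewrite opprD subrK.
by rewrite E; apply: add => //; rewrite -E; exact/root_opp/sub.
Qed.

(** Let [a] be the first summand and [H = [e, f]] for a triple with [a(H) = 2]. If
    [a + c] is a root for another summand [c], replacing both by it gives a shorter
    sum. Otherwise [e] kills the root vectors of weight [c], so that [c(H)] is a
    natural number for all other summands, and the sum does not vanish at [H]. *)
Lemma nil_root_sum_neq0 (s : seq tdual) : s != [::] ->
    (forall a, a \in s -> psi0 a /\ ~ psi0 (- a)) ->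
  \sum_(a <- s) a != 0.
Proof.
have [n] := ubnP (size s); elim: n s => // n IH [//|a s] /= sn _ sP.
case: (psiP) => sub _ _.
have [pa na] := sP a (mem_head _ _); have [a0 [e ae e0]] := sub _ pa.
have sP' c : c \in s -> psi0 c /\ ~ psi0 (- c).
  by move=> cs; apply: sP; rewrite inE cs orbT.
have [[c cs pac]|none] := pselect (exists2 c, c \in s & Phi (a + c)).
  have -> : \sum_(d <- a :: s) d = \sum_(d <- (a + c) :: rem c s) d.
    by rewrite !big_cons (big_rem c cs) addrA.
  have [pc nc] := sP' c cs; apply: IH => //.
    rewrite /= size_rem // prednK; first by rewrite -ltnS.
    by case: (s) cs.
  move=> d; rewrite inE => /orP[/eqP ->|/mem_rem/sP' //].
  exact: nil_root_add.
have [f af ef] := sl2_triple a0 ae e0; set H := vsproj t (br e f) in ef.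
have sH c : c \in s -> exists k : nat, c H = k%:R.
  move=> cs; have [pc nc] := sP' c cs; have [c0 [v cv v0]] := sub _ pc.
  have ev : br e v = 0.
    apply: contrapT => /eqP ev0; apply: none; exists c => //; split; last first.
      by exists (br e v) => //; exact: root_space_br.
    by apply/eqP => /eqP; rewrite addrC addr_eq0 => /eqP cE; apply: na; rewrite -cE.
  have [k] := highest_weight brP tP a0 ae af v0 cv ev.
  rewrite -/H ef mulrC => /(mulIf _) E; exists k; apply: E.
  by rewrite pnatr_eq0.
have [k kE] : exists k : nat, (\sum_(c <- s) c) H = k%:R.
  rewrite big_seq; elim/big_ind: _ => [|c d [k ck] [l dl]|c /sH //].
    by exists 0%N; rewrite zero_lfunE.
  by exists (k + l)%N; rewrite add_lfunE ck dl natrD.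
apply/eqP => /lfunP/(_ H); rewrite big_cons zero_lfunE add_lfunE ef kE.
by rewrite -natrD => /eqP; rewrite pnatr_eq0.
Qed.

End Parabolic.
End Coroots.

(** * Truncated current algebras *)

Section CurrentBracket.
Context {K : numFieldType} {g : vectType K} (br : g -> g -> g) {r : nat}.
Hypothesis brP : is_lie_bracket br.

Local Notation cur := (current g r).
Local Notation cb := (@current_br _ g br r).

(** The coefficient [x] at the power [n], also for [n >= r], where it is zero, so
    that the bracket of homogeneous elements needs no case distinction. *)
Definition homog (n : nat) (x : g) : cur := [ffun k : 'I_r => if k == n :> nat then x else 0].

Lemma eps_homog (i : 'I_r) x : eps i x = homog i x.
Proof. by apply/ffunP => k; rewrite !ffunE. Qed.

Lemma homog_linear n : linear (homog n).
Proof.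
move=> a x y; apply/ffunP => k; rewrite !ffunE.
by case: eqP => // _; rewrite scaler0 addr0.
Qed.

Lemma homog_large n x : (r <= n)%N -> homog n x = 0.
Proof. by move=> rn; apply/ffunP => k; rewrite !ffunE ltn_eqF // (leq_trans (ltn_ord k)). Qed.

Lemma current_sum (x : cur) : x = \sum_(i < r) homog i (x i).
Proof.
apply/ffunP => k; rewrite sum_ffunE (bigD1 k) //= ffunE eqxx big1 ?addr0 // => i ik.
by rewrite ffunE; case: eqP => // /val_inj ki; rewrite ki eqxx in ik.
Qed.

Lemma current_br_linearl y : linear (cb^~ y).
Proof.
move=> a u v; apply/ffunP => k; rewrite !ffunE scaler_sumr -big_split /=.
apply: eq_bigr => i _; rewrite scaler_sumr -big_split /=; apply: eq_bigr => j _.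
by rewrite !ffunE (brlD brP) (brlZ brP).
Qed.

Lemma current_br_linearr x : linear (cb x).
Proof.
move=> a u v; apply/ffunP => k; rewrite !ffunE scaler_sumr -big_split /=.
apply: eq_bigr => i _; rewrite scaler_sumr -big_split /=; apply: eq_bigr => j _.
by rewrite !ffunE (brrD brP) (brrZ brP).
Qed.

Lemma current_br_homog m n x y : cb (homog m x) (homog n y) = homog (m + n) (br x y).
Proof.
apply/ffunP => k; rewrite !ffunE.
have [mr|rm] := ltnP m r; last first.
  rewrite big1 => [|i _].
    by case: eqP => // E; have := ltn_ord k; rewrite E ltnNge (leq_trans rm) ?leq_addr.
  rewrite big1 // => j _; rewrite ffunE ltn_eqF ?(br0l brP) //.
  exact: leq_trans (ltn_ord i) rm.
have [nr|rn] := ltnP n r; last first.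
  rewrite big1 => [|i _].
    by case: eqP => // E; have := ltn_ord k; rewrite E ltnNge (leq_trans rn) ?leq_addl.
  rewrite big1 // => j _; rewrite [X in br _ X]ffunE ltn_eqF ?(br0r brP) //.
  exact: leq_trans (ltn_ord j) rn.
rewrite (bigD1 (Ordinal mr)) //= [X in _ + X]big1 ?addr0 => [|i im]; last first.
  rewrite big1 // => j _; rewrite ffunE.
  by rewrite -(inj_eq val_inj) /= in im; rewrite (negPf im) (br0l brP).
case: eqP => [kE|kE].
  rewrite (bigD1 (Ordinal nr)) //= ?kE ?eqxx // big1 ?addr0 => [|j /andP[_ jn]].
    by rewrite !ffunE !eqxx.
  by rewrite -(inj_eq val_inj) /= in jn; rewrite [X in br _ X]ffunE (negPf jn) (br0r brP).
rewrite big1 // => j /eqP jE; rewrite [X in br _ X]ffunE; case: eqP => [jn|_].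
  by case: kE; rewrite -jE jn.
by rewrite (br0r brP).
Qed.

Lemma homog_lspan (x : cur) : lspan [set v | exists n z, v = homog n z] x.
Proof.
rewrite [x]current_sum; apply: linset_sum; first exact: linset_lspan.
by move=> i _ _; apply: lspan_sub; exists i, (x i).
Qed.

Lemma current_is_lie : is_lie_bracket cb.
Proof.
have l0 : linset [set v : cur | v = 0].
  by split=> //= a u v -> ->; rewrite scaler0 addr0.
split; [exact: current_br_linearl|exact: current_br_linearr| |].
  move=> x; apply/ffunP => k; rewrite !ffunE; set S := \sum_(i < r) _.
  (* exchange the summation indices i and j *)
  have SN : S = - S.
    rewrite {1}/S; under eq_bigr do rewrite big_mkcond.
    rewrite exchange_big -sumrN; apply: eq_bigr => i _.
    rewrite -sumrN [RHS]big_mkcond; apply: eq_bigr => j _ /=.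
    by rewrite addnC; case: ifP => // _; rewrite (brC brP).
  apply/eqP; have : 2 *: S == 0 by rewrite scaler_nat mulr2n {1}SN addNr.
  by rewrite scaler_eq0 pnatr_eq0.
move=> x y z.
have lin1 (f : cur -> cur) : linear f -> linset [set v | f v = 0].
  by move=> fl; have /= := linset_preim fl l0.
have ll := current_br_linearl; have lr := current_br_linearr.
apply: (lspan_min (lin1 (fun x => cb x (cb y z) + cb y (cb z x) + cb z (cb x y)) _) _
          (homog_lspan x)).
  by move=> a u v /=; rewrite !(lr, ll) !scalerDr [LHS](AC ((2*2)*2) ((1*3*5)*(2*4*6))).
move=> _ [m [{}x ->]] /=.
apply: (lspan_min (lin1 (fun y => cb (homog m x) (cb y z) + cb y (cb z (homog m x)) +
          cb z (cb (homog m x) y)) _) _ (homog_lspan y)).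
  by move=> a u v /=; rewrite !(lr, ll) !scalerDr [LHS](AC ((2*2)*2) ((1*3*5)*(2*4*6))).
move=> _ [n [{}y ->]] /=.
apply: (lspan_min (lin1 (fun z => cb (homog m x) (cb (homog n y) z) +
   cb (homog n y) (cb z (homog m x)) + cb z (cb (homog m x) (homog n y))) _) _ (homog_lspan z)).
  by move=> a u v /=; rewrite !(lr, ll) !scalerDr [LHS](AC ((2*2)*2) ((1*3*5)*(2*4*6))).
move=> _ [p [{}z ->]] /=; rewrite !current_br_homog.
rewrite (addnC p m) (addnCA n m p) (addnCA p m n) (addnC p n).
rewrite -!(linear_valD (homog_linear _)).
by rewrite (lie_jacobi brP) (linear_val0 (homog_linear _)).
Qed.

End CurrentBracket.

(** * The subalgebras of a parabolic filtration *)

Section Filtration.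
Context {R : realType} {g : vectType R[i]} (br : g -> g -> g) (t : {vspace g}).
Local Notation K := R[i].
Hypothesis brP : is_lie_bracket br.
Hypothesis tP : is_cartan br t.

Local Notation tdual := (tdual t).
Local Notation rs := (@root_space _ g br t).
Local Notation Phi := (@root_set _ g br t).

Lemma sign_involutive (b : bool) : involutive (fun a : tdual => (-1) ^+ b *: a).
Proof. by move=> a; rewrite scalerA -signr_addb addbb scale1r. Qed.

Lemma signT (a : tdual) : (-1) ^+ true *: a = - a.
Proof. by rewrite -[_ ^+ true]/(-1) scaleN1r. Qed.

Lemma signF (a : tdual) : (-1) ^+ false *: a = a.
Proof. by rewrite -[_ ^+ false]/1 scale1r. Qed.

Context {r : nat} (psi : nat -> set tdual).
Hypothesis psiP : is_parabolic_filtration br r psi.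
Local Notation phi := (levi_factor psi).
Local Notation nu := (nilradical_roots psi).
Local Notation cur := (current g r).
Local Notation cb := (@current_br _ g br r).
Local Notation par b := (@parabolic _ g br t r psi b).

Lemma filtration_mono i j : (i <= j)%N -> psi i `<=` psi j.
Proof.
case: psiP => _ step _; elim: j => [|j IH]; first by rewrite leqn0 => /eqP ->.
by rewrite leq_eqVlt => /orP[/eqP -> //|/IH le a /le/step].
Qed.

Lemma filtration_root i : psi i `<=` Phi.
Proof. by case: psiP => prb _ _; case: (prb i). Qed.

Lemma filtration_root_opp a : Phi a -> Phi (- a).
Proof. by case: psiP => prb _ _; exact: (root_opp (prb 0%N)). Qed.

Lemma sign_root (b : bool) a : Phi a -> Phi ((-1) ^+ b *: a).
Proof.
case: b => Pa; rewrite ?signT ?signF //.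
exact: filtration_root_opp.
Qed.

Definition graded_span (P : nat -> tdual -> Prop) : set cur :=
  lspan [set v | exists i a x, [/\ P i a, rs a x & v = homog i x]].

(** In [levi_wt] and [par_wt], the weight zero stands for the Cartan subalgebra.
    The sign turns the roots of [nilradical b] into those of [nu]. *)
Definition levi_wt i a := a = 0 \/ phi i a.
Definition nil_wt (b : bool) i a := nu i ((-1) ^+ b *: a).
Definition par_wt (b : bool) i a := a = 0 \/ psi i ((-1) ^+ b *: a).

Lemma leviE v : v \in levi br r psi <-> graded_span levi_wt v.
Proof.
rewrite vspanP; split; apply: lspan_min; try exact: linset_lspan.
  move=> _ [i [x [-> ix]]]; rewrite eps_homog; apply: lspan_sub.
  case: ix => [xt|[a ia ax]]; last by exists i, a, x; split=> //; right.
  by exists i, 0, x; split; [left|apply/(root_space0 tP)|].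
move=> _ [i [a [x [ia ax ->]]]]; have [ir|ri] := ltnP i r; last first.
  by rewrite homog_large //; exact: lspan0.
apply: lspan_sub; exists (Ordinal ir), x; rewrite eps_homog; split=> //.
case: ia => [a0|pa]; first by left; apply/(root_space0 tP); rewrite -a0.
by right; exists a.
Qed.

Lemma nilradicalE b v : v \in nilradical br r psi b <-> graded_span (nil_wt b) v.
Proof.
rewrite vspanP; split; apply: lspan_min; try exact: linset_lspan.
  move=> _ [i [x [-> [a ia ax]]]]; rewrite eps_homog; apply: lspan_sub.
  by exists i, ((-1) ^+ b *: a), x; split=> //; rewrite /nil_wt sign_involutive.
move=> _ [i [a [x [ia ax ->]]]]; have [ir|ri] := ltnP i r; last first.
  by rewrite homog_large //; exact: lspan0.
apply: lspan_sub; exists (Ordinal ir), x; rewrite eps_homog; split=> //.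
by exists ((-1) ^+ b *: a); rewrite // sign_involutive.
Qed.

Lemma graded_spanS P Q : (forall i a, P i a -> Q i a) -> graded_span P `<=` graded_span Q.
Proof.
by move=> PQ; apply: lspanS => _ [i [a [x [/PQ ia ax ->]]]]; exists i, a, x.
Qed.

Lemma sign_levi (b : bool) i a : phi i ((-1) ^+ b *: a) <-> phi i a.
Proof.
by case: b; rewrite ?signT ?signF // /levi_factor /= opprK; split=> -[].
Qed.

Lemma par_wt_split b i a : par_wt b i a <-> levi_wt i a \/ nil_wt b i a.
Proof.
split=> [[->|pa]|[[->|/(sign_levi b)[pa _]]|[pa _]]]; try by left; left.
- have [fa|nfa] := pselect (phi i ((-1) ^+ b *: a)); last by right.
  by left; right; apply/(sign_levi b).
- by left.
- by right.
- by right.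
Qed.

Lemma parabolicE b v : v \in par b <-> graded_span (par_wt b) v.
Proof.
split=> [/memv_addP[u /leviE lu [w /nilradicalE nw ->]]|].
  apply: lspanD.
    by apply: graded_spanS lu => i a h; apply/par_wt_split; left.
  by apply: graded_spanS nw => i a h; apply/par_wt_split; right.
have pl : linset [set v | v \in par b].
  by split=> [|k u w pu pw] /=; [exact: mem0v|rewrite memvD // memvZ].
move: v; apply: (lspan_min pl) => _ [i [a [x [/par_wt_split ia ax ->]]]] /=.
have h (P : nat -> tdual -> Prop) : P i a -> graded_span P (homog i x).
  by move=> Pa; apply: lspan_sub; exists i, a, x.
case: ia => [la|na]; first by apply: (subvP (addvSl _ _)); apply/leviE/h.
by apply: (subvP (addvSr _ _)); apply/nilradicalE/h.
Qed.

Lemma par_wt_levi i a : par_wt true i a -> par_wt false i a -> levi_wt i a.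
Proof.
move=> [->|na]; [by left|move=> [->|pa]; [by left|right]].
by move: na pa; rewrite signT signF.
Qed.

Lemma levi_wt_par b i a : levi_wt i a -> par_wt b i a.
Proof. by move=> h; apply/par_wt_split; left. Qed.

(** ** Brackets *)

Lemma graded_span_br (P Q S : nat -> tdual -> Prop) u v :
    (forall i j a c, P i a -> Q j c -> a + c = 0 \/ Phi (a + c) -> S (i + j)%N (a + c)) ->
  graded_span P u -> graded_span Q v -> graded_span S (cb u v).
Proof.
move=> PQS Pu Qv; have Sl : linset (graded_span S) := linset_lspan _.
apply: (lspan_min (linset_preim (current_br_linearl brP v) Sl) _ Pu).
move=> _ [i [a [x [ia ax ->]]]] /=.
apply: (lspan_min (linset_preim (current_br_linearr brP _) Sl) _ Qv).
move=> _ [j [c [y [jc cy ->]]]] /=; rewrite current_br_homog //.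
have [xy0|xy0] := eqVneq (br x y) 0.
  by rewrite xy0 (linear_val0 (homog_linear _)); case: Sl.
apply: lspan_sub; exists (i + j)%N, (a + c), (br x y).
have acxy : rs (a + c) (br x y) by exact: root_space_br.
split=> //; apply: PQS => //; have [->|ac0] := eqVneq (a + c) 0; first by left.
by right; split=> //; exists (br x y).
Qed.

Lemma par_wt_add b i j a c : par_wt b i a -> par_wt b j c ->
  a + c = 0 \/ Phi (a + c) -> par_wt b (i + j)%N (a + c).
Proof.
move=> ia jc [->|pac]; first by left.
case: ia => [->|ia]; last case: jc => [->|jc].
- rewrite add0r; case: jc => [->|jc]; first by left.
  by right; apply: filtration_mono jc; exact: leq_addl.
- by rewrite addr0; right; apply: filtration_mono ia; exact: leq_addr.
right; rewrite scalerDr; case: psiP => prb _ _; case: (prb (i + j)%N) => _ add _.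
apply: add; first by apply: filtration_mono ia; exact: leq_addr.
  by apply: filtration_mono jc; exact: leq_addl.
by rewrite -scalerDr; exact: sign_root.
Qed.

Lemma parabolic_br b u v : u \in par b -> v \in par b ->
  cb u v \in par b.
Proof.
move=> /parabolicE pu /parabolicE pv; apply/parabolicE.
by apply: (graded_span_br _ pu pv) => i j a c; exact: par_wt_add.
Qed.

Lemma levi_br u v : u \in levi br r psi -> v \in levi br r psi -> cb u v \in levi br r psi.
Proof.
move=> /leviE lu /leviE lv; apply/leviE; apply: (graded_span_br _ lu lv) => i j a c la lc ac.
by apply: par_wt_levi; apply: par_wt_add => //; exact: levi_wt_par.
Qed.

(** ** The triangular decomposition *)

Lemma graded_span_coef P v (k : 'I_r) : graded_span P v ->
  lspan [set x | exists2 a, P k a & rs a x] (v k).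
Proof.
have cl : linear (fun v : cur => v k) by move=> q u w; rewrite !ffunE.
move: v; apply: (lspan_min (linset_preim cl (linset_lspan _))) => _ [i [a [x [ia ax ->]]]] /=.
rewrite ffunE; case: eqP => [ki|_]; last exact: lspan0.
by apply: lspan_sub; exists a; rewrite // ki.
Qed.

Lemma graded_span_disjoint P Q v : (forall i a, P i a -> Q i a -> False) ->
  graded_span P v -> graded_span Q v -> v = 0.
Proof.
move=> PQ Pv Qv; apply/ffunP => k; rewrite ffunE.
apply: (weight_sets_disjoint brP tP (PQ k)); exact: graded_span_coef.
Qed.

Lemma graded_span_root v :
  graded_span (fun i a => [\/ levi_wt i a, nil_wt true i a | nil_wt false i a]) v.
Proof.
rewrite [v]current_sum; apply: linset_sum; first exact: linset_lspan.
move=> k _ _; have := weight_vectors_span brP tP (v k); move: (v k).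
apply: (lspan_min (linset_preim (homog_linear k) (linset_lspan _))) => x [a ax] /=.
have [->|x0] := eqVneq x 0.
  by rewrite (linear_val0 (homog_linear k)); exact: lspan0.
apply: lspan_sub; exists k, a, x; split=> //.
have [->|a0] := eqVneq a 0; first by constructor 1; left.
have : Phi a by split=> //; exists x.
case: psiP => prb _ _; case: (prb k) => _ _ <- /=.
have pw (b : bool) : psi k ((-1) ^+ b *: a) -> levi_wt k a \/ nil_wt b k a.
  by move=> h; apply/par_wt_split; right.
move=> [pa|na].
  by have [] := pw false; rewrite ?signF //; [constructor 1|constructor 3].
by have [] := pw true; rewrite ?signT //; [constructor 1|constructor 2].
Qed.

Lemma nil_levi_disjoint b i a : nil_wt b i a -> levi_wt i a -> False.
Proof.
move=> [pa npa] [a0|/(sign_levi b)//].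
by have [] := filtration_root pa; rewrite a0 scaler0 eqxx.
Qed.

Lemma nil_nil_disjoint i a : nil_wt true i a -> nil_wt false i a -> False.
Proof.
rewrite /nil_wt signT signF => -[pna nna] [pa npa].
by apply: npa; split.
Qed.

Context (bm : seq cur) (bl : seq (subvs_of (levi br r psi))) (bp : seq cur).
Hypothesis bmP : basis_of (nilradical br r psi true) bm.
Hypothesis blP : basis_of fullv bl.
Hypothesis bpP : basis_of (nilradical br r psi false) bp.

Lemma levi_basis : basis_of (levi br r psi) [seq vsval x | x <- bl].
Proof.
have inj : (fullv :&: lker (linfun (vsval : subvs_of (levi br r psi) -> cur)) = 0)%VS.
  apply/eqP; rewrite -subv0; apply/subvP => x; rewrite memv_cap memvf memv_ker lfunE /= memv0.
  by move=> /eqP x0; apply/eqP/subvs_inj; rewrite x0 linear0.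
have := limg_basis_of inj blP.
have -> : [seq linfun vsval i | i <- bl] = [seq vsval x | x <- bl].
  by apply: eq_map => x; rewrite lfunE.
have -> // : (linfun (vsval : subvs_of (levi br r psi) -> cur) @: fullv = levi br r psi)%VS.
apply/vspaceP => v; apply/memv_imgP/idP => [[x _ ->]|vl]; first by rewrite lfunE /= subvsP.
by exists (vsproj _ v); rewrite ?memvf // lfunE /= vsprojK.
Qed.

Lemma parabolic_basis : basis_of (par true) (bm ++ [seq vsval x | x <- bl]).
Proof.
rewrite /parabolic addvC; apply: cat_basis => //; last exact: levi_basis.
apply/directv_addP/eqP; rewrite -subv0; apply/subvP => v /memv_capP[/nilradicalE n /leviE l].
rewrite memv0; apply/eqP; apply: (graded_span_disjoint _ n l) => i a.
exact: nil_levi_disjoint.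
Qed.

Lemma parabolic_basis_right : basis_of (par false) ([seq vsval x | x <- bl] ++ bp).
Proof.
rewrite /parabolic; apply: cat_basis => //; first last.
  exact: levi_basis.
apply/directv_addP/eqP; rewrite -subv0; apply/subvP => v /memv_capP[/leviE l /nilradicalE n].
rewrite memv0; apply/eqP; apply: (graded_span_disjoint _ l n) => i a la na.
exact: nil_levi_disjoint na la.
Qed.

Lemma current_basis : basis_of fullv ((bm ++ [seq vsval x | x <- bl]) ++ bp).
Proof.
have -> : fullv = (par true + nilradical br r psi false)%VS.
  apply/eqP; rewrite eq_sym eqEsubv subvf /=; apply/subvP => v _.
  have := graded_span_root v.
  have pl : linset [set v | v \in (par true + nilradical br r psi false)%VS].
    by split=> [|k u w pu pw] /=; [exact: mem0v|rewrite memvD // memvZ].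
  move: v; apply: (lspan_min pl) => _ [i [a [x [ia ax ->]]]] /=.
  have h (P : nat -> tdual -> Prop) : P i a -> graded_span P (homog i x).
    by move=> Pa; apply: lspan_sub; exists i, a, x.
  case: ia => [la|na|na]; last by apply: (subvP (addvSr _ _)); apply/nilradicalE/h.
    by apply: (subvP (addvSl _ _)); apply/parabolicE/h/levi_wt_par.
  by apply: (subvP (addvSl _ _)); apply/parabolicE/h/par_wt_split; right.
apply: cat_basis => //; last exact: parabolic_basis.
apply/directv_addP/eqP; rewrite -subv0; apply/subvP => v /memv_capP[/parabolicE p /nilradicalE n].
rewrite memv0; apply/eqP; apply: (graded_span_disjoint _ p n) => i a /par_wt_split[la|na] na'.
  exact: nil_levi_disjoint na' la.
exact: nil_nil_disjoint na na'.
Qed.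

End Filtration.

(** * Characters *)

Section Subalgebra.
Context {K : fieldType} {L : vectType K} (br : L -> L -> L).
Hypothesis brP : is_lie_bracket br.
Context (W : {vspace L}).
Hypothesis W_br : forall u v, u \in W -> v \in W -> br u v \in W.

Lemma vsval_sub_br (u v : subvs_of W) : vsval (sub_br br u v) = br (vsval u) (vsval v).
Proof. by rewrite vsprojK //; apply: W_br; exact: subvsP. Qed.

Lemma sub_br_is_lie : is_lie_bracket (@sub_br _ _ br W).
Proof.
split.
- move=> y a u v; apply: subvs_inj; rewrite vsval_sub_br.
  transitivity (a *: br (vsval u) (vsval y) + br (vsval v) (vsval y)).
    exact: lie_linearl.
  by rewrite -!vsval_sub_br.
- move=> x a u v; apply: subvs_inj; rewrite vsval_sub_br.
  transitivity (a *: br (vsval x) (vsval u) + br (vsval x) (vsval v)).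
    exact: lie_linearr.
  by rewrite -!vsval_sub_br.
- by move=> x; apply: subvs_inj; rewrite vsval_sub_br (lie_alternating brP).
- move=> x y z; apply: subvs_inj; rewrite !linearD /= !vsval_sub_br.
  by rewrite (lie_jacobi brP).
Qed.

Lemma env_inclP (i := env_lift (fun x : subvs_of W => env_gen br (vsval x))
                      : env (@sub_br _ _ br W) -> env br) :
  [/\ linear i, monoid_morphism i & forall v, i (env_gen _ v) = env_gen br (vsval v)].
Proof.
apply: env_liftP => [a u v|u v]; first exact: env_gen_linear.
by rewrite vsval_sub_br env_gen_br.
Qed.

Lemma env_characterP (f : L -> K) (f_lin : linear (f : L -> K^o))
    (f_br : forall u v, u \in W -> v \in W -> f (br u v) = 0)
    (F := env_lift (fun x : subvs_of W => f (vsval x) : K^o)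
          : env (@sub_br _ _ br W) -> K^o) :
  [/\ linear F, monoid_morphism F & forall v, F (env_gen _ v) = f (vsval v)].
Proof.
apply: env_liftP => [a u v|u v]; first exact: f_lin.
rewrite vsval_sub_br f_br ?subvsP //; apply/esym/eqP; rewrite subr_eq0; apply/eqP.
exact: (@mulrC K).
Qed.

End Subalgebra.

Lemma morph_ordered_monomial {K : fieldType} {L : vectType K} (br : L -> L -> L)
    (A : algType K) (F : env br -> A) (b : seq L) e : monoid_morphism F ->
  F (ordered_monomial br b e) = \prod_(i < size b) F (env_gen br b`_i) ^+ e i.
Proof.
case=> F1 FM; rewrite /ordered_monomial (big_morph F FM F1).
apply: eq_bigr => i _; elim: (e i) => [|k IH]; first by rewrite !expr0.
by rewrite !exprS FM IH.
Qed.

Lemma daddv_pi_eq0 {K : fieldType} {V : vectType K} (U W : {vspace V}) w :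
  (U :&: W = 0)%VS -> w \in W -> daddv_pi U W w = 0.
Proof.
move=> UW wW; have := daddv_pi_add UW (subvP (addvSr U W) _ wW).
rewrite (@daddv_pi_id _ _ W U w) // 1?capvC // -[X in _ = X]add0r.
exact: addIr.
Qed.

Section LeviCharacter.
Context {R : realType} {g : vectType R[i]} (br : g -> g -> g) (t : {vspace g}).
Local Notation K := R[i].
Hypothesis brP : is_lie_bracket br.
Hypothesis brR : is_reductive br.
Hypothesis tP : is_cartan br t.

Local Notation tdual := (tdual t).
Local Notation rs := (@root_space _ g br t).
Local Notation Phi := (@root_set _ g br t).

Let roots := vspan [set y | exists2 a, Phi a & rs a y].

Let t_roots : (t :&: roots = 0)%VS.
Proof.
apply/eqP; rewrite -subv0; apply/subvP => x /memv_capP[xt /vspanP xr]; rewrite memv0.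
apply/eqP; apply: (weight_sets_disjoint brP tP (P := fun a => a = 0) (Q := Phi)) => //.
  by move=> a -> []; rewrite eqxx.
by apply: lspan_sub; exists 0 => //; apply/(root_space0 tP).
Qed.

Lemma cartan_proj_linear : linear (cartan_proj br t).
Proof. by move=> a u v; rewrite /cartan_proj !linearP. Qed.

Lemma cartan_proj_id (h : subvs_of t) : cartan_proj br t (vsval h) = h.
Proof. by rewrite /cartan_proj daddv_pi_id ?vsvalK // subvsP. Qed.

Lemma cartan_proj_root a x : Phi a -> rs a x -> cartan_proj br t x = 0.
Proof.
move=> Pa ax; have xr : x \in roots by apply/vspanP/lspan_sub; exists a.
by rewrite /cartan_proj (daddv_pi_eq0 t_roots xr) linear0.
Qed.

Context {r : nat} (psi : nat -> set tdual) (lam : 'I_r -> tdual).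
Hypothesis psiP : is_parabolic_filtration br r psi.
Hypothesis lamP : in_levi_dual br psi lam.
Local Notation cur := (current g r).
Local Notation cb := (@current_br _ g br r).
Local Notation par b := (@parabolic _ g br t r psi b).
Local Notation chi := (@chi _ g br t r lam).

Lemma chi_linear : linear (chi : cur -> K^o).
Proof.
move=> a u v; rewrite /Defs.chi scaler_sumr -big_split /=; apply: eq_bigr => i _.
by rewrite !ffunE cartan_proj_linear linearP.
Qed.

Lemma chi_homog0 n z : (forall i : 'I_r, i = n :> nat -> lam i (cartan_proj br t z) = 0) ->
  chi (homog n z) = 0.
Proof.
move=> h; rewrite /Defs.chi big1 // => i _; rewrite ffunE.
case: eqP => [/h //|_]; by rewrite (linear_val0 cartan_proj_linear) linear0.
Qed.

Lemma chi_eps (i : 'I_r) (h : subvs_of t) : chi (eps i (vsval h)) = lam i h.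
Proof.
rewrite /Defs.chi (bigD1 i) //= ffunE eqxx cartan_proj_id big1 ?addr0 // => j ji.
by rewrite ffunE (negPf ji) (linear_val0 cartan_proj_linear) linear0.
Qed.

Lemma chi_nilradical b v : v \in nilradical br r psi b -> chi v = 0.
Proof.
move/nilradicalE.
have l0 : linset [set v : cur | chi v = 0].
  apply: (linset_eq (f' := fun=> 0 : K^o)); first exact: chi_linear.
  by move=> k u w; rewrite scaler0 addr0.
move: v; apply: (lspan_min l0) => _ [i [a [x [[ia _] ax ->]]]] /=.
apply: chi_homog0 => j _; have Pa := filtration_root psiP ia.
rewrite (@cartan_proj_root a) ?linear0 //.
by rewrite -(sign_involutive b a); exact: (sign_root psiP).
Qed.

(** On opposite root vectors [x z^i] and [y z^j] of a parabolic subalgebra the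
    bracket is a multiple of the coroot at the power [i + j], where both roots
    belong to the Levi factor. *)
Lemma chi_parabolic_br b u v : u \in par b -> v \in par b -> chi (cb u v) = 0.
Proof.
move=> /(parabolicE tP) pu /(parabolicE tP) pv.
have l0 : linset [set v : cur | chi v = 0].
  apply: (linset_eq (f' := fun=> 0 : K^o)); first exact: chi_linear.
  by move=> k w1 w2; rewrite scaler0 addr0.
apply: (lspan_min (linset_preim (current_br_linearl brP v) l0) _ pu).
move=> _ [i [a [x [ia ax ->]]]] /=.
apply: (lspan_min (linset_preim (current_br_linearr brP _) l0) _ pv).
move=> _ [j [c [y [jc cy ->]]]] /=; rewrite current_br_homog //.
apply: chi_homog0 => k kij.
have [->|xy0] := eqVneq (br x y) 0; first by rewrite (linear_val0 cartan_proj_linear) linear0.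
have acxy : rs (a + c) (br x y) by exact: root_space_br.
have [ac|ac] := eqVneq (a + c) 0; last first.
  by rewrite (@cartan_proj_root (a + c)) ?linear0 //; split=> //; exists (br x y).
have cE : c = - a by move/eqP: ac; rewrite addrC addr_eq0 => /eqP.
have [a0|a0] := eqVneq a 0.
  have [tab _ _] := tP; case/eqP: xy0; apply: tab; apply/(root_space0 tP).
    by rewrite -a0.
  by rewrite -[0 : tdual](oppr0 tdual) -a0 -cE.
case: ia => [a0'|ia]; first by rewrite a0' eqxx in a0.
case: jc => [c0|jc].
  by rewrite c0 in cE; rewrite -oppr_eq0 -cE eqxx in a0.
have fa : levi_factor psi k a.
  apply/(sign_levi psi b); rewrite kij; split.
    exact: (filtration_mono psiP (leq_addr j i)).
  by rewrite -scalerN -cE; apply: (filtration_mono psiP (leq_addl i j)).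
rewrite cE in cy; rewrite (bracket_coroot brP brR tP a0 ax cy).
rewrite (linear_valZ cartan_proj_linear) cartan_proj_id linearZ /= (lamP fa).
by rewrite scaler0.
Qed.

End LeviCharacter.

(** * The projection to the Levi factor *)

Lemma vsproj_basis {K : fieldType} {V : vectType K} (W : {vspace V}) (B : seq V) :
  basis_of W B -> basis_of fullv [seq vsproj W x | x <- B].
Proof.
move=> BP; pose f : 'Hom(V, subvs_of W) := linfun (vsproj W).
have fK : (W :&: lker f = 0)%VS.
  apply/eqP; rewrite -subv0; apply/subvP => x; rewrite memv_cap memv_ker lfunE /= memv0.
  by move=> /andP[xW /eqP x0]; rewrite -(vsprojK xW) x0 linear0.
have := limg_basis_of fK BP.
have -> : [seq f i | i <- B] = [seq vsproj W x | x <- B] by apply: eq_map => x; rewrite lfunE.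
have -> // : (f @: W = fullv)%VS.
apply/eqP; rewrite eqEsubv subvf /=; apply/subvP => x _.
by apply/memv_imgP; exists (vsval x); rewrite ?subvsP // lfunE /= vsvalK.
Qed.

Lemma prod_exponents_cat {K : comPzRingType} {V : zmodType} (f : V -> K) (B C : seq V)
    (e : nat -> nat) :
  \prod_(i < size (B ++ C)) f (B ++ C)`_i ^+ e i =
  (\prod_(i < size B) f B`_i ^+ e i) *
  \prod_(i < size C) f C`_i ^+ e (size B + i)%N.
Proof.
rewrite -(big_mkord xpredT (fun i => f (B ++ C)`_i ^+ e i)).
rewrite -(big_mkord xpredT (fun i => f B`_i ^+ e i)).
rewrite -(big_mkord xpredT (fun i => f C`_i ^+ e (size B + i)%N)).
rewrite size_cat (big_cat_nat (n := size B)) ?leq_addr //=; congr (_ * _).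
  by rewrite !big_nat; apply: eq_bigr => i /andP[_ ib]; rewrite nth_cat ib.
rewrite -{1}[size B]add0n big_addn addKn; apply: eq_bigr => i _.
by rewrite nth_cat ltnNge leq_addl /= addnK addnC.
Qed.

Section Projection.
Context {R : realType} {g : vectType R[i]} (br : g -> g -> g) (t : {vspace g}).
Local Notation K := R[i].
Hypothesis brP : is_lie_bracket br.
Hypothesis brR : is_reductive br.
Hypothesis tP : is_cartan br t.
Local Notation tdual := (tdual t).
Context {r : nat} (psi : nat -> set tdual) (lam : 'I_r -> tdual).
Hypothesis psiP : is_parabolic_filtration br r psi.
Hypothesis lamP : in_levi_dual br psi lam.
Local Notation cur := (current g r).
Local Notation cb := (@current_br _ g br r).
Local Notation lv := (levi br r psi).
Local Notation par b := (@parabolic _ g br t r psi b).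
Local Notation chi := (@chi _ g br t r lam).
Local Notation U := (env cb).
Local Notation om := (ordered_monomial cb).
Local Notation gen := (env_gen cb).
Local Notation sb b := (@sub_br _ _ cb (par b)).

Context (bm : seq cur) (bl : seq (subvs_of lv)) (bp : seq cur).
Hypothesis bmP : basis_of (nilradical br r psi true) bm.
Hypothesis blP : basis_of fullv bl.
Hypothesis bpP : basis_of (nilradical br r psi false) bp.
Local Notation bl' := [seq vsval x | x <- bl].

Let cbP : is_lie_bracket cb := current_is_lie brP.

Let zero_exponents (b : seq cur) (e : nat -> nat) := [forall i : 'I_(size b), e i == 0%N].

(** The three given bases form a basis of the current algebra, so the
    Poincare-Birkhoff-Witt theorem provides the projection. *)
Lemma pbw_projectionP : is_pbw_projection bm bl bp (pbw_projection bm bl bp).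
Proof.
suff ex : exists pi, is_pbw_projection bm bl bp pi.
  by rewrite /pbw_projection; case: pselect => // ex'; exact: (svalP (cid ex')).
pose el (e : nat -> nat) k := e (size bm + k)%N.
pose ep (e : nat -> nat) k := e (size (bm ++ bl') + k)%N.
pose tau e : Ulevi br psi := if zero_exponents bm e && zero_exponents bp (ep e)
  then ordered_monomial (sub_br cb (W := lv)) bl (el e) else 0.
have [|pi [pil piE]] := @pbw_linear_map _ _ _ cbP _ _ tau
  (current_basis brP tP psiP bmP blP bpP).
  move=> e e' E; have sz : size ((bm ++ bl') ++ bp) = (size bm + size bl + size bp)%N.
    by rewrite !size_cat size_map.
  rewrite /tau; congr (if _ && _ then _ else _).
  - apply: eq_forallb => i; rewrite E // sz -addnA.
    exact: leq_trans (ltn_ord i) (leq_addr _ _).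
  - apply: eq_forallb => i; rewrite /ep E // [X in (_ < X)%N]size_cat ltn_add2l.
    exact: ltn_ord.
  - apply: eq_ordered_monomial => i il; rewrite /el E // sz -addnA ltn_add2l.
    exact: leq_trans il (leq_addr _ _).
exists pi; split=> // em1 el1 ep1.
pose e k := if (k < size bm)%N then em1 k else
  if (k < size bm + size bl)%N then el1 (k - size bm)%N
  else ep1 (k - (size bm + size bl))%N.
have e1 k : (k < size bm)%N -> em1 k = e k by rewrite /e => ->.
have e2 k : (k < size bl)%N -> el1 k = el e k.
  by move=> kl; rewrite /el /e ltnNge leq_addr /= ltn_add2l kl addKn.
have e3 k : (k < size bp)%N -> ep1 k = ep e k.
  move=> kp; rewrite /ep /e size_cat size_map ltnNge.
  by rewrite -addnA leq_addr /= addnA ltnNge leq_addr /= addKn.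
have -> : ordered_monomial cb bm em1 * ordered_monomial cb bl' el1 *
    ordered_monomial cb bp ep1 = om ((bm ++ bl') ++ bp) e.
  rewrite !ordered_monomial_cat; congr (_ * _ * _); apply: eq_ordered_monomial.
  - exact: e1.
  - by move=> k; rewrite size_map; exact: e2.
  - exact: e3.
rewrite piE /tau; congr (if _ && _ then _ else _).
- by apply: eq_forallb => i; rewrite e1.
- by apply: eq_forallb => i; rewrite e3.
- by apply: eq_ordered_monomial => k kl; rewrite e2.
Qed.

Definition proj_character (X : U) : K := chi_Ulevi lam (pbw_projection bm bl bp X).
Local Notation P := proj_character.

Let levi_character : [/\ linear (@chi_Ulevi _ g br t r psi lam),
    monoid_morphism (@chi_Ulevi _ g br t r psi lam)
  & forall v, @chi_Ulevi _ g br t r psi lam (env_gen (sub_br cb (W := lv)) v) = chi (vsval v)].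
Proof.
apply: (@env_characterP _ _ cb lv _ chi).
- by move=> u v; exact: (levi_br brP tP psiP).
- exact: chi_linear.
move=> u v /(leviE tP) lu /(leviE tP) lv'; apply: (chi_parabolic_br brP brR tP psiP lamP (b := true)).
  by apply/(parabolicE tP); apply: graded_spanS lu => i a; exact: levi_wt_par.
by apply/(parabolicE tP); apply: graded_spanS lv' => i a; exact: levi_wt_par.
Qed.

Lemma proj_character_linear : linear (P : U -> K^o).
Proof.
have [pl _] := pbw_projectionP; have [cl _ _] := levi_character.
by move=> a u v; rewrite /P pl; exact: cl.
Qed.

Lemma proj_character_monomial em el ep :
  P (om bm em * om bl' el * om bp ep) =
  if zero_exponents bm em && zero_exponents bp ep
  then \prod_(i < size bl') chi bl'`_i ^+ el i else 0.
Proof.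
have [_ pE] := pbw_projectionP; have [cl cM cg] := levi_character.
rewrite /P pE; case: ifP => _; last exact: (linear_val0 cl).
rewrite [LHS](morph_ordered_monomial bl el cM) size_map.
apply: eq_bigr => i _; rewrite [X in X ^+ _]cg; congr (chi _ ^+ _).
by rewrite (nth_map 0).
Qed.

Let par_character b :
  [/\ linear (env_lift (fun x : subvs_of (par b) => chi (vsval x) : K^o) : env (sb b) -> K^o),
      monoid_morphism (env_lift (fun x : subvs_of (par b) => chi (vsval x) : K^o)
                         : env (sb b) -> K^o)
    & forall v, env_lift (fun x : subvs_of (par b) => chi (vsval x) : K^o)
                  (env_gen (sb b) v) = chi (vsval v)].
Proof.
apply: (@env_characterP _ _ cb (par b) _ chi).
- by move=> u v; exact: (parabolic_br brP tP psiP).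
- exact: chi_linear.
- by move=> u v; exact: (chi_parabolic_br brP brR tP psiP lamP).
Qed.

Let par_incl b :
  [/\ linear (@Uparabolic_incl _ _ br t r psi b : env (sb b) -> U),
      monoid_morphism (@Uparabolic_incl _ _ br t r psi b : env (sb b) -> U)
    & forall v, @Uparabolic_incl _ _ br t r psi b (env_gen (sb b) v) = gen (vsval v)].
Proof.
by apply: (@env_inclP _ _ cb (par b)) => u v; exact: (parabolic_br brP tP psiP).
Qed.

Local Notation chi_par b := (env_lift (fun x : subvs_of (par b) => chi (vsval x) : K^o)
                               : env (sb b) -> K^o).
Local Notation incl b := (@Uparabolic_incl _ _ br t r psi b : env (sb b) -> U).

Let par_monomial b (B : seq cur) e (c := ordered_monomial (sb b) [seq vsproj (par b) x | x <- B] e) :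
  basis_of (par b) B ->
  incl b c = om B e /\ chi_par b c = \prod_(i < size B) chi B`_i ^+ e i.
Proof.
move=> BP; have [_ iM ig] := par_incl b; have [_ cM cg] := par_character b.
have BK i : (i < size B)%N -> vsval ([seq vsproj (par b) x | x <- B]`_i) = B`_i.
  by move=> iB; rewrite (nth_map 0) // vsprojK //; apply: (basis_mem BP); exact: mem_nth.
split; rewrite /c.
  rewrite (morph_ordered_monomial _ _ iM) size_map.
  by apply: eq_bigr => i _; rewrite ig BK.
rewrite (morph_ordered_monomial _ _ cM) size_map.
by apply: eq_bigr => i _; rewrite cg BK.
Qed.

Let par_span b (B : seq cur) (c : env (sb b)) : basis_of (par b) B ->
  lspan [set c : env (sb b) | exists e,
    incl b c = om B e /\ chi_par b c = \prod_(i < size B) chi B`_i ^+ e i] c.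
Proof.
move=> BP; have sbP : is_lie_bracket (sb b).
  by apply: (sub_br_is_lie cbP) => u v; exact: (parabolic_br brP tP psiP).
apply: lspanS (pbw_span sbP c (vsproj_basis BP)) => _ [e _ <-]; exists e.
exact: par_monomial.
Qed.

Let nil_exponents b (B : seq cur) (e : nat -> nat) : {subset B <= nilradical br r psi b} ->
  \prod_(i < size B) chi B`_i ^+ e i = (zero_exponents B e)%:R.
Proof.
move=> BN; have [/forallP e0|] := boolP (zero_exponents B e).
  by rewrite big1 // => i _; rewrite (eqP (e0 i)) expr0.
rewrite negb_forall => /existsP[i ei]; rewrite (bigD1 i) //=.
by rewrite (chi_nilradical brP tP lam psiP (BN _ (mem_nth 0 (ltn_ord i)))) expr0n (negPf ei) mul0r.
Qed.

Let bmN : {subset bm <= nilradical br r psi true}.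
Proof. by move=> x; exact: basis_mem. Qed.

Let bpN : {subset bp <= nilradical br r psi false}.
Proof. by move=> x; exact: basis_mem. Qed.

(** On [U p^-] followed by an ordered monomial in [u^+], the value is the
    character of [p^-] times the constant coefficient of the monomial.  Since the
    elements of [U p^-] are combinations of ordered monomials in [u^-] and the
    Levi factor, this determines the functional. *)
Lemma proj_character_left v X : v \in par true -> P (gen v * X) = chi v * P X.
Proof.
move=> vp; have [il iM ig] := par_incl true; have [cl cM cg] := par_character true.
have Pl := proj_character_linear.
have key (c : env (sb true)) ep :
    P (incl true c * om bp ep) = chi_par true c * (zero_exponents bp ep)%:R.
  have lin1 : linear (fun c : env (sb true) => P (incl true c * om bp ep) : K^o).
    by move=> a x y; rewrite il mulrDl -scalerAl Pl.
  have lin2 : linear (fun c : env (sb true) => chi_par true c * (zero_exponents bp ep)%:R : K^o).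
    by move=> a x y; rewrite cl mulrDl -scalerAl.
  apply: (linear_ext_lspan lin1 lin2 _ (par_span c (parabolic_basis brP tP psiP bmP blP))).
  move=> x [e [ix cx]]; rewrite ix cx ordered_monomial_cat proj_character_monomial.
  rewrite prod_exponents_cat (nil_exponents e bmN).
  by case: zero_exponents; case: zero_exponents; rewrite /= ?mulr1n ?mulr0n ?mul1r ?mulr1 ?mul0r ?mulr0.
have lin1 : linear (fun X : U => P (gen v * X) : K^o).
  by move=> a x y; rewrite mulrDr -scalerAr Pl.
have lin2 : linear (fun X : U => chi v * P X : K^o).
  by move=> a x y; rewrite Pl mulrDr /GRing.scale /= mulrCA.
apply: (linear_ext_lspan lin1 lin2 _ (pbw_span cbP X (current_basis brP tP psiP bmP blP bpP))).
move=> _ [e _ <-]; rewrite ordered_monomial_cat.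
have [<- _] := par_monomial e (parabolic_basis brP tP psiP bmP blP).
rewrite key mulrA -(vsprojK vp) -ig.
have [_ iMM] := iM; have [_ cMM] := cM.
by rewrite -iMM key cMM cg mulrA.
Qed.

(** The mirror image: ordered monomials in [u^-] followed by [U p^+]. *)
Lemma proj_character_right v X : v \in par false -> P (X * gen v) = P X * chi v.
Proof.
move=> vp; have [il iM ig] := par_incl false; have [cl cM cg] := par_character false.
have Pl := proj_character_linear.
have parB := parabolic_basis_right brP tP psiP blP bpP.
have key (c : env (sb false)) em :
    P (om bm em * incl false c) = (zero_exponents bm em)%:R * chi_par false c.
  have lin1 : linear (fun c : env (sb false) => P (om bm em * incl false c) : K^o).
    by move=> a x y; rewrite il mulrDr -scalerAr Pl.
  have lin2 : linear (fun c : env (sb false) => (zero_exponents bm em)%:R * chi_par false c : K^o).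
    by move=> a x y; rewrite cl mulrDr /GRing.scale /= mulrCA.
  apply: (linear_ext_lspan lin1 lin2 _ (par_span c parB)).
  move=> x [e [ix cx]]; rewrite ix cx ordered_monomial_cat mulrA proj_character_monomial.
  rewrite prod_exponents_cat.
  have /= -> := nil_exponents (fun k => e (size bl' + k)%N) bpN.
  by case: zero_exponents; case: zero_exponents; rewrite /= ?mulr1n ?mulr0n ?mul1r ?mulr1 ?mul0r ?mulr0.
have lin1 : linear (fun X : U => P (X * gen v) : K^o).
  by move=> a x y; rewrite mulrDl -scalerAl Pl.
have lin2 : linear (fun X : U => P X * chi v : K^o).
  by move=> a x y; rewrite Pl mulrDl -!scalerAl.
apply: (linear_ext_lspan lin1 lin2 _ (pbw_span cbP X (current_basis brP tP psiP bmP blP bpP))).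
move=> _ [e _ <-]; rewrite -catA ordered_monomial_cat.
have [<- _] := par_monomial (fun k => e (size bm + k)%N) parB.
rewrite key -mulrA -(vsprojK vp) -ig.
have [_ iMM] := iM; have [_ cMM] := cM.
by rewrite -iMM key cMM cg mulrA.
Qed.

Lemma proj_character1 : P 1 = 1.
Proof.
have om0 b : om b (fun=> 0%N) = 1 by rewrite /ordered_monomial big1.
have := proj_character_monomial (fun=> 0%N) (fun=> 0%N) (fun=> 0%N).
rewrite !om0 !mulr1 => ->.
have z b : zero_exponents b (fun=> 0%N) by apply/forallP.
by rewrite !z big1.
Qed.

End Projection.

(** * Induced modules *)

Section InducedModule.
Context {K : fieldType} {A B : algType K} (j : B -> A) (chi : B -> K^o).
Local Notation act := (fun y (c : K^o) => chi y * c).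
Local Notation M := (induced j act).
Local Notation F := {malg K[(A * K^o)%type]}.
Local Notation tn := (tensor j act).

Lemma tensor_linear (c : K^o) : linear (fun a => tn a c).
Proof.
move=> k a a'; rewrite /tensor -lproj_linear; apply/lprojP/lspan_sub.
by constructor 1; exists k, a, a', c.
Qed.

Lemma tensor_linearr a : linear (fun c : K^o => tn a c).
Proof.
move=> k c c'; rewrite /tensor -lproj_linear; apply/lprojP/lspan_sub.
by constructor 2; exists k, a, c, c'.
Qed.

Lemma tensor_scalar a (c : K^o) : tn a c = tn (c *: a) 1.
Proof.
rewrite (linear_valZ (tensor_linear 1)) -(linear_valZ (tensor_linearr a)).
by rewrite /GRing.scale /= mulr1.
Qed.

Lemma induced_generated (m : M) : exists a, m = tn a 1.
Proof.
rewrite -[m]lprojK; have := malg_lspan (repr m); move: (repr m) => {m}.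
have L : linset [set m : M | exists a, m = tn a 1].
  split=> [|k u v [a ->] [a' ->]]; first by exists 0; rewrite (linear_val0 (tensor_linear 1)).
  by exists (k *: a + a'); rewrite tensor_linear.
apply: (lspan_min (linset_preim (@lproj_linear _ _ (tensor_relations j act)) L)).
by move=> _ [[a c] _ <-]; exists (c *: a); rewrite -tensor_scalar.
Qed.

Lemma induced_actM a a' (m : M) :
  induced_act (a * a') m = induced_act a (induced_act a' m).
Proof.
by have [x ->] := induced_generated m; rewrite !induced_act_tensor mulrA.
Qed.

Lemma induced_act_linearl (m : M) : linear (fun a => induced_act a m).
Proof.
have [x ->] := induced_generated m; move=> k a a'.
by rewrite !induced_act_tensor mulrDl -scalerAl tensor_linear.
Qed.

(** The universal property, for functionals: those of [A] that transform by the
    character under right multiplication by [B] factor through the induced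
    module. *)
Lemma induced_functional (f : A -> K^o) : linear f ->
    (forall a b, f (a * j b) = f a * chi b) ->
  exists h : M -> K, forall a, h (tn a 1) = f a.
Proof.
move=> fl fj; pose h0 : F -> K^o := linext (fun k : A * K^o => f k.1 * k.2 : K^o).
have h0l : linear h0 by exact: linext_linear.
have h0t a c : h0 (tgen a c) = f a * c by rewrite /h0 /tgen linextU.
have h0rel x : lspan (tensor_relations j act) x -> h0 x = 0.
  have L : linset [set x : F | h0 x = 0].
    by apply: (linset_eq h0l (f' := fun=> 0)) => k u v; rewrite scaler0 addr0.
  move: x; apply: (lspan_min L) => x /=.
  case=> [[k [a [a' [c ->]]]]|[k [a [c [c' ->]]]]|[a [b [c ->]]]].
  - rewrite (linear_valBZD h0l) !h0t fl mulrDl -scalerAl.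
    by apply/eqP; rewrite subr_eq0.
  - rewrite (linear_valBZD h0l) !h0t mulrDr /GRing.scale /= mulrCA.
    by apply/eqP; rewrite subr_eq0.
  - by rewrite (linear_valB h0l) !h0t fj mulrA subrr.
exists (fun m => h0 (repr m)) => a.
have /h0rel : lspan (tensor_relations j act) (repr (tn a 1) - tgen a 1).
  exact/lprojP/lprojK.
by rewrite (linear_valB h0l) h0t mulr1 => /eqP; rewrite subr_eq0 => /eqP.
Qed.

Lemma transforms_linset (f : A -> K^o) : linear f -> linear j -> linear chi ->
  linset [set b | forall a, f (a * j b) = f a * chi b].
Proof.
move=> fl jl cl; split=> [a|k b b' hb hb' a] /=.
  by rewrite (linear_val0 jl) (linear_val0 cl) !mulr0 (linear_val0 fl).
by rewrite jl cl mulrDr -scalerAr fl hb hb' [RHS]mulrDr -scalerAr.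
Qed.

End InducedModule.

Lemma antipodeK {K : fieldType} {V : lmodType K} (br : V -> V -> V) :
  involutive (@antipode _ _ br).
Proof.
have [al a1 aM ag] := antipodeP br => x.
pose aa x := antipode (@antipode _ _ br x).
have aal : linear aa by move=> k u v; rewrite /aa al al.
have idl : linear (@id (env br)) by [].
have L := linset_eq aal idl.
apply: (env_genind L) => [|v y /= h]; first by rewrite /= /aa a1 a1.
rewrite /aa aM ag aM -/(aa y) h -scaleN1r (linear_valZ al) ag.
by rewrite scaleN1r opprK.
Qed.

(** * The Shapovalov form *)

Section ShapovalovForm.
Context {R : realType} {g : vectType R[i]} (br : g -> g -> g) (t : {vspace g}).
Local Notation K := R[i].
Hypothesis brP : is_lie_bracket br.
Hypothesis brR : is_reductive br.
Hypothesis tP : is_cartan br t.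
Local Notation tdual := (tdual t).
Local Notation rs := (@root_space _ g br t).
Context {r : nat} (r_gt0 : (0 < r)%N) (psi : nat -> set tdual) (lam : 'I_r -> tdual).
Hypothesis psiP : is_parabolic_filtration br r psi.
Hypothesis lamP : in_levi_dual br psi lam.
Local Notation cur := (current g r).
Local Notation cb := (@current_br _ g br r).
Local Notation lv := (levi br r psi).
Local Notation par b := (@parabolic _ g br t r psi b).
Local Notation chi := (@chi _ g br t r lam).
Local Notation U := (env cb).
Local Notation gen := (env_gen cb).
Local Notation i0 := (Ordinal r_gt0).

Context (bm : seq cur) (bl : seq (subvs_of lv)) (bp : seq cur).
Hypothesis bmP : basis_of (nilradical br r psi true) bm.
Hypothesis blP : basis_of fullv bl.
Hypothesis bpP : basis_of (nilradical br r psi false) bp.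
Local Notation P := (proj_character lam bm bl bp).

(* The pair of opposite modules, given by what the proof uses of them. *)
Context (M : bool -> lmodType K) (act : forall b, U -> M b -> M b) (w : forall b, M b).
Arguments act {b}.
Hypothesis act_linear : forall b X, linear (@act b X).
Hypothesis act_linearl : forall b (m : M b), linear (act^~ m).
Hypothesis actM : forall b X Y (m : M b), act (X * Y) m = act X (act Y m).
Hypothesis act_generated : forall b (m : M b), exists X, m = act X (w b).
Hypothesis act_par : forall b v, v \in par b ->
  act (gen v) (w b) = ((-1) ^+ b * chi v) *: w b.
Hypothesis act_functional : forall b (f : U -> K^o), linear f ->
  (forall X v, v \in par b -> f (X * gen v) = f X * ((-1) ^+ b * chi v)) ->
  exists h : M b -> K, forall X, h (act X (w b)) = f X.

Let Pl : linear (P : U -> K^o).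
Proof. exact: proj_character_linear. Qed.

Let wt (b : bool) (s : seq tdual) : tdual :=
  (-1) ^+ b *: lam i0 + (-1) ^+ (~~ b) *: \sum_(a <- s) a.

Let T b (h : subvs_of t) : M b -> M b := act (gen (eps i0 (vsval h))).

(** The vectors obtained from the generator by a word in root vectors of the
    opposite nilradical, together with the list of the roots involved, which
    determines their weight. *)
Inductive reachable b : seq tdual -> M b -> Prop :=
| reachable_nil : @reachable b [::] (w b)
| reachable_cons i a x s m : nilradical_roots psi i a -> rs ((-1) ^+ (~~ b) *: a) x ->
    @reachable b s m -> @reachable b (a :: s) (act (gen (homog i x)) m).

Let act1 b (m : M b) : act 1 m = m.
Proof. by have [X ->] := act_generated m; rewrite -actM mul1r. Qed.

Let act_br b u v (m : M b) :
  act (gen (cb u v)) m = act (gen u) (act (gen v) m) - act (gen v) (act (gen u) m).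
Proof. by rewrite env_gen_br (linear_valB (act_linearl m)) !actM. Qed.

Let genl b (m : M b) : linear (fun v => act (gen v) m).
Proof. by move=> k u v; rewrite env_gen_linear (act_linearl m). Qed.

Let cur_dec b (z : cur) : exists u v, [/\ u \in par b,
  graded_span br (nil_wt psi (~~ b)) v & z = u + v].
Proof.
have zg := graded_span_root brP tP psiP z.
have L : linset [set z : cur | exists u v, [/\ u \in par b,
    graded_span br (nil_wt psi (~~ b)) v & z = u + v]].
  split=> [|k z1 z2 [u1 [v1 [u1p v1n ->]]] [u2 [v2 [u2p v2n ->]]]].
    by exists 0, 0; split; [exact: mem0v|exact: lspan0|rewrite addr0].
  exists (k *: u1 + u2), (k *: v1 + v2); split.
  - by rewrite memvD // memvZ.
  - by apply: lspanD => //; exact: lspanZ.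
  - by rewrite scalerDr addrACA.
apply: (lspan_min L _ zg) => _ [i [a [x [ia ax ->]]]] /=.
have hg (Q : nat -> tdual -> Prop) : Q i a -> graded_span br Q (homog i x).
  by move=> Qa; apply: lspan_sub; exists i, a, x.
have parc b' : levi_wt psi i a \/ nil_wt psi b' i a -> homog i x \in par b'.
  by move=> h; apply/(parabolicE tP)/hg/par_wt_split.
have inpar : homog i x \in par b -> exists u v, [/\ u \in par b,
    graded_span br (nil_wt psi (~~ b)) v & homog i x = u + v].
  by move=> h; exists (homog i x), 0; split; [|exact: lspan0|rewrite addr0].
have innil : nil_wt psi (~~ b) i a -> exists u v, [/\ u \in par b,
    graded_span br (nil_wt psi (~~ b)) v & homog i x = u + v].
  move=> h; exists 0, (homog i x); split; [exact: mem0v|exact: hg|by rewrite add0r].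
clear L; case: ia => [la|na|na]; first by apply/inpar/parc; left.
  by move: inpar innil parc; case: b => inpar innil parc; [apply/inpar/parc; right|exact: innil].
by move: inpar innil parc; case: b => inpar innil parc; [exact: innil|apply/inpar/parc; right].
Qed.

Let span b : set (M b) := lspan [set m | exists s, reachable s m].

Let span_linset b : linset (@span b).
Proof. exact: linset_lspan. Qed.

Let span_nil b v m : graded_span br (nil_wt psi (~~ b)) v -> @span b m ->
  span (act (gen v) m).
Proof.
move=> vn; apply: (lspan_min (linset_preim (act_linear (gen v)) (span_linset b))).
move=> {}m [s sm] /=.
apply: (lspan_min (linset_preim (genl m) (span_linset b)) _ vn).
move=> _ [i [a [x [ia ax ->]]]] /=.
apply: lspan_sub; exists ((-1) ^+ (~~ b) *: a :: s); apply: reachable_cons => //.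
by rewrite sign_involutive.
Qed.

(** An element of the parabolic subalgebra is moved through the word towards the
    generator, on which it acts by a scalar. The commutators that arise may be any
    elements of the current algebra, but act on shorter words. *)
Let span_act b X (m : M b) : span m -> span (act X m).
Proof.
have gen_reach s (m' : M b) : reachable s m' -> forall z, span (act (gen z) m').
  elim=> [|i a x {}s {}m' ia ax sm IH] z.
    have [u [v [up vn ->]]] := cur_dec b z; rewrite (linear_valD (genl _)).
    have wsp : span (w b) by apply: lspan_sub; exists [::]; exact: reachable_nil.
    apply: (linsetD (span_linset b)); last exact: span_nil.
    by rewrite act_par //; exact: (linsetZ _ (span_linset b)).
  have [u [v [up vn ->]]] := cur_dec b z; rewrite (linear_valD (genl _)).
  have yn : graded_span br (nil_wt psi (~~ b)) (homog i x : cur).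
    apply: lspan_sub; exists i, ((-1) ^+ (~~ b) *: a), x; split=> //.
    by rewrite /nil_wt sign_involutive.
  have msp : span (act (gen (homog i x)) m').
    by apply: span_nil => //; apply: lspan_sub; exists s.
  apply: (linsetD (span_linset b)); last exact: span_nil.
  have -> : act (gen u) (act (gen (homog i x)) m') =
      act (gen (cb u (homog i x))) m' + act (gen (homog i x)) (act (gen u) m').
    by rewrite act_br subrK.
  by apply: (linsetD (span_linset b)) => //; apply: span_nil.
have gen_span z (m' : M b) : span m' -> span (act (gen z) m').
  apply: (lspan_min (linset_preim (act_linear (gen z)) (span_linset b))).
  by move=> {}m' [s sm] /=; exact: gen_reach sm z.
move=> msp; move: X.
apply: (env_genind (linset_preim (act_linearl m) (span_linset b))) => /=.
  by rewrite act1.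
by move=> v X /= Xm; rewrite actM; exact: gen_span.
Qed.

Let span_full b (m : M b) : span m.
Proof.
have [X ->] := act_generated m; apply: span_act.
by apply: lspan_sub; exists [::]; exact: reachable_nil.
Qed.

Let homog_par b (h : subvs_of t) : eps i0 (vsval h) \in par b.
Proof.
rewrite eps_homog; apply/(parabolicE tP)/lspan_sub.
by exists 0%N, 0, (vsval h); split; [left|apply/(root_space0 tP); exact: subvsP|].
Qed.

Let reachable_weight b s (m : M b) : reachable s m ->
  joint_eigen (@T b) (fun h => wt b s h) m.
Proof.
elim=> [|i a x {}s {}m ia ax sm IH] h.
  rewrite /T act_par ?homog_par // (chi_eps brP tP) /wt big_nil scaler0 addr0.
  by rewrite scale_lfunE.
have := act_br (eps i0 (vsval h)) (homog i x) m.
rewrite eps_homog current_br_homog // add0n ax => /eqP.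
rewrite (linear_valZ (homog_linear i)) (linear_valZ (genl m)) eq_sym subr_eq -eps_homog => /eqP E.
rewrite /T E -/(T h m) IH (linear_valZ (act_linear _)) -scalerDl; congr (_ *: _).
by rewrite /wt big_cons scalerDr [in RHS]add_lfunE [in RHS]add_lfunE add_lfunE addrCA.
Qed.

Let reachable_roots b s (m : M b) : reachable s m ->
  forall a, a \in s -> psi 0%N a /\ ~ psi 0%N (- a).
Proof.
elim=> // i a x {}s {}m [pa na] ax sm IH c; rewrite inE => /orP[/eqP ->|/IH //].
have np : ~ psi 0%N (- a).
  move=> n0a; apply: na; split=> //.
  exact: (filtration_mono psiP (leq0n i)).
split=> //; have [prb _ _] := psiP; have [_ _ root0] := prb 0%N.
have : root_set br a := filtration_root psiP pa.
by rewrite -root0 /= => -[].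
Qed.

Let weight_decomposition b (m : M b) : exists c u,
  m = c *: w b + u /\ lspan [set v | exists s, s != [::] /\ reachable s v] u.
Proof.
have L : linset [set m : M b | exists c u,
    m = c *: w b + u /\ lspan [set v | exists s, s != [::] /\ reachable s v] u].
  split=> [|k _ _ [c1 [u1 [-> h1]]] [c2 [u2 [-> h2]]]].
    by exists 0, 0; split; [rewrite scale0r addr0|exact: lspan0].
  exists (k * c1 + c2), (k *: u1 + u2); split.
    by rewrite scalerDr addrACA scalerA scalerDl.
  by apply: lspanD => //; exact: lspanZ.
apply: (lspan_min L _ (span_full m)) => v [s].
case: s => [|a s] sv.
  inversion sv; subst; exists 1, 0; split; last exact: lspan0.
  by rewrite scale1r addr0.
exists 0, v; split; first by rewrite scale0r add0r.
by apply: lspan_sub; exists (a :: s).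
Qed.

(** Sums of roots of [nu_0] do not vanish, so the weight of the generator for the
    Cartan subalgebra differs from those of all other reachable vectors. *)
Let other_weights b (u : M b) :
  lspan [set v | exists s, s != [::] /\ reachable s v] u ->
  lspan (other_eigen (@T b) (fun h => wt b [::] h)) u.
Proof.
apply: lspanS => v [s [s0 sv]]; exists (fun h => wt b s h); first exact: reachable_weight.
have [prb _ _] := psiP.
have := nil_root_sum_neq0 brP brR tP (prb 0%N) s0 (reachable_roots sv).
move=> /lfunPn[h]; rewrite zero_lfunE => sh; exists h; apply: contra_neq sh.
rewrite /wt big_nil scaler0 addr0 add_lfunE -[RHS]addr0 => /addrI.
rewrite scale_lfunE => /eqP; rewrite scaler_eq0 expf_eq0 oppr_eq0 oner_eq0 andbF /=.
by move=> /eqP.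
Qed.

Let T_linear b h : linear (@T b h).
Proof. exact: act_linear. Qed.

(** ** The form and its invariance *)

Local Notation inv := (@antipode _ _ cb).

Let inv_lin : linear inv. Proof. by have [] := antipodeP cb. Qed.
Let inv1 : inv 1 = 1. Proof. by have [] := antipodeP cb. Qed.
Let invM X Y : inv (X * Y) = inv Y * inv X. Proof. by have [] := antipodeP cb. Qed.
Let inv_gen v : inv (gen v) = - gen v. Proof. by have [] := antipodeP cb. Qed.

Let functional_minus Z : exists h : M true -> K,
  forall X, h (act X (w true)) = P (inv X * Z).
Proof.
apply: (@act_functional true (fun X => P (inv X * Z))).
  by move=> k X Y; rewrite inv_lin mulrDl -scalerAl Pl.
move=> X v vp; rewrite invM inv_gen !mulNr -mulrA -scaleN1r (linear_valZ Pl).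
rewrite (proj_character_left brP brR tP psiP lamP bmP blP bpP) //.
by rewrite /GRing.scale /= mulN1r mul1r mulrN mulrC.
Qed.

Let functional_plus Z : exists h : M false -> K,
  forall X, h (act X (w false)) = P (Z * X).
Proof.
apply: (@act_functional false (fun X => P (Z * X))).
  by move=> k X Y; rewrite mulrDr -scalerAr Pl.
move=> X v vp.
rewrite mulrA (proj_character_right brP brR tP psiP lamP bmP blP bpP) //.
by rewrite expr0 mul1r.
Qed.

Let lift b (m : M b) : U := sval (cid (act_generated m)).

Let liftE b (m : M b) : act (lift m) (w b) = m.
Proof. by rewrite /lift; case: cid. Qed.

Definition shapovalov_form (m : M true) (n : M false) : K := P (inv (lift m) * lift n).
Local Notation S := shapovalov_form.

(** The value does not depend on the representatives, because the functionals
    [X |-> P (inv X * Z)] and [X |-> P (Z * X)] factor through the two modules. *)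
Lemma shapovalov_formE X Y : S (act X (w true)) (act Y (w false)) = P (inv X * Y).
Proof.
rewrite /shapovalov_form; move: (liftE (act X (w true))) (liftE (act Y (w false))).
move: (lift (act X (w true))) (lift (act Y (w false))) => X' Y' EX EY.
have [h1 E1] := functional_minus Y'; have [h2 E2] := functional_plus (inv X).
by rewrite -E1 EX E1 -E2 EY E2.
Qed.

Lemma shapovalov_form_linearl n : linear ((S^~ n) : M true -> K^o).
Proof.
move=> k m m'; rewrite -(liftE m) -(liftE m') -(liftE n).
rewrite -(act_linearl (w true)) !shapovalov_formE inv_lin mulrDl -scalerAl.
exact: Pl.
Qed.

Lemma shapovalov_form_linearr m : linear (S m : M false -> K^o).
Proof.
move=> k n n'; rewrite -(liftE m) -(liftE n) -(liftE n').
rewrite -(act_linearl (w false)) !shapovalov_formE mulrDr -scalerAr.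
exact: Pl.
Qed.

Lemma shapovalov_form_inv Z m n : S (act Z m) n = S m (act (inv Z) n).
Proof.
rewrite -(liftE m) -(liftE n) -!actM !shapovalov_formE invM.
by rewrite mulrA.
Qed.

Lemma shapovalov_form_generators : S (w true) (w false) = 1.
Proof.
rewrite -(act1 (w true)) -(act1 (w false)) shapovalov_formE inv1 mulr1.
exact: (proj_character1 brP brR tP psiP lamP bmP blP bpP).
Qed.

Lemma shapovalov_form_weight (h : subvs_of t) (p q : K) m n :
  act (gen (eps i0 (vsval h))) m = p *: m -> act (gen (eps i0 (vsval h))) n = q *: n ->
  p + q != 0 -> S m n = 0.
Proof.
move=> hm hn pq; have := shapovalov_form_inv (gen (eps i0 (vsval h))) m n.
rewrite hm inv_gen -scaleN1r (linear_valZ (act_linearl n)) hn scalerA mulN1r.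
rewrite (linear_valZ (shapovalov_form_linearl n)) (linear_valZ (shapovalov_form_linearr m)).
move=> /eqP; rewrite -subr_eq0 -scalerBl opprK scaler_eq0 (negPf pq).
by move=> /eqP.
Qed.

(** ** Simplicity *)

Definition submodule b (W : set (M b)) : Prop :=
  [/\ W 0, forall k u v, W u -> W v -> W (k *: u + v) & forall X v, W v -> W (act X v)].

Definition simple b : Prop :=
  (exists m : M b, m != 0) /\ forall W : set (M b), submodule W -> W = [set 0] \/ W = setT.

Let generator_neq0 b : w b != 0.
Proof.
have n1 := oner_neq0 K; have w1 := shapovalov_form_generators; apply/eqP => w0.
move: w1; case: b w0 => ->.
  by rewrite (linear_val0 (shapovalov_form_linearl _)) => /eqP; rewrite eq_sym (negPf n1).
by rewrite (linear_val0 (shapovalov_form_linearr _)) => /eqP; rewrite eq_sym (negPf n1).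
Qed.

Let with_generator b : M b -> K :=
  match b return M b -> K with
  | true => fun m => S m (w false)
  | false => fun n => S (w true) n
  end.

Let with_generator_linear b : linear (@with_generator b : M b -> K^o).
Proof. by case: b; [exact: shapovalov_form_linearl|exact: shapovalov_form_linearr]. Qed.

Let with_generator_reachable b s (m : M b) : s != [::] -> reachable s m ->
  with_generator m = 0.
Proof.
move=> s0 sm; have [prb _ _] := psiP.
have := nil_root_sum_neq0 brP brR tP (prb 0%N) s0 (reachable_roots sm).
move=> /lfunPn[h]; rewrite zero_lfunE => sh.
have hm := reachable_weight sm h.
have hw b' := reachable_weight (reachable_nil b') h.
have sT : (-1) ^+ true = -1 :> K by [].
have sF : (-1) ^+ false = 1 :> K by [].
case: b m sm hm => m sm hm /=.
  apply: (shapovalov_form_weight hm (hw false)); rewrite /wt big_nil scaler0 addr0.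
  by rewrite add_lfunE !scale_lfunE -[~~ true]/false sT sF scaleN1r !scale1r addrAC addNr add0r.
apply: (shapovalov_form_weight (hw true) hm); rewrite /wt big_nil scaler0 addr0.
rewrite add_lfunE !scale_lfunE -[~~ false]/true sT sF !scaleN1r scale1r addKr.
by rewrite oppr_eq0.
Qed.

Let decomposition b (m : M b) : exists u,
  m = with_generator m *: w b + u /\ lspan (other_eigen (@T b) (fun h => wt b [::] h)) u.
Proof.
have [c [u [mE us]]] := weight_decomposition m.
exists u; split; last exact: other_weights.
have l0 : linset [set v : M b | with_generator v = 0].
  apply: (linset_eq (@with_generator_linear b) (f' := fun=> 0)) => k u1 u2.
  by rewrite scaler0 addr0.
have u0 : with_generator u = 0.
  by apply: (lspan_min l0 _ us) => v [s [s0 sv]] /=; exact: with_generator_reachable sv.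
have ww : with_generator (w b) = 1.
  by have := shapovalov_form_generators; case: (b).
rewrite {1}mE; congr (_ *: _ + _).
rewrite mE (linear_valD (@with_generator_linear b)) u0 addr0.
by rewrite (linear_valZ (@with_generator_linear b)) ww /GRing.scale /= mulr1.
Qed.

(** A submodule that contains a vector with a nonzero component along the
    generator contains the generator, since that component has a weight of its
    own. *)
Let proper_submodule b (W : set (M b)) : submodule W -> W <> setT ->
  forall m, W m -> with_generator m = 0.
Proof.
move=> [W0 Wl Wact] WT m Wm; apply/eqP; apply: contraT => mw.
have Wlin : linset W by split.
have [u [mE us]] := decomposition m.
have Ww : W (with_generator m *: w b).
  apply: (eigen_component (@T_linear b) Wlin _ _ us); last by rewrite -mE.
    by move=> h v; exact: Wact.
  apply: (linsetZ _ (joint_eigen_linset (@T_linear b) _)).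
  exact: (reachable_weight (reachable_nil b)).
case: WT; apply/seteqP; split=> // v _; have [X ->] := act_generated v.
apply: Wact; have := linsetZ (with_generator m)^-1 Wlin Ww.
by rewrite scalerA mulVf // scale1r.
Qed.

(** A proper submodule pairs to zero with the generator of the opposite module,
    hence with the whole opposite module, by invariance. *)
Lemma nondegenerate_simple :
    (forall m, (forall n, S m n = 0) -> m = 0) -> (forall n, (forall m, S m n = 0) -> n = 0) ->
  simple true /\ simple false.
Proof.
move=> radl radr; split; split; first by exists (w true); exact: generator_neq0.
- move=> W Wsub; have [->|WT] := pselect (W = setT); first by right.
  left; have W0 := proper_submodule Wsub WT; case: Wsub => W00 _ Wact.
  apply/seteqP; split=> m /= => [Wm|->//]; apply: radl => n.
  rewrite -(liftE n) -(antipodeK (lift n)) -shapovalov_form_inv.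
  exact/(W0 _)/Wact.
- by exists (w false); exact: generator_neq0.
move=> W Wsub; have [->|WT] := pselect (W = setT); first by right.
left; have W0 := proper_submodule Wsub WT; case: Wsub => W00 _ Wact.
apply/seteqP; split=> n /= => [Wn|->//]; apply: radr => m.
rewrite -(liftE m) shapovalov_form_inv.
exact/(W0 _)/Wact.
Qed.

(** The radicals are submodules that do not contain the generators. *)
Lemma simple_nondegenerate : simple true -> simple false ->
  (forall m, (forall n, S m n = 0) -> m = 0) /\ (forall n, (forall m, S m n = 0) -> n = 0).
Proof.
have n1 := oner_neq0 K; have ww := shapovalov_form_generators.
move=> [_ st] [_ sf]; split.
  have [|E|E] := st [set m | forall n, S m n = 0].
  - split=> [n|k u v u0 v0 n|X v v0 n].
    + exact: (linear_val0 (shapovalov_form_linearl n)).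
    + by rewrite shapovalov_form_linearl u0 v0 scaler0 addr0.
    + by rewrite shapovalov_form_inv.
  - by move=> m mr; have : [set m | forall n, S m n = 0] m by []; rewrite E.
  have : [set m | forall n, S m n = 0] (w true) by rewrite E.
  by move=> /(_ (w false)) => w0; move: n1; rewrite -ww w0 eqxx.
have [|E|E] := sf [set n | forall m, S m n = 0].
- split=> [m|k u v u0 v0 m|X v v0 m].
  + exact: (linear_val0 (shapovalov_form_linearr m)).
  + by rewrite shapovalov_form_linearr u0 v0 scaler0 addr0.
  + by rewrite -(antipodeK X) -shapovalov_form_inv.
- by move=> n nr; have : [set n | forall m, S m n = 0] n by []; rewrite E.
have : [set n | forall m, S m n = 0] (w false) by rewrite E.
by move=> /(_ (w true)) => w0; move: n1; rewrite -ww w0 eqxx.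
Qed.

Theorem shapovalov_pairing : exists S : M true -> M false -> K,
  [/\ (forall n, scalar (S^~ n)) /\ (forall m, scalar (S m)),
      forall X Y, S (act X (w true)) (act Y (w false)) = P (inv X * Y),
      (simple true /\ simple false) <->
      ((forall m, (forall n, S m n = 0) -> m = 0) /\
       (forall n, (forall m, S m n = 0) -> n = 0))
    & forall (h : subvs_of t) (p q : K) m n,
        act (gen (eps i0 (vsval h))) m = p *: m ->
        act (gen (eps i0 (vsval h))) n = q *: n -> p + q != 0 -> S m n = 0].
Proof.
exists S; split.
- by split=> [n|m]; [exact: shapovalov_form_linearl|exact: shapovalov_form_linearr].
- exact: shapovalov_formE.
- split=> [[st sf]|[radl radr]]; first exact: simple_nondegenerate.
  exact: nondegenerate_simple.
- exact: shapovalov_form_weight.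
Qed.

End ShapovalovForm.

(** * Singularity modules *)

Section SingularityModules.
Context {R : realType} {g : vectType R[i]} (br : g -> g -> g) (t : {vspace g}).
Local Notation K := R[i].
Hypothesis brP : is_lie_bracket br.
Hypothesis brR : is_reductive br.
Hypothesis tP : is_cartan br t.
Local Notation tdual := (tdual t).
Context {r : nat} (psi : nat -> set tdual) (lam : 'I_r -> tdual).
Hypothesis psiP : is_parabolic_filtration br r psi.
Hypothesis lamP : in_levi_dual br psi lam.
Local Notation cb := (@current_br _ g br r).
Local Notation par b := (@parabolic _ g br t r psi b).
Local Notation chi := (@chi _ g br t r lam).
Local Notation M b := (singularity_module br psi lam b).
Local Notation w b := (generator br psi lam b).

Local Notation chiU b := (@chi_Uparabolic _ g br t r psi lam b).
Local Notation incl b := (@Uparabolic_incl _ g br t r psi b).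

Let chiUP b : [/\ linear (chiU b), monoid_morphism (chiU b)
  & forall v, chiU b (env_gen (sub_br cb (W := par b)) v) = (-1) ^+ b * chi (vsval v)].
Proof.
apply: (@env_characterP _ _ cb (par b) _ (fun v => (-1) ^+ b * chi v)).
- by move=> u v; exact: (parabolic_br brP tP psiP).
- move=> k u v; rewrite (@chi_linear _ _ br t r lam) mulrDr.
  by rewrite /GRing.scale /= mulrCA.
- by move=> u v up vp; rewrite (chi_parabolic_br brP brR tP psiP lamP up vp) mulr0.
Qed.

Let inclP b : [/\ linear (incl b), monoid_morphism (incl b)
  & forall v, incl b (env_gen (sub_br cb (W := par b)) v) = env_gen cb (vsval v)].
Proof.
by apply: (@env_inclP _ _ cb (par b)) => u v; exact: (parabolic_br brP tP psiP).
Qed.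

Lemma module_action_generated b (m : M b) : exists X, m = module_action X (w b).
Proof.
have [X ->] := induced_generated m; exists X.
by rewrite [RHS]induced_act_tensor mulr1.
Qed.

Lemma module_action_par b v : v \in par b ->
  module_action (env_gen cb v) (w b) = ((-1) ^+ b * chi v) *: w b.
Proof.
move=> vp; have [_ _ ig] := inclP b; have [_ _ cg] := chiUP b.
rewrite [LHS]induced_act_tensor mulr1 -[X in tensor _ _ X]mul1r.
have -> : env_gen cb v = incl b (env_gen _ (vsproj (par b) v)) by rewrite ig vsprojK.
rewrite [LHS]tensor_balanced cg vsprojK // mulr1.
rewrite -[X in tensor _ _ 1 X]mulr1.
exact: (linear_valZ (tensor_linearr (incl b) (chiU b) 1)).
Qed.

Lemma module_action_functional b (f : env cb -> K^o) : linear f ->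
    (forall X v, v \in par b -> f (X * env_gen cb v) = f X * ((-1) ^+ b * chi v)) ->
  exists h : M b -> K, forall X, h (module_action X (w b)) = f X.
Proof.
move=> fl fpar; have [il [i1 iM] ig] := inclP b; have [cl [c1 cM] cg] := chiUP b.
have fc X c : f (X * incl b c) = f X * chiU b c.
  pose Q := [set c : env (sub_br cb (W := par b)) |
    forall X, f (X * incl b c) = f X * chiU b c].
  have Ql : linset Q := transforms_linset fl il cl.
  have Q1 : Q 1 by move=> Y; rewrite i1 c1 !mulr1.
  have Qall d : Q d; last exact: Qall.
  apply: (env_genind Ql Q1) => v {}d Qd Y.
  by rewrite iM cM ig cg !mulrA Qd fpar ?subvsP // !mulrA.
have [h hE] := induced_functional fl fc.
by exists h => X; rewrite -hE [X in h X]induced_act_tensor mulr1.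
Qed.

End SingularityModules.

Theorem mainTheorem14 (R : realType) (g : vectType R[i]) (br : g -> g -> g)
    (t : {vspace g}) (r : nat) (r_gt0 : (0 < r)%N)
    (psi : nat -> set (tdual t)) (lam : 'I_r -> tdual t)
    (bm : seq (current g r)) (bl : seq (subvs_of (levi br r psi)))
    (bp : seq (current g r)) :
  is_lie_bracket br -> is_reductive br -> is_cartan br t ->
  is_parabolic_filtration br r psi ->
  in_levi_dual br psi lam ->
  basis_of (nilradical br r psi true) bm ->
  basis_of fullv bl ->
  basis_of (nilradical br r psi false) bp ->
  let Mminus := singularity_module br psi lam true in
  let Mplus := singularity_module br psi lam false in
  let wminus : Mminus := generator br psi lam true in
  let wplus : Mplus := generator br psi lam false in
  exists S : Mminus -> Mplus -> R[i],
    [/\ (forall n, scalar (S^~ n)) /\ (forall m, scalar (S m)),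
        forall X Y : Ucurrent br r,
          S (module_action X wminus) (module_action Y wplus) =
          shapovalov lam bm bl bp X Y,
        (is_simple br psi lam true /\ is_simple br psi lam false) <->
        ((forall m, (forall n, S m n = 0) -> m = 0) /\
         (forall n, (forall m, S m n = 0) -> n = 0))
      & forall mu mu',
          weight_monoid psi mu -> weight_monoid psi mu' -> mu <> mu' ->
          forall m n, weight_space br lam r_gt0 true mu m ->
                      weight_space br lam r_gt0 false mu' n -> S m n = 0].
Proof.
move=> brP brR tP psiP lamP bmP blP bpP Mm Mp wm wp.
have [S [Slin SE Ssimple Sweight]] := @shapovalov_pairing _ _ _ _ brP brR tP _ r_gt0
  psi lam psiP lamP bm bl bp bmP blP bpP (singularity_module br psi lam)
  (@module_action _ _ br t r psi lam) (generator br psi lam)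
  (fun b X => induced_act_linear X) (fun b m => induced_act_linearl m)
  (fun b X Y m => induced_actM X Y m) (@module_action_generated _ _ br t r psi lam)
  (module_action_par brP brR tP psiP lamP) (module_action_functional brP brR tP psiP lamP).
exists S; split; [exact: Slin| |exact: Ssimple|].
  move=> X Y; exact: (SE X Y).
move=> mu mu' _ _ mu_neq m n hm hn.
have /lfunPn[X muX] : mu != mu' by exact/eqP.
apply: (Sweight _ _ _ _ _ (hm X) (hn X)).
have -> : (-1) ^+ true * (lam (Ordinal r_gt0) (vsval X) - mu X) +
    (-1) ^+ false * (lam (Ordinal r_gt0) (vsval X) - mu' X) = mu X - mu' X.
  by rewrite expr1 expr0; ring.
by rewrite subr_eq0.
Qed.
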